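(* Let $H_1,H_2,H_3$ be Hilbert spaces over the same field ($\mathbb{R}$ or $\mathbb{C}$). For $S\in\mathrm{Fr}(H_1,H_2)$ and $T\in\mathrm{Fr}(H_2,H_3)$ let $\phi_{S,T}:\mathrm{Det}(S)\otimes\mathrm{Det}(T)\to\mathrm{Det}(TS)$ be the isomorphism \[ \phi_{S,T}\big(\alpha_1\otimes(\pi_*\alpha_3\wedge\alpha_4)^*\otimes(\alpha_3\wedge S_*\alpha_2)\otimes\alpha_5^*\big)=(-1)^{\rho(S,T)}(\alpha_1\wedge\alpha_2)\otimes(\alpha_5\wedge T_*\alpha_4)^*, \] \[ \rho(S,T)=(\dim\ker S+\dim\ker TS)(\dim\mathrm{coker}\,T+\dim\mathrm{coker}\,TS), \] with $\alpha_1,\dots,\alpha_5$ as specified in the context. Then the collection of the isomorphisms $\phi_{S,T}$ is an analytic bundle morphism \[ \mathrm{Det}(\mathrm{Fr}(H_1,H_2))\otimes\mathrm{Det}(\mathrm{Fr}(H_2,H_3))\to\mathrm{Det}(\mathrm{Fr}(H_1,H_3)) \] which lifts the composition map $\mathrm{Fr}(H_1,H_2)\times\mathrm{Fr}(H_2,H_3)\to\mathrm{Fr}(H_1,H_3)$, $(S,T)\mapsto TS$, the domain being regarded as a line bundle over $\mathrm{Fr}(H_1,H_2)\times\mathrm{Fr}(H_2,H_3)$.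
   Context: $\mathrm{Fr}(H_i,H_j)$ is the open set of Fredholm operators in the Banach space $\mathrm{L}(H_i,H_j)$ of bounded operators. For finite dimensional $X$, $\mathrm{Det}(X)=\Lambda_{\max}(X)$ is the top exterior power; for a generator $\xi$ of a line, $\xi^*$ is the dual generator. $\mathrm{Det}(T):=\mathrm{Det}(\ker T)\otimes\mathrm{Det}(\mathrm{coker}\,T)^*$ for $T$ Fredholm. The determinant bundle $\mathrm{Det}(\mathrm{Fr}(H_1,H_2))\to\mathrm{Fr}(H_1,H_2)$ has fiber $\mathrm{Det}(T)$ at $T$, and its analytic line bundle structure is the one such that for every finite dimensional subspace $X\subset H_2$, over the open set $\mathcal{U}_X(H_1,H_2)=\{T\in\mathrm{Fr}(H_1,H_2): \mathrm{ran}\,T+X=H_2\}$, the isomorphisms $\psi_T:\mathrm{Det}(T)\to\mathrm{Det}(T^{-1}X)\otimes\mathrm{Det}(X)^*$, $\alpha\otimes(\pi_*\gamma)^*\mapsto(\alpha\wedge\beta)\otimes(\gamma\wedge T_*\beta)^*$, form an analytic bundle isomorphism onto the analytic line bundle with fiber $\mathrm{Det}(T^{-1}X)\otimes\mathrm{Det}(X)^*$; here $\alpha$ generates $\mathrm{Det}(\ker T)$, $\alpha\wedge\beta$ generates $\mathrm{Det}(T^{-1}X)$, $\gamma\wedge T_*\beta$ generates $\mathrm{Det}(X)$, and $\pi:X\to\mathrm{coker}\,T$ is the quotient projection. In the definition of $\phi_{S,T}$ one uses the exact sequence $0\to\ker S\to\ker TS\xrightarrow{S}\ker T\xrightarrow{\pi}\mathrm{coker}\,S\xrightarrow{T}\mathrm{coker}\,TS\to\mathrm{coker}\,T\to0$,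 where $\pi$ is the restriction of the quotient projection; $\alpha_1$ generates $\mathrm{Det}(\ker S)$, $\alpha_1\wedge\alpha_2$ generates $\mathrm{Det}(\ker TS)$, $\alpha_3\wedge S_*\alpha_2$ generates $\mathrm{Det}(\ker T)$, $\pi_*\alpha_3\wedge\alpha_4$ generates $\mathrm{Det}(\mathrm{coker}\,S)$, $\alpha_5\wedge T_*\alpha_4$ generates $\mathrm{Det}(\mathrm{coker}\,TS)$, and (the image of) $\alpha_5$ generates $\mathrm{Det}(\mathrm{coker}\,T)$. The $\alpha_i$ are homogeneous elements of the relevant exterior algebras; $\phi_{S,T}$ does not depend on their choice. *)

(* Defs.v *)
From HB Require Import structures.
From mathcomp Require Import all_boot all_order all_algebra.
From mathcomp Require Import generic_quotient.
From mathcomp Require Import complex.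
From mathcomp Require Import all_classical all_reals topology normedtype sequences.
Set Implicit Arguments.
Unset Strict Implicit.
Unset Printing Implicit Defensive.
Import Order.TTheory GRing.Theory Num.Theory.
Import numFieldNormedType.Exports.
Local Open Scope classical_set_scope.
Local Open Scope ring_scope.

Record subspace (K : fieldType) (V : lmodType K) := Subspace {
  sscar :> V -> Prop;
  ss0 : sscar 0;
  ssP : forall (a : K) x y, sscar x -> sscar y -> sscar (a *: x + y) }.

Section SubspaceType.
Variables (K : fieldType) (V : lmodType K) (X : subspace V).

Definition sspred : pred V := fun x => `[< X x >].

Lemma sspred_closed : GRing.submod_closed sspred.
Proof.
split; first by apply/asboolP; exact: ss0.
by move=> a x y /asboolP Xx /asboolP Xy; apply/asboolP; exact: ssP.
Qed.

HB.instance Definition _ := GRing.isSubmodClosed.Build K V sspred sspred_closed.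

Definition subsp : Type := {x : V | sspred x}.
HB.instance Definition _ := SubType.on subsp.
HB.instance Definition _ := Choice.on subsp.
HB.instance Definition _ := [SubChoice_isSubLmodule of subsp by <:].

End SubspaceType.

Section Quotient.
Variables (K : fieldType) (V : lmodType K) (X : subspace V).
Local Open Scope quotient_scope.

Lemma ssB x y : X x -> X y -> X (x - y).
Proof.
by move=> Xx Xy; rewrite addrC -scaleN1r; exact: ssP.
Qed.
Lemma ssN x : X x -> X (- x).
Proof. by move=> Xx; rewrite -sub0r; apply: ssB => //; exact: ss0. Qed.
Lemma ssD x y : X x -> X y -> X (x + y).
Proof. by move=> Xx Xy; rewrite -[x]scale1r; exact: ssP. Qed.
Lemma ssZ a x : X x -> X (a *: x).
Proof. by move=> Xx; rewrite -[_ *: _]addr0; apply: ssP => //; exact: ss0. Qed.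

Definition quot_rel : rel V := fun x y => `[< X (x - y) >].

Lemma quot_rel_equiv : equiv_class_of quot_rel.
Proof.
split=> [x|x y|y x z].
- by apply/asboolP; rewrite subrr; exact: ss0.
- by apply/asboolP/asboolP => /ssN; rewrite opprB.
- move=> /asboolP xy /asboolP yz; apply/asboolP.
  by have := ssD xy yz; rewrite addrA subrK.
Qed.

Canonical quot_equiv := EquivRelPack quot_rel_equiv.

Definition quot : Type := {eq_quot quot_equiv}.
HB.instance Definition _ := EqQuotient.on quot.
HB.instance Definition _ := Choice.on quot.

Definition quot_pi (x : V) : quot := \pi_quot x.

Lemma quot_piP x y : quot_pi x = quot_pi y <-> X (x - y).
Proof.
rewrite /quot_pi; split; first by move=> /eqquotP/asboolP.
by move=> h; apply/eqquotP/asboolP.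
Qed.

Lemma quot_repr c : quot_pi (repr c) = c.
Proof. exact: reprK. Qed.

Lemma quot_reprB x : X (repr (quot_pi x) - x).
Proof. by apply/quot_piP; exact: quot_repr. Qed.

Let add (c d : quot) : quot := quot_pi (repr c + repr d).
Let opp (c : quot) : quot := quot_pi (- repr c).
Let scale (a : K) (c : quot) : quot := quot_pi (a *: repr c).

Let addE x y : add (quot_pi x) (quot_pi y) = quot_pi (x + y).
Proof.
apply/quot_piP; rewrite opprD addrACA.
by apply: ssD; exact: quot_reprB.
Qed.
Let oppE x : opp (quot_pi x) = quot_pi (- x).
Proof. by apply/quot_piP; rewrite -opprD; apply/ssN/quot_reprB. Qed.
Let scaleE a x : scale a (quot_pi x) = quot_pi (a *: x).
Proof. by apply/quot_piP; rewrite -scalerBr; apply/ssZ/quot_reprB. Qed.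

Let quot_ind (P : quot -> Prop) : (forall x, P (quot_pi x)) -> forall c, P c.
Proof. by move=> h c; rewrite -[c]quot_repr. Qed.

Let addA : associative add.
Proof.
by elim/quot_ind=> x; elim/quot_ind=> y; elim/quot_ind=> z; rewrite !addE addrA.
Qed.
Let addC : commutative add.
Proof. by elim/quot_ind=> x; elim/quot_ind=> y; rewrite !addE addrC. Qed.
Let add0 : left_id (quot_pi 0) add.
Proof. by elim/quot_ind=> x; rewrite addE add0r. Qed.
Let addN : left_inverse (quot_pi 0) opp add.
Proof. by elim/quot_ind=> x; rewrite oppE addE addNr. Qed.

HB.instance Definition _ := GRing.isZmodule.Build quot addA addC add0 addN.

Let piD x y : quot_pi x + quot_pi y = quot_pi (x + y).
Proof. exact: addE. Qed.

Let scaleA a b c : scale a (scale b c) = scale (a * b) c.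
Proof. by elim/quot_ind: c => x; rewrite !scaleE scalerA. Qed.
Let scale1 : left_id 1 scale.
Proof. by elim/quot_ind => x; rewrite scaleE scale1r. Qed.
Let scaleDr : right_distributive scale +%R.
Proof.
move=> a; elim/quot_ind=> x; elim/quot_ind=> y.
by rewrite piD !scaleE piD scalerDr.
Qed.
Let scaleDl c : {morph scale^~ c : a b / a + b}.
Proof.
move=> a b; elim/quot_ind: c => x.
by rewrite !scaleE piD scalerDl.
Qed.

HB.instance Definition _ :=
  GRing.Zmodule_isLmodule.Build K quot scaleA scale1 scaleDr scaleDl.

Lemma quot_pi_is_linear : linear quot_pi.
Proof. by move=> a x y; rewrite -piD -scaleE. Qed.
HB.instance Definition _ :=
  GRing.isLinear.Build K V quot *:%R quot_pi quot_pi_is_linear.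

End Quotient.

Section SubspaceOps.
Variables (K : fieldType) (V W : lmodType K).

Definition ssub (X : subspace V) (x : V) (Xx : X x) : subsp X :=
  exist _ x (asboolT Xx).

Definition fullspace : subspace V :=
  @Subspace K V (fun=> True) I (fun _ _ _ _ _ => I).

Lemma span_closed0 (A : set V) :
  forall X : subspace V, (forall x, A x -> X x) -> X 0.
Proof. by move=> X _; exact: ss0. Qed.
Lemma span_closedP (A : set V) (a : K) x y :
  (forall X : subspace V, (forall x, A x -> X x) -> X x) ->
  (forall X : subspace V, (forall x, A x -> X x) -> X y) ->
  forall X : subspace V, (forall x, A x -> X x) -> X (a *: x + y).
Proof. by move=> Ax Ay X AX; apply: ssP; [exact: Ax|exact: Ay]. Qed.
Definition span (A : set V) : subspace V :=
  Subspace (@span_closed0 A) (@span_closedP A).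

Lemma mem_span (A : set V) x : A x -> span A x.
Proof. by move=> Ax X; exact. Qed.

Definition lker (f : {linear V -> W}) : subspace V.
Proof.
exists (fun x => f x = 0); first exact: linear0.
by move=> a x y fx fy; rewrite linearP fx fy scaler0 addr0.
Defined.

Definition lran (f : {linear V -> W}) : subspace W.
Proof.
exists (fun y => exists x, f x = y); first by exists 0; exact: linear0.
by move=> a _ _ [x <-] [y <-]; exists (a *: x + y); exact: linearP.
Defined.

Definition lpreim (f : {linear V -> W}) (X : subspace W) : subspace V.
Proof.
exists (fun x => X (f x)); first by rewrite linear0; exact: ss0.
by move=> a x y fx fy; rewrite linearP; exact: ssP.
Defined.

Definition is_basis (X : subspace V) (s : seq V) : Prop :=
  (forall x, X x <-> span [set` s] x) /\
  forall c : 'I_(size s) -> K,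
    \sum_(i < size s) c i *: s`_i = 0 -> forall i, c i = 0.

Definition finite_dim (X : subspace V) : Prop := exists s, is_basis X s.

(* Junk value 0 on infinite dimensional subspaces. *)
Definition dim (X : subspace V) : nat :=
  xget 0%N [set n | exists2 s, is_basis X s & size s = n].

End SubspaceOps.

Definition quot_map (K : fieldType) (V W : lmodType K) (X : subspace V)
    (Y : subspace W) (f : {linear V -> W}) (_ : forall x, X x -> Y (f x)) :
  quot X -> quot Y := fun c => quot_pi Y (f (repr c)).

Section QuotMap.
Variables (K : fieldType) (V W : lmodType K) (X : subspace V) (Y : subspace W).
Variables (f : {linear V -> W}) (fXY : forall x, X x -> Y (f x)).

Lemma quot_mapE x : quot_map fXY (quot_pi X x) = quot_pi Y (f x).
Proof. by apply/quot_piP; rewrite -linearB; apply/fXY/quot_reprB. Qed.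

Lemma quot_map_is_linear : linear (quot_map fXY).
Proof.
move=> a c d; rewrite -[c]quot_repr -[d]quot_repr -linearP !quot_mapE.
by rewrite !linearP.
Qed.
HB.instance Definition _ :=
  GRing.isLinear.Build K (quot X) (quot Y) *:%R (quot_map fXY) quot_map_is_linear.

End QuotMap.

Section DualTensor.
Variables (K : fieldType).

Definition dual_sub (V : lmodType K) : subspace (V -> K^o).
Proof.
exists (fun f => linear f).
  by move=> a x y /=; rewrite /GRing.zero/= addr0 scaler0.
move=> b f g fl gl a x y.
rewrite !fctE fl gl !scalerDr addrACA; congr (_ + _ + _).
by rewrite !scalerA mulrC.
Defined.

Definition dual (V : lmodType K) : Type := subsp (dual_sub V).
HB.instance Definition _ (V : lmodType K) := GRing.Lmodule.on (dual V).

Definition mkdual (V : lmodType K) (f : V -> K^o) (fl : linear f) : dual V :=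
  ssub (X := dual_sub V) fl.

(* On a line L with generator xi, dual_gen xi is the generator of the dual of
   L with value 1 at xi. *)
Definition dual_gen (L : lmodType K) (xi : L) : dual L :=
  xget 0 [set f : dual L | \val f xi = 1].

Definition bilinear_sub (V W : lmodType K) : subspace (V * W -> K^o).
Proof.
exists (fun b => (forall w, linear (fun v => b (v, w))) /\
                 (forall v, linear (fun w => b (v, w)))).
  by split=> ? a x y /=; rewrite /GRing.zero/= addr0 scaler0.
move=> c b b' [b1 b2] [b'1 b'2]; split=> z a x y.
  rewrite !fctE b1 b'1 !scalerDr addrACA; congr (_ + _ + _).
  by rewrite !scalerA mulrC.
rewrite !fctE b2 b'2 !scalerDr addrACA; congr (_ + _ + _).
by rewrite !scalerA mulrC.
Defined.

Definition bilinear_form (V W : lmodType K) : lmodType K :=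
  subsp (bilinear_sub V W).

Lemma eval_bilinear (V W : lmodType K) (v : V) (w : W) :
  linear (fun b : bilinear_form V W => \val b (v, w) : K^o).
Proof. by []. Qed.

(* V (x) W is realized inside the dual of the space of bilinear forms: v (x) w
   is b |-> b (v, w), and V (x) W is spanned by these functionals.  Over a field
   this is the usual tensor product. *)
Definition pure_tensor (V W : lmodType K) (v : V) (w : W) :
  dual (bilinear_form V W) := mkdual (eval_bilinear v w).

Definition tensor_sub (V W : lmodType K) : subspace (dual (bilinear_form V W)) :=
  span [set pure_tensor vw.1 vw.2 | vw in [set: V * W]].

Definition tensor (V W : lmodType K) : lmodType K := subsp (tensor_sub V W).

Lemma pure_tensor_sub (V W : lmodType K) (v : V) (w : W) :
  tensor_sub V W (pure_tensor v w).
Proof. by apply: mem_span; exists (v, w). Qed.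

Definition tens (V W : lmodType K) (v : V) (w : W) : tensor V W :=
  ssub (pure_tensor_sub v w).

End DualTensor.

Notation "x ⊗ y" := (tens x y) (at level 40, left associativity) : ring_scope.

Section Exterior.
Variables (K : fieldType).

(* Alternating forms of all degrees at once: the restriction of w to sequences
   of size n is an alternating n-linear form. *)
Definition altform_sub (V : lmodType K) : subspace (seq V -> K^o).
Proof.
exists (fun w => (forall s t, linear (fun x => w (s ++ x :: t))) /\
                 (forall s t u x, w (s ++ x :: t ++ x :: u) = 0)).
  by split=> // s t a x y; rewrite /GRing.zero/= addr0 scaler0.
move=> c w w' [w1 w2] [w'1 w'2]; split=> [s t a x y|s t u x].
  rewrite !fctE w1 w'1 !scalerDr addrACA; congr (_ + _ + _).
  by rewrite !scalerA mulrC.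
by rewrite !fctE w2 w'2 scaler0 addr0.
Defined.

Definition altform (V : lmodType K) : lmodType K := subsp (altform_sub V).

Lemma altform_eq (V : lmodType K) (w w' : altform V) :
  (forall s, \val w s = \val w' s) -> w = w'.
Proof. by move=> ww'; apply/val_inj/funext. Qed.

(* blade [:: v_1; ...; v_n] = v_1 /\ ... /\ v_n is realized as the functional
   w |-> w [:: v_1; ...; v_n] on alternating forms.  The n-th exterior power of
   V is the span of the blades of size n inside (multivec V); over a field this
   is the usual exterior power. *)
Definition multivec (V : lmodType K) : lmodType K := dual (altform V).

Lemma blade_linear (V : lmodType K) (s : seq V) :
  linear (fun w : altform V => \val w s : K^o).
Proof. by []. Qed.

Definition blade (V : lmodType K) (s : seq V) : multivec V :=
  mkdual (blade_linear s).

(* For a subspace X of V, Lambda^k(X) is seen as a subspace of Lambda^k(V). *)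
Definition ext_pow (V : lmodType K) (k : nat) (X : subspace V) :
    subspace (multivec V) :=
  span [set blade s | s in [set s | size s = k /\ forall x, x \in s -> X x]].

Definition homogeneous (V : lmodType K) (X : subspace V) (a : multivec V) :
    Prop :=
  exists k, ext_pow k X a.

Section Wedge.
Variable V : lmodType K.
Implicit Types (a b : multivec V) (w : altform V) (s t : seq V).

Lemma altform_cat_sub w s : altform_sub V (fun t => \val w (s ++ t)).
Proof.
case: w => w /= /asboolP[w1 w2]; split=> [t u|t u r x].
  by move=> c x y; rewrite !catA w1.
by rewrite catA w2.
Qed.
Definition altform_cat w s : altform V := ssub (altform_cat_sub w s).

Lemma wedge_sub b w : altform_sub V (fun s => \val b (altform_cat w s)).
Proof.
case: b => b /= /asboolP bl; case: w => w /= hw; have /asboolP[w1 w2] := hw.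
split=> [s t c x y|s t u x].
  rewrite -bl; congr b; apply: altform_eq => r /=.
  by rewrite !fctE -!catA w1.
rewrite [X in b X](_ : _ = 0).
  by have := bl (-1) 0 0; rewrite scaler0 addr0 scaleN1r addNr.
by apply: altform_eq => r /=; rewrite -catA /= -catA /= w2.
Qed.
Definition wedge_form b w : altform V := ssub (wedge_sub b w).

Lemma wedge_linear a b : linear (fun w => \val a (wedge_form b w) : K^o).
Proof.
case: a => a /= /asboolP al c w w'; rewrite -al; congr a.
apply: altform_eq => s /=; rewrite !fctE.
case: b => b /= /asboolP bl; rewrite -bl; congr b.
exact: altform_eq.
Qed.

(* The product on multivectors, with blade s /\ blade t = blade (s ++ t). *)
Definition wedge a b : multivec V := mkdual (wedge_linear a b).

Lemma wedge_blade s t : wedge (blade s) (blade t) = blade (s ++ t).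
Proof. by apply/val_inj/funext. Qed.

End Wedge.

Section ExtMap.
Variables (V W : lmodType K) (f : {linear V -> W}).

Lemma altform_pull_sub (w : altform W) :
  altform_sub V (fun s => \val w (map f s)).
Proof.
case: w => w /= /asboolP[w1 w2]; split=> [s t c x y|s t u x].
  by rewrite !map_cat /= linearP w1.
by rewrite map_cat /= map_cat w2.
Qed.
Definition altform_pull (w : altform W) : altform V :=
  ssub (altform_pull_sub w).

Lemma ext_map_linear (a : multivec V) :
  linear (fun w => \val a (altform_pull w) : K^o).
Proof.
case: a => a /= /asboolP al c w w'; rewrite -al; congr a; exact: altform_eq.
Qed.

Definition ext_map (a : multivec V) : multivec W := mkdual (ext_map_linear a).

Lemma ext_map_blade s : ext_map (blade s) = blade (map f s).
Proof. by apply/val_inj/funext. Qed.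

End ExtMap.

Definition Det (V : lmodType K) (X : subspace V) : lmodType K :=
  subsp (ext_pow (dim X) X).

Definition generates (V : lmodType K) (X : subspace V) (a : multivec V) : Prop :=
  ext_pow (dim X) X a /\ a <> 0.

(* a as an element of Det X; only used when a lies in Det X. *)
Definition in_Det (V : lmodType K) (X : subspace V) (a : multivec V) : Det X :=
  insubd (0 : Det X) a.

End Exterior.

Notation "a ∧ b" := (wedge a b) (at level 40, left associativity) : ring_scope.

Variant scalar_kind := RealScalars | ComplexScalars.

Definition scalars (R : realType) (k : scalar_kind) : numFieldType :=
  match k with RealScalars => R | ComplexScalars => R[i] end.

Definition conj (R : realType) (k : scalar_kind) :
    scalars R k -> scalars R k :=
  match k return scalars R k -> scalars R k with
  | RealScalars => id | ComplexScalars => @conjc R end.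

Record hilbertType (R : realType) (k : scalar_kind) := Hilbert {
  hilbert_sort :> completeNormedModType (scalars R k);
  inner : {dot hilbert_sort for @conj R k};
  inner_norm : forall x, inner x x = `|x| ^+ 2 }.

Section ScalarsTheory.
Variables (R : realType) (k : scalar_kind).

Definition of_real (k : scalar_kind) : R -> scalars R k :=
  match k return R -> scalars R k with
  | RealScalars => id | ComplexScalars => real_complex R end.

Definition to_real (k : scalar_kind) : scalars R k -> R :=
  match k return scalars R k -> R with
  | RealScalars => id | ComplexScalars => @complex.Re R end.

Lemma of_realD x y : of_real k (x + y) = of_real k x + of_real k y.
Proof. by case: k => //=; rewrite rmorphD. Qed.
Lemma of_realM x y : of_real k (x * y) = of_real k x * of_real k y.
Proof. by case: k => //=; rewrite rmorphM. Qed.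
Lemma of_real0 : of_real k 0 = 0.
Proof. by case: k. Qed.
Lemma of_real_le x y : (of_real k x <= of_real k y) = (x <= y).
Proof. by case: k => //=; rewrite lecR. Qed.
Lemma to_realK (z : scalars R k) : 0 <= z -> of_real k (to_real z) = z.
Proof.
by case: k z => //= z; rewrite lecE /= => /andP[/eqP z0 _]; case: z z0 => a b /= ->.
Qed.
Lemma of_realK x : to_real (of_real k x) = x.
Proof. by case: k. Qed.

End ScalarsTheory.

Section BoundedOperators.
Variables (R : realType) (k : scalar_kind).
Local Notation K := (scalars R k).

Definition bop_sub (V W : normedModType K) : subspace (V -> W).
Proof.
exists (fun f => linear f /\ exists M, forall x, `|f x| <= M * `|x|).
  split; first by move=> a x y; rewrite /GRing.zero/= addr0 scaler0.
  by exists 0 => x; rewrite /GRing.zero/= normr0 mul0r.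
move=> a f g [fl [M fM]] [gl [N gN]]; split=> [b x y|].
  rewrite !fctE fl gl !scalerDr addrACA; congr (_ + _ + _).
  by rewrite !scalerA mulrC.
exists (`|a| * M + N) => x; rewrite !fctE (le_trans (ler_normD _ _))// mulrDl.
by rewrite lerD// normrZ -mulrA ler_wpM2l.
Defined.

Definition bop (V W : normedModType K) : Type := subsp (bop_sub V W).
HB.instance Definition _ (V W : normedModType K) := GRing.Lmodule.on (bop V W).

Definition bop_fun (V W : normedModType K) (T : bop V W) : V -> W := \val T.
Coercion bop_fun : bop >-> Funclass.

Lemma bop_is_linear (V W : normedModType K) (T : bop V W) : linear T.
Proof. by have /asboolP[] := valP T. Qed.
HB.instance Definition _ (V W : normedModType K) (T : bop V W) :=
  GRing.isLinear.Build K V W *:%R (bop_fun T) (bop_is_linear T).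

Lemma bop_bounded (V W : normedModType K) (T : bop V W) :
  exists M, forall x, `|T x| <= M * `|x|.
Proof. by have /asboolP[] := valP T. Qed.

Section OperatorNorm.
Variables V W : normedModType K.
Implicit Types T : bop V W.

Let unit_values T : set R :=
  [set to_real `|T x| | x in [set x : V | `|x| <= 1]].

Definition opnorm T : K := of_real k (sup (unit_values T)).

Let unit_values_sup T : has_sup (unit_values T).
Proof.
split; first by exists (to_real `|T 0|), 0 => //=; rewrite normr0 ler01.
have [M TM] := bop_bounded T; exists (to_real `|M|) => _ [x x1 <-].
rewrite -(of_real_le k) !to_realK//; apply: le_trans (TM x) _.
have [->|x0] := eqVneq x 0; first by rewrite normr0 mulr0.
have x_gt0 : 0 < `|x| by rewrite normr_gt0.
have M0 : 0 <= M.
  by rewrite -(pmulr_lge0 _ x_gt0); apply: le_trans (TM x).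
by rewrite ger0_norm// ler_piMr.
Qed.

Lemma opnorm_ge0 T : 0 <= opnorm T.
Proof.
rewrite -(of_real0 R k) of_real_le.
apply: (@le_trans _ _ (to_real `|T 0|)).
  by rewrite -(of_real_le k) of_real0 to_realK.
apply: ub_le_sup; first by have [] := unit_values_sup T.
by exists 0 => //=; rewrite normr0.
Qed.

Lemma opnorm_bound T x : `|T x| <= opnorm T * `|x|.
Proof.
have [->|x0] := eqVneq x 0; first by rewrite linear0 !normr0 mulr0.
have x_gt0 : 0 < `|x| by rewrite normr_gt0.
rewrite -ler_pdivrMr// -[leLHS]ger0_norm ?divr_ge0// normrM normr_id.
have <- : `| `|x|^-1 *: T x| = `|T x| * `| `|x|^-1|.
  by rewrite normrZ mulrC.
rewrite -linearZ /= /opnorm -[leLHS]to_realK// of_real_le.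
apply: ub_le_sup; first by have [] := unit_values_sup T.
exists (`|x|^-1 *: x) => //=.
by rewrite normrZ normfV normr_id mulVf// gt_eqF.
Qed.

Lemma opnorm_le T (M : K) : 0 <= M -> (forall x, `|T x| <= M * `|x|) ->
  opnorm T <= M.
Proof.
move=> M0 TM; rewrite -(to_realK M0) of_real_le; apply: ge_sup.
  by have [] := unit_values_sup T.
move=> _ [x /= x1 <-]; rewrite -(of_real_le k) !to_realK//.
by apply: le_trans (TM x) _; rewrite ler_piMr.
Qed.

Let opnormD T T' : opnorm (T + T') <= opnorm T + opnorm T'.
Proof.
apply: opnorm_le => [|x]; first by rewrite addr_ge0// opnorm_ge0.
rewrite mulrDl; apply: le_trans (ler_normD _ _) _.
by apply: lerD; exact: opnorm_bound.
Qed.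

Let opnormZ_le a T : opnorm (a *: T) <= `|a| * opnorm T.
Proof.
apply: opnorm_le => [|x]; first by rewrite mulr_ge0// opnorm_ge0.
by rewrite -mulrA [leLHS]normrZ ler_wpM2l// opnorm_bound.
Qed.

Let opnormZ a T : opnorm (a *: T) = `|a| * opnorm T.
Proof.
apply/eqP; rewrite eq_le opnormZ_le /=.
have [->|a0] := eqVneq a 0; first by rewrite normr0 mul0r opnorm_ge0.
rewrite -ler_pdivlMl ?normr_gt0//.
by rewrite -{1}[T](scalerK a0) (le_trans (opnormZ_le _ _))// normfV.
Qed.

Let opnorm0 T : opnorm T = 0 -> T = 0.
Proof.
move=> T0; apply/val_inj/funext => x; apply/eqP; rewrite -normr_le0.
by rewrite (le_trans (opnorm_bound T x))// T0 mul0r.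
Qed.

HB.instance Definition _ := Lmodule_isNormed.Build K (bop V W)
  opnormD opnormZ opnorm0.

End OperatorNorm.
End BoundedOperators.

Section Composition.
Variables (R : realType) (k : scalar_kind).
Variables (V1 V2 V3 : normedModType (scalars R k)).
Variables (T : bop V2 V3) (S : bop V1 V2).

Lemma bop_comp_sub : bop_sub V1 V3 (T \o S).
Proof.
split=> [a x y|]; first by rewrite /= !linearP.
exists (opnorm T * opnorm S) => x /=; rewrite -mulrA.
by rewrite (le_trans (opnorm_bound _ _))// ler_wpM2l ?opnorm_ge0 ?opnorm_bound.
Qed.

Definition bop_comp : bop V1 V3 := ssub bop_comp_sub.

End Composition.

Section Fredholm.
Variables (R : realType) (k : scalar_kind).

Definition coker (V W : normedModType (scalars R k)) (T : bop V W) :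
    lmodType (scalars R k) :=
  quot (lran T).

(* The range of such an operator between Banach spaces is closed. *)
Definition fredholm (V W : normedModType (scalars R k)) (T : bop V W) : Prop :=
  finite_dim (lker T) /\ finite_dim (fullspace (coker T)).

(* Det (ker T) (x) Det (coker T)^* *)
Definition DetF (V W : normedModType (scalars R k)) (T : bop V W) :
    lmodType (scalars R k) :=
  tensor (Det (lker T)) (dual (Det (fullspace (coker T)))).

Variables (V1 V2 V3 : normedModType (scalars R k)).
Variables (S : bop V1 V2) (T : bop V2 V3).

Lemma coker_comp_sub y : lran S y -> lran (bop_comp T S) (T y).
Proof. by move=> [x <-]; exists x. Qed.

Lemma coker_proj_sub z : lran (bop_comp T S) z -> lran T (idfun z).
Proof. by move=> [x <-]; exists (S x). Qed.

Definition coker_comp : coker S -> coker (bop_comp T S) :=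
  quot_map (f := T) coker_comp_sub.
HB.instance Definition _ := GRing.Linear.on coker_comp.

Definition coker_proj : coker (bop_comp T S) -> coker T :=
  quot_map (f := idfun) coker_proj_sub.
HB.instance Definition _ := GRing.Linear.on coker_proj.

End Fredholm.
Arguments coker_comp {R k V1 V2 V3} S T _.
Arguments coker_proj {R k V1 V2 V3} S T _.

Section Analytic.
Variable K : numFieldType.

Definition multilinear_map (E F : normedModType K) n (A : ('I_n -> E) -> F) :
    Prop :=
  forall (i : 'I_n) (v : 'I_n -> E), linear (fun x : E => A (@dfwith 'I_n (fun=> E) v i x)).

(* f is the sum near a of a power series sum_n A_n (h, ..., h) with bounded
   n-linear A_n such that |A_n| <= M * rho ^ n, i.e. whose radius of convergence
   is positive. *)
Definition analytic_at (E F : normedModType K) (f : E -> F) (a : E) : Prop :=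
  exists (A : forall n, ('I_n -> E) -> F) (M rho : K),
    [/\ forall n, multilinear_map (A n),
        forall n v, `|A n v| <= M * rho ^+ n * \prod_(i < n) `|v i|
      & \forall h \near (0 : E),
          series (fun n => A n (fun=> h)) @ \oo --> f (a + h)].

(* An analytic line bundle over the open subset base of B, given by an atlas of
   local trivializations v_b : fiber b -> K (b in an open set U).  These are
   encoded by the local frames s b = v_b^-1 (1): frame U s means that s is the
   frame of a trivialization over U of the atlas.  The values of fiber off base
   and those of s off U are junk. *)
Record line_bundle (B : normedModType K) := LineBundle {
  base : set B;
  fiber : B -> lmodType K;
  frame : set B -> (forall b, fiber b) -> Prop }.
Arguments frame {B} _ _ _.

Definition ext_tensor (B1 B2 : normedModType K)
    (E1 : line_bundle B1) (E2 : line_bundle B2) : line_bundle (B1 * B2)%type :=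
  {| base := base E1 `*` base E2;
     fiber := fun b => tensor (fiber E1 b.1) (fiber E2 b.2);
     frame := fun U s => exists U1 s1 U2 s2,
       [/\ frame E1 U1 s1, frame E2 U2 s2, U = U1 `*` U2
         & forall b, s b = s1 b.1 ⊗ s2 b.2] |}.

(* In local frames s and t around b and f b, phi is given by the scalar function
   g such that phi (s) = g * t; phi is analytic when f and all these g are.  The
   third condition says that the atlases cover b and f b. *)
Definition analytic_bundle_morphism (B B' : normedModType K)
    (E : line_bundle B) (F : line_bundle B') (f : B -> B')
    (phi : forall b, fiber E b -> fiber F (f b)) : Prop :=
  [/\ forall b, base E b -> base F (f b) /\ analytic_at f b,
      forall b, base E b -> linear (phi b),
      forall b, base E b ->
        (exists U s, frame E U s /\ U b) /\
        (exists V t, frame F V t /\ V (f b))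
    & forall b U s V t, base E b ->
        frame E U s -> U b -> frame F V t -> V (f b) ->
        exists2 g : B -> K, analytic_at (g : B -> K^o) b
          & \forall b' \near b, phi b' (s b') = g b' *: t (f b')].

End Analytic.
Arguments frame {K B} _ _ _.

Section DetBundle.
Variables (R : realType) (k : scalar_kind).
Variables V W : normedModType (scalars R k).
Implicit Types (T : bop V W) (X : subspace W).

Definition transversal X : set (bop V W) :=
  [set T | fredholm T /\ forall y, exists x z, X z /\ y = T x + z].

Definition DetX X T : lmodType (scalars R k) :=
  tensor (Det (lpreim T X)) (dual (Det X)).

Definition is_psi X T (f : DetF T -> DetX X T) : Prop :=
  linear f /\
  forall (a b : multivec V) (c : multivec W),
    homogeneous (lpreim T X) b -> homogeneous X c ->
    generates (lker T) a ->
    generates (lpreim T X) (a ∧ b) ->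
    generates X (c ∧ ext_map T b) ->
    f (in_Det (lker T) a
         ⊗ dual_gen (in_Det (fullspace (coker T)) (ext_map (quot_pi (lran T)) c)))
    = in_Det (lpreim T X) (a ∧ b) ⊗ dual_gen (in_Det X (c ∧ ext_map T b)).

(* is_psi determines a unique map when T is transversal to X and X is finite
   dimensional; 0 is a junk value. *)
Definition psi X T : DetF T -> DetX X T := xget (fun=> 0) [set f | @is_psi X T f].

(* The bundle with fiber Det (T^-1 X) (x) Det(X)^*.  Its structure is the
   pull-back by T |-> T^-1 X of that of the tautological determinant bundle
   over the Grassmannian of finite dimensional subspaces of V, trivialized by
   the usual graph charts: for a bounded projector P of finite rank, Y |-> Det Y
   is trivialized over the open set of the Y which P maps isomorphically onto
   ran P, by Det Y -> Det (ran P), theta |-> P_* theta. *)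
Definition DetX_bundle X : line_bundle (bop V W) :=
  {| base := transversal X;
     fiber := DetX X;
     frame := fun U s =>
       exists (P : bop V V) (theta0 : multivec V) (xi : Det X),
       [/\ (forall x, P (P x) = P x) /\ finite_dim (lran P),
           generates (lran P) theta0,
           xi <> 0,
           U = transversal X `&`
               [set T | (forall x, X (T x) -> P x = 0 -> x = 0) /\
                        (forall y, lran P y -> exists x, X (T x) /\ P x = y)]
         & forall T, U T -> exists theta,
             [/\ generates (lpreim T X) theta, ext_map P theta = theta0
               & s T = in_Det (lpreim T X) theta ⊗ dual_gen xi]] |}.

(* Over transversal X the frames are those transported from DetX_bundle X by
   the isomorphisms psi X T. *)
Definition Det_bundle : line_bundle (bop V W) :=
  {| base := @fredholm R k V W;
     fiber := @DetF R k V W;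
     frame := fun U s => exists X, finite_dim X /\
       frame (DetX_bundle X) U (fun T => psi X (s T)) |}.

End DetBundle.

Section Phi.
Variables (R : realType) (k : scalar_kind).
Variables V1 V2 V3 : normedModType (scalars R k).
Variables (S : bop V1 V2) (T : bop V2 V3).
Local Notation TS := (bop_comp T S).

Definition rho : nat :=
  ((dim (lker S) + dim (lker TS)) *
  (dim (fullspace (coker T)) + dim (fullspace (coker TS))))%N.

Definition is_phi (f : tensor (DetF S) (DetF T) -> DetF TS) : Prop :=
  linear f /\
  forall (a1 a2 : multivec V1) (a3 : multivec V2) (a4 : multivec (coker S))
         (a5 : multivec (coker TS)),
    homogeneous (lker TS) a2 ->
    homogeneous (lker T) a3 ->
    homogeneous (fullspace (coker S)) a4 ->
    homogeneous (fullspace (coker TS)) a5 ->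
    generates (lker S) a1 ->
    generates (lker TS) (a1 ∧ a2) ->
    generates (lker T) (a3 ∧ ext_map S a2) ->
    generates (fullspace (coker S)) (ext_map (quot_pi (lran S)) a3 ∧ a4) ->
    generates (fullspace (coker TS)) (a5 ∧ ext_map (coker_comp S T) a4) ->
    generates (fullspace (coker T)) (ext_map (coker_proj S T) a5) ->
    f ((in_Det (lker S) a1
          ⊗ dual_gen (in_Det (fullspace (coker S))
                             (ext_map (quot_pi (lran S)) a3 ∧ a4)))
         ⊗ (in_Det (lker T) (a3 ∧ ext_map S a2)
            ⊗ dual_gen (in_Det (fullspace (coker T))
                               (ext_map (coker_proj S T) a5))))
    = (-1) ^+ rho *:
      (in_Det (lker TS) (a1 ∧ a2)
       ⊗ dual_gen (in_Det (fullspace (coker TS))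
                          (a5 ∧ ext_map (coker_comp S T) a4))).

(* is_phi determines a unique map when S and T are Fredholm; 0 is a junk value. *)
Definition phi : tensor (DetF S) (DetF T) -> DetF TS :=
  xget (fun=> 0) [set f | is_phi f].

End Phi.
Arguments phi {R k V1 V2 V3} S T _.
Arguments is_phi {R k V1 V2 V3} S T _.

(* Main.v *)
From HB Require Import structures.
From mathcomp Require Import all_boot all_order all_algebra.
From mathcomp Require Import perm complex ring lra.
From mathcomp Require Import all_classical all_reals topology normedtype sequences.
Require Import Defs.
Set Implicit Arguments.
Unset Strict Implicit.
Unset Printing Implicit Defensive.
Import Order.TTheory GRing.Theory Num.Theory.
Import numFieldNormedType.Exports.
Local Open Scope classical_set_scope.
Local Open Scope ring_scope.

(** Let X be a finite dimensional subspace transversal to TS and N = T^-1 X.  Then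
    X is transversal to T, N is transversal to S and (TS)^-1 X = S^-1 N.  Through
    the isomorphisms psi, the lines Det S, Det T and Det TS become
    Det (S^-1 N) (x) Det N^*, Det N (x) Det X^* and Det (S^-1 N) (x) Det X^*, and
    phi becomes the contraction of Det N^* with Det N (phi_contracts).  The sign
    (-1)^rho is exactly what this takes: it moves S_* alpha_2, of degree
    dim ker TS - dim ker S, past a lift of alpha_4, of degree
    dim coker TS - dim coker T (contracts_is_phi).  This gives the existence of
    phi and its bijectivity.

    The frames of the three bundles are given by unrelated subspaces X1, X2, X3.
    With X = X3, the frame of Det TS is adapted to the contraction, and it remains
    to compare, on Det S, the frame given by X1 with the element given by N, and,
    on Det T, the frame given by X2 with the element given by X3
    (phi_in_frames).  For two subspaces X and X' transversal to S, the elements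
    of Det S which correspond to generators t (x) x^* of Det (S^-1 X) (x) Det X^*
    and t' (x) x'^* of Det (S^-1 X') (x) Det X'^* are compared in the space Z of
    the (v, y) in V x W with y in X and S v - y in X': up to sign, their ratio is
    that of the generators of Det Z defined by t, x' and by t', x (comparison).
    When t' is normalized by a projector P', as in the graph charts of the
    Grassmannian, this ratio is the determinant of a matrix whose entries are
    values of fixed linear forms at vectors built from S, from factors u_i and
    x'_j of t and x', and from a section E of S modulo X (comparison_det).

    It remains to choose u, x' and E analytic in the operators.  In the chart of
    a projector P, near an operator T0, let E(T) be the section of T modulo X with
    values in the kernel of P.  Then T^-1 X consists of the u0 - E(T) T u0 with u0
    in T0^-1 X.  The section E(T0) is bounded by the closed graph theorem
    (chart_section), and E(T) is the sum of a Neumann series (neumann_inverse).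
    Sums of analytic maps and their images under bounded bilinear maps are
    analytic (analytic_bilinear); determinants and compositions of operators are
    obtained in this way. *)

(** * Subspaces and linear forms *)

Arguments sscar : simpl never.

Definition linear_of (K : fieldType) (V W : lmodType K) (f : V -> W)
  (fl : linear f) : {linear V -> W} :=
  HB.pack f (GRing.isLinear.Build K V W *:%R f fl).

Section Subspaces.
Variables (K : fieldType) (V : lmodType K).
Implicit Types (X : subspace V) (s t : seq V).

Lemma subspace_eq X (Y : subspace V) : (forall x, X x <-> Y x) -> X = Y.
Proof.
case: X Y => [X X0 XP] [Y Y0 YP] /= XY.
have E : X = Y by apply/funext => x; apply/propext.
by subst Y; congr Subspace; exact: Prop_irrelevance.
Qed.

Lemma span_ind (A : set V) (P : V -> Prop) : P 0 ->
  (forall a y z, P y -> P z -> P (a *: y + z)) ->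
  (forall y, A y -> P y) -> forall x, span A x -> P x.
Proof. by move=> P0 PP AP x /(_ (Subspace P0 PP)); apply. Qed.

Lemma span_sub (A B : set V) x :
  (forall y, A y -> span B y) -> span A x -> span B x.
Proof. by move=> AB; apply. Qed.

Lemma mem_spans s x : x \in s -> span [set` s] x.
Proof. by move=> xs; exact: mem_span. Qed.

Lemma span_subset s t x : {subset s <= t} -> span [set` s] x -> span [set` t] x.
Proof. by move=> st; apply: span_sub => y /st /mem_spans. Qed.

Lemma ss_sum (X : subspace V) (I : Type) (r : seq I) (F : I -> V) :
  (forall i, X (F i)) -> X (\sum_(i <- r) F i).
Proof.
move=> XF; elim/big_ind: _ => //; [exact: ss0|exact: ssD].
Qed.

Lemma span_comb s x : span [set` s] x ->
  exists c : nat -> K, x = \sum_(i < size s) c i *: s`_i.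
Proof.
move: x; apply: span_ind.
- by exists (fun=> 0); rewrite big1// => i _; rewrite scale0r.
- move=> a _ _ [c ->] [d ->]; exists (fun i => a * c i + d i).
  rewrite scaler_sumr -big_split /=; apply: eq_bigr => i _.
  by rewrite scalerDl scalerA.
- move=> y ys; exists (fun i => (i == index y s)%:R).
  have ys' : (index y s < size s)%N by rewrite index_mem.
  rewrite (bigD1 (Ordinal ys'))//= eqxx scale1r nth_index// big1 ?addr0// => i.
  by rewrite -val_eqE /= => /negbTE ->; rewrite scale0r.
Qed.

Lemma span_cons x s y : span [set` x :: s] y ->
  exists a z, span [set` s] z /\ y = a *: x + z.
Proof.
move: y; apply: span_ind.
- by exists 0, 0; split; [exact: ss0|rewrite scale0r addr0].
- move=> a _ _ [b [z [sz ->]]] [c [w [sw ->]]].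
  exists (a * b + c), (a *: z + w); split; first exact: ssP.
  by rewrite scalerDr scalerA scalerDl addrACA.
- move=> z zs; have := zs : z \in x :: s; rewrite inE => /orP[/eqP ->|zs'].
    by exists 1, 0; split; [exact: ss0|rewrite scale1r addr0].
  by exists 0, z; split; [exact: mem_spans|rewrite scale0r add0r].
Qed.

Lemma span_cat s t x : span [set` s ++ t] x ->
  exists y z, [/\ span [set` s] y, span [set` t] z & x = y + z].
Proof.
elim: s x => [|v s IH] x /=.
  by move=> tx; exists 0, x; split=> //; [exact: ss0|rewrite add0r].
move=> /span_cons[a [z [/IH[y [w [sy tw ->]]] ->]]].
exists (a *: v + y), w; split=> //; last by rewrite addrA.
apply: ssP; first by apply: mem_spans; rewrite inE eqxx.
by apply: span_subset sy => ? ?; rewrite inE orbC; apply/orP; left.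
Qed.

(** Zorn: a subspace maximal among those containing X but not u is the kernel
    of a linear form with value 1 at u. *)
Lemma separating_form X (u : V) : ~ X u ->
  exists l : {linear V -> K^o}, (forall x, X x -> l x = 0) /\ l u = 1.
Proof.
move=> Xu.
pose good (Y : subspace V) := (forall x, X x -> Y x) /\ ~ Y u.
pose T := {Y : subspace V | good Y}.
pose R : rel T := fun M N : T => `[< forall x, sval M x -> sval N x >].
have Xgood : good X by [].
pose mk Y (gY : good Y) : T := exist _ Y gY.
have [|||Y Ymax] := @ZL_preorder T (mk X Xgood) R.
- by move=> Y; apply/asboolP.
- move=> Y Z Z' /asboolP YZ /asboolP ZZ; apply/asboolP => x /YZ; exact: ZZ.
- move=> A Atot; have [[Y0 AY0]|A0] := pselect (exists Y, A Y); last first.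
    by exists (mk X Xgood) => Y AY; case: A0; exists Y.
  pose U : set V := fun x => exists Y, A Y /\ sval Y x.
  have U0 : U 0 by exists Y0; split=> //; exact: ss0.
  have UP a x y : U x -> U y -> U (a *: x + y).
    move=> [Y [AY Yx]] [Z [AZ Zy]].
    have [/asboolP YZ|/asboolP ZY] := Atot _ _ AY AZ.
      by exists Z; split=> //; apply: ssP => //; exact: YZ.
    by exists Y; split=> //; apply: ssP => //; exact: ZY.
  have gU : good (Subspace U0 UP).
    split=> [x Xx|[Y [_]]]; last by have [] := svalP Y.
    by exists Y0; split=> //; have [+ _] := svalP Y0; apply.
  by exists (mk _ gU) => Y AY; apply/asboolP => x Yx; exists Y.
have [XY Yu] := svalP Y; set M := sval Y in XY Yu.
(* V = M + K u: if x is not in M, then M + K x contains u by maximality. *)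
have dec x : exists a, M (x - a *: u).
  have [Mx|Mx] := pselect (M x); first by exists 0; rewrite scale0r subr0.
  pose N : set V := fun y => exists a, M (y - a *: x).
  have N0 : N 0 by exists 0; rewrite scale0r subr0; exact: ss0.
  have NP a y z : N y -> N z -> N (a *: y + z).
    move=> [b Mb] [c Mc]; exists (a * b + c).
    rewrite scalerDl opprD addrACA -scalerA -scalerBr; exact: ssP.
  have MN y : M y -> N y by exists 0; rewrite scale0r subr0.
  have [[a Ma]|Nu] := pselect (N u).
    have [a0|a0] := eqVneq a 0.
      by case: Yu; move: Ma; rewrite a0 scale0r subr0.
    exists a^-1; rewrite -(scalerK a0 x) -scalerBr; apply: ssZ.
    by rewrite -opprB; exact: ssN.
  have gN : good (Subspace N0 NP) by split=> // y /XY /MN.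
  have /asboolP NM : R (mk _ gN) Y.
    by apply: Ymax; apply/asboolP => y /MN.
  by case: Mx; apply: NM => /=; exists 1; rewrite scale1r subrr; exact: ss0.
have decU x a b : M (x - a *: u) -> M (x - b *: u) -> a = b.
  move=> Ma Mb; have := ssB Mb Ma; rewrite opprB addrC addrA subrK.
  rewrite -scalerBl => Mab; apply/eqP; rewrite -subr_eq0; apply/negP => /negP ab.
  by apply: Yu; rewrite -(scalerK ab u); exact: ssZ.
have [l lP] := choice dec.
have ll : linear (l : V -> K^o).
  move=> a x y; apply: (decU (a *: x + y)) => //.
  rewrite scalerDl -scalerA opprD addrACA -scalerBr; exact: ssP.
exists (linear_of ll); split=> [x /XY Mx|] /=.
  by apply: (decU x) => //; rewrite scale0r subr0.
by apply: (decU u) => //; rewrite scale1r subrr; exact: ss0.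
Qed.

Definition independent s := forall c : 'I_(size s) -> K,
  \sum_(i < size s) c i *: s`_i = 0 -> forall i, c i = 0.

(** The i-th form separates the i-th entry from the span of the others. *)
Lemma dual_family s : independent s ->
  exists L : nat -> {linear V -> K^o}, forall i j, (i < size s)%N ->
    (j < size s)%N -> L i s`_j = (i == j)%:R.
Proof.
move=> fs.
have H i : exists l : {linear V -> K^o}, (i < size s)%N ->
    forall j, (j < size s)%N -> l s`_j = (i == j)%:R.
  have [si|] := boolP (i < size s)%N; last by exists \0.
  pose A := [set v | exists2 j, (j < size s)%N /\ j <> i & v = s`_j].
  have nA : ~ span A s`_i.
    move=> sA.
    have [c [ci E]] : exists c : nat -> K,
        c i = 0 /\ s`_i = \sum_(k < size s) c k *: s`_k.
      move: sA; move: (s`_i); apply: span_ind.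
      - by exists (fun=> 0); split=> //; rewrite big1// => k _; rewrite scale0r.
      - move=> a _ _ [c [ci ->]] [d [di ->]]; exists (fun k => a * c k + d k).
        split; first by rewrite ci di mulr0 addr0.
        rewrite scaler_sumr -big_split /=; apply: eq_bigr => k _.
        by rewrite scalerDl scalerA.
      - move=> _ [j [sj ji] ->]; exists (fun k => (k == j)%:R).
        split; first by case: eqP => // /esym.
        rewrite (bigD1 (Ordinal sj))//= eqxx scale1r big1 ?addr0// => k.
        by rewrite -val_eqE /= => /negbTE ->; rewrite scale0r.
    have := fs (fun k => c k - (val k == i)%:R) _ (Ordinal si).
    rewrite /= ci eqxx sub0r => h.
    suff /eqP : (-1 : K) = 0 by rewrite oppr_eq0 oner_eq0.
    apply: h; under eq_bigr do rewrite scalerBl.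
    rewrite sumrB -E (bigD1 (Ordinal si))//= eqxx scale1r big1 ?addr0 ?subrr// => k.
    by rewrite -val_eqE /= => /negbTE ->; rewrite scale0r.
  have [l [lA li]] := separating_form nA; exists l => _ j sj.
  case: eqP => [<-//|/nesym ji].
  by apply: lA; apply: mem_span; exists j.
by have [L LP] := choice H; exists L => i j si sj; exact: LP.
Qed.

End Subspaces.

(** * Multivectors and blades *)

Section Blades.
Variables (K : fieldType) (V : lmodType K).
Implicit Types (X : subspace V) (s t p q r : seq V) (a b : multivec V).

Lemma multivec_eq a b : (forall w, \val a w = \val b w) -> a = b.
Proof. by move=> ab; apply/val_inj/funext. Qed.

Lemma multivec_linear a : linear (\val a : altform V -> K^o).
Proof. by case: a => a /= /asboolP. Qed.

Lemma wedgePl c a a' b : (c *: a + a') ∧ b = c *: (a ∧ b) + a' ∧ b.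
Proof. exact: multivec_eq. Qed.

Lemma wedgePr c a b b' : a ∧ (c *: b + b') = c *: (a ∧ b) + a ∧ b'.
Proof.
apply: multivec_eq => w; rewrite /= -[RHS]multivec_linear; congr (\val a _).
exact: altform_eq.
Qed.

Lemma wedge0l b : 0 ∧ b = 0 :> multivec V.
Proof. exact: multivec_eq. Qed.

Lemma wedge0r a : a ∧ 0 = 0 :> multivec V.
Proof. by have := wedgePr (-1) a 0 0; rewrite scaler0 addr0 scaleN1r addNr. Qed.

Lemma wedgeZl c a b : (c *: a) ∧ b = c *: (a ∧ b).
Proof. by have := wedgePl c a 0 b; rewrite wedge0l !addr0. Qed.

Lemma wedgeZr c a b : a ∧ (c *: b) = c *: (a ∧ b).
Proof. by have := wedgePr c a b 0; rewrite wedge0r !addr0. Qed.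

Lemma wedgeA a b c : a ∧ (b ∧ c) = a ∧ b ∧ c.
Proof.
apply: multivec_eq => w /=; congr (\val a _); apply: altform_eq => s /=.
congr (\val b _); apply: altform_eq => t /=.
by congr (\val c _); apply: altform_eq => u /=; rewrite catA.
Qed.

Lemma blade_lin s t c x y :
  blade (s ++ (c *: x + y) :: t) = c *: blade (s ++ x :: t) + blade (s ++ y :: t).
Proof.
by apply: multivec_eq => -[w wP] /=; have /asboolP[wl _] := wP; exact: wl.
Qed.

Lemma blade_dup s t r x : blade (s ++ x :: t ++ x :: r) = 0.
Proof.
by apply: multivec_eq => -[w wP] /=; have /asboolP[_ wd] := wP; exact: wd.
Qed.

Lemma blade0 s t : blade (s ++ 0 :: t) = 0.
Proof.
by have := blade_lin s t (-1) 0 0; rewrite scaler0 addr0 scaleN1r addNr.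
Qed.

Lemma blade_nuniq s : ~~ uniq s -> blade s = 0.
Proof.
elim/last_ind: s => // s x IH; rewrite rcons_uniq negb_and negbK => /orP[xs|/IH s0].
  by case/splitPr: xs => p q; rewrite -cats1 -catA cat_cons blade_dup.
by rewrite -cats1 -wedge_blade s0 wedge0l.
Qed.

Lemma blade_swap s t x y : blade (s ++ x :: y :: t) = - blade (s ++ y :: x :: t).
Proof.
have l1 u v w : blade (s ++ (u + v) :: w :: t) =
    blade (s ++ u :: w :: t) + blade (s ++ v :: w :: t).
  by have := blade_lin s (w :: t) 1 u v; rewrite !scale1r.
have l2 u v w : blade (s ++ w :: (u + v) :: t) =
    blade (s ++ w :: u :: t) + blade (s ++ w :: v :: t).
  by have := blade_lin (s ++ [:: w]) t 1 u v; rewrite !scale1r -!catA.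
have dup u : blade (s ++ u :: u :: t) = 0 := blade_dup s [::] t u.
apply/eqP; rewrite -addr_eq0; apply/eqP.
by have := dup (x + y); rewrite l1 !l2 !dup add0r addr0.
Qed.

Lemma blade_move p x q r :
  blade (p ++ x :: q ++ r) = (-1) ^+ size q *: blade (p ++ q ++ x :: r).
Proof.
elim: q p => [|y q IH] p; first by rewrite scale1r.
rewrite cat_cons blade_swap -cat1s catA IH -catA exprS mulN1r scaleNr.
by rewrite [RHS]/=.
Qed.

Lemma blade_moves p s t r :
  blade (p ++ s ++ t ++ r) = (-1) ^+ (size s * size t) *: blade (p ++ t ++ s ++ r).
Proof.
elim: s p => [|x s IH] p; first by rewrite mul0n scale1r.
rewrite cat_cons -cat1s catA IH -catA cat1s [size (x :: s)]/= mulSn exprD.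
by rewrite blade_move scalerA mulrC.
Qed.

Lemma blade_dep p q x : span [set` p ++ q] x -> blade (p ++ x :: q) = 0.
Proof.
move: x; apply: span_ind; first exact: blade0.
  by move=> a y z y0 z0; rewrite blade_lin y0 z0 scaler0 addr0.
move=> y yq; apply: blade_nuniq; rewrite -cat1s uniq_catCA cat1s /=.
by rewrite (yq : y \in p ++ q).
Qed.

(** Elementary operations: the entries g i are corrected one at a time by
    combinations of the entries p and r, which stay in place. *)
Lemma blade_congr (I : eqType) (g g' : I -> V) p (s : seq I) r :
  (forall i, i \in s -> span [set` p ++ r] (g i - g' i)) ->
  blade (p ++ map g s ++ r) = blade (p ++ map g' s ++ r).
Proof.
elim: s p => // i s IH p gg' /=.
have sub t' j : j \in i :: s -> span [set` p ++ t' ++ r] (g j - g' j).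
  move=> js; apply: span_subset (gg' _ js) => y; rewrite !mem_cat.
  by case/orP=> ->; rewrite ?orbT.
have -> : g i = 1 *: (g i - g' i) + g' i by rewrite scale1r subrK.
rewrite blade_lin (blade_dep (sub _ _ (mem_head _ _))) scaler0 add0r.
rewrite -cat1s catA IH => [|j js]; first by rewrite -catA.
by rewrite -catA; apply: sub; rewrite inE js orbT.
Qed.

(** Multilinear expansion: a blade of combinations of entries of s is a
    combination of blades of entries of s. *)
Lemma blade_expand (Z : subspace (multivec V)) k s :
  (forall t, {subset t <= s} -> size t = k -> Z (blade t)) ->
  forall t, (forall x, x \in t -> span [set` s] x) -> size t = k -> Z (blade t).
Proof.
move=> ZH t0 t0s t0k.
suff H t p : {subset p <= s} -> (forall x, x \in t -> span [set` s] x) ->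
    size (p ++ t) = k -> Z (blade (p ++ t)) by exact: (H t0 [::]).
elim: t p => [|x t IH] p ps st.
  by rewrite cats0 => sk; exact: ZH.
rewrite size_cat /= addnS => sk.
have tt y : y \in t -> span [set` s] y.
  by move=> yt; have /st : y \in x :: t by rewrite inE yt orbT.
have := st x (mem_head _ _); move: x {st}; apply: span_ind.
- by rewrite blade0; exact: ss0.
- by move=> a y z Zy Zz; rewrite blade_lin; exact: ssP.
- move=> y ys; rewrite -cat1s catA; apply: IH => //.
    by move=> z; rewrite mem_cat inE => /orP[/ps//|/eqP ->].
  by rewrite !size_cat /= addn1 addSn.
Qed.

Lemma ext_pow_expand (Z : subspace (multivec V)) k X s a :
  (forall x, X x -> span [set` s] x) ->
  (forall t, {subset t <= s} -> size t = k -> Z (blade t)) ->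
  ext_pow k X a -> Z a.
Proof.
move=> Xs ZH; apply => _ [t [tk tX] <-]; apply: (@blade_expand Z k s) => //.
by move=> x /tX /Xs.
Qed.

Lemma blade_perm r s t : perm_eq t s ->
  exists c : K, blade (r ++ t) = c *: blade (r ++ s).
Proof.
elim: t r s => [|x t IH] r s ts.
  by exists 1; rewrite scale1r; move: ts; rewrite perm_sym => /perm_nilP ->.
have xs : x \in s by rewrite -(perm_mem ts) mem_head.
case/splitPr: xs ts => p q; rewrite perm_sym -[x :: q]cat1s perm_catCA cat1s.
rewrite perm_cons perm_sym => /(IH (r ++ [:: x]))[c E].
exists (c * (-1) ^+ size p).
by rewrite -[x :: t]cat1s catA E -catA cat1s blade_move scalerA.
Qed.

Lemma blade_top s t : {subset t <= s} -> size t = size s ->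
  exists c : K, blade t = c *: blade s.
Proof.
move=> ts tsz; have [ut|/blade_nuniq ->] := boolP (uniq t); last first.
  by exists 0; rewrite scale0r.
apply: (@blade_perm [::]).
have [_ st] := uniq_min_size ut ts (eq_leq (esym tsz)).
by apply: uniq_perm => //; rewrite (leq_size_uniq ut ts)// tsz.
Qed.

Lemma blade_over s t : {subset t <= s} -> (size s < size t)%N -> blade t = 0.
Proof.
move=> ts st; apply: blade_nuniq; apply: contraL st => ut.
by rewrite -leqNgt; exact: uniq_leq_size.
Qed.

Section DetForm.
Variables (n : nat) (L : nat -> {linear V -> K^o}).

Let M s : 'M[K]_n := \matrix_(i, j) (L j s`_i : K).

Lemma detform_sub :
  altform_sub V (fun s => if size s == n then \det (M s) else 0).
Proof.
split=> [s t c x y|s t u x].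
  have E z : size (s ++ z :: t) = (size s + size t).+1 by rewrite size_cat addnS.
  rewrite !E; case: eqP => [sn|_]; last by rewrite scaler0 addr0.
  have si : (size s < n)%N by rewrite -sn ltnS leq_addr.
  rewrite -[RHS]/(c * _ + _) -[\det (M (s ++ y :: t))]mul1r.
  apply: (@determinant_multilinear _ _ _ _ _ (Ordinal si)).
  - apply/rowP => j; rewrite !mxE /= !nth_cat !ltnn subnn /= linearP /=.
    by rewrite mul1r.
  - apply/matrixP => i j; rewrite !mxE !nth_cat; case: ifP => // /negbT sni.
    suff : (0 < lift (Ordinal si) i - size s)%N by case: (_ - _)%N.
    rewrite subn_gt0 ltn_neqAle leqNgt sni andbT.
    exact: (neq_lift (Ordinal si) i).
  - apply/matrixP => i j; rewrite !mxE !nth_cat; case: ifP => // /negbT sni.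
    suff : (0 < lift (Ordinal si) i - size s)%N by case: (_ - _)%N.
    rewrite subn_gt0 ltn_neqAle leqNgt sni andbT.
    exact: (neq_lift (Ordinal si) i).
case: eqP => // sn.
have n1 : (size s < n)%N by rewrite -sn size_cat /= addnS ltnS leq_addr.
have n2 : (size s + (size t).+1 < n)%N.
  by rewrite -sn size_cat /= size_cat /= ltn_add2l ltnS addnS ltnS leq_addr.
apply: (@determinant_alternate _ _ _ (Ordinal n1) (Ordinal n2)).
  by rewrite -val_eqE /= neq_ltn -[X in (X < _)%N]addn0 ltn_add2l.
move=> j; rewrite !mxE !nth_cat /= ltnn subnn /= ltnNge leq_addr /= addKn /=.
by rewrite nth_cat ltnn subnn.
Qed.
(** This form has the value 1 on a sequence dual to L; it detects independence. *)
Definition detform : altform V := ssub detform_sub.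

End DetForm.

(** A dual family gives a form which does not vanish on s; conversely, an entry
    depending on the others kills the blade. *)
Lemma independent_blade s : independent s <-> blade s <> 0.
Proof.
split=> [/dual_family[L LP] s0|bs c cs i].
  have := congr1 (fun a => \val a (detform (size s) L)) s0.
  rewrite /= eqxx (_ : \matrix_(_, _) _ = 1%:M) ?det1 => [/eqP|].
    by rewrite oner_eq0.
  by apply/matrixP => i j; rewrite !mxE LP// eq_sym.
apply/eqP/negPn/negP => ci; apply: bs.
rewrite -[s](cat_take_drop i) (drop_nth 0 (ltn_ord i)).
apply: blade_dep.
have -> : s`_i = \sum_(j < size s | j != i) (- (c i)^-1 * c j) *: s`_j.
  move/eqP: cs; rewrite (bigD1 i)//= addr_eq0 => /eqP csi.
  rewrite -[LHS](scalerK ci) csi scalerN -scaleNr scaler_sumr.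
  by apply: eq_bigr => j _; rewrite scalerA.
elim/big_ind: _ => [|x y|j ji]; [exact: ss0|exact: ssD|].
apply: ssZ; apply: mem_spans; rewrite mem_cat.
have := ji; rewrite -val_eqE /= neq_ltn => /orP[ij|ij].
  apply/orP; left; rewrite -(nth_take 0 ij) mem_nth// size_takel//.
  exact: ltnW.
apply/orP; right; rewrite -[s in s`_j](cat_take_drop i.+1) nth_cat.
rewrite size_takel// ltnNge ij /= mem_nth// size_drop ltn_sub2r//.
exact: leq_ltn_trans ij _.
Qed.

End Blades.

(** * Exterior powers and bases *)

Section ExteriorPowers.
Variables (K : fieldType) (V : lmodType K).
Implicit Types (X Y : subspace V) (s t : seq V) (a b : multivec V).

Lemma ext_pow_blade X k s :
  (forall x, x \in s -> X x) -> size s = k -> ext_pow k X (blade s).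
Proof. by move=> sX sk; apply: mem_span; exists s. Qed.

Lemma ext_pow_sub X Y k a :
  (forall x, X x -> Y x) -> ext_pow k X a -> ext_pow k Y a.
Proof.
move=> XY; apply: span_sub => _ [s [sk sX] <-].
by apply: ext_pow_blade => // x /sX /XY.
Qed.

Lemma homogeneous_sub X Y a :
  (forall x, X x -> Y x) -> homogeneous X a -> homogeneous Y a.
Proof. by move=> XY [k ak]; exists k; exact: ext_pow_sub ak. Qed.

Lemma ext_pow_wedge X k l a b :
  ext_pow k X a -> ext_pow l X b -> ext_pow (k + l) X (a ∧ b).
Proof.
move=> ak bl; move: a ak; apply: span_ind.
- by rewrite wedge0l; exact: ss0.
- by move=> c x y ? ?; rewrite wedgePl; exact: ssP.
move=> _ [s [sk sX] <-]; move: b bl; apply: span_ind.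
- by rewrite wedge0r; exact: ss0.
- by move=> c x y ? ?; rewrite wedgePr; exact: ssP.
move=> _ [t [tl tX] <-]; rewrite wedge_blade.
apply: ext_pow_blade; last by rewrite size_cat sk tl.
by move=> x; rewrite mem_cat => /orP[/sX|/tX].
Qed.

Lemma homogeneous_wedge X a b :
  homogeneous X a -> homogeneous X b -> homogeneous X (a ∧ b).
Proof.
by move=> [k ak] [l bl]; exists (k + l)%N; exact: ext_pow_wedge.
Qed.

Lemma wedge_comm X Y k l a b : ext_pow k X a -> ext_pow l Y b ->
  a ∧ b = (-1) ^+ (k * l) *: (b ∧ a).
Proof.
move=> ak bl; move: a ak; apply: span_ind.
- by rewrite wedge0l wedge0r scaler0.
- move=> c x y xb yb.
  by rewrite wedgePl wedgePr xb yb scalerDr !scalerA [c * _]mulrC.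
move=> _ [s [sk sX] <-]; move: b bl; apply: span_ind.
- by rewrite wedge0l wedge0r scaler0.
- move=> c x y xb yb.
  by rewrite wedgePl wedgePr xb yb scalerDr !scalerA [c * _]mulrC.
move=> _ [t [tl tX] <-]; rewrite !wedge_blade -sk -tl.
by have := blade_moves [::] s t [::]; rewrite !cats0 !cat0s.
Qed.

(** Truncating a form to sequences of one size separates the degrees. *)
Lemma ext_pow_deg X Y k l a :
  ext_pow k X a -> ext_pow l Y a -> a <> 0 -> k = l.
Proof.
move=> ak al a0; apply/eqP/negPn/negP => kl; apply: a0.
have trunc_sub n (w : altform V) :
    altform_sub V (fun s => if size s == n then \val w s else 0).
  case: w => w /= /asboolP[wl wd]; split=> [s t c x y|s t u x].
    by rewrite !size_cat /=; case: eqP; rewrite ?wl// scaler0 addr0.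
  by rewrite wd; case: ifP.
pose trunc n w : altform V := ssub (trunc_sub n w).
have E n Z b w : ext_pow n Z b -> \val b w = \val b (trunc n w).
  move: b; apply: span_ind => //.
    by move=> c x y /= xw yw; rewrite !fctE xw yw.
  by move=> _ [s [sn _] <-] /=; rewrite sn eqxx.
apply: multivec_eq => w; rewrite (E _ _ _ _ ak) (E _ _ _ _ al).
rewrite [X in \val a X](_ : _ = 0).
  by have := multivec_linear a (-1) 0 0; rewrite scaler0 addr0 scaleN1r addNr.
apply: altform_eq => s /=; case: eqP => // sl.
by rewrite -sl in kl; case: eqP => // sk; rewrite sk eqxx in kl.
Qed.

End ExteriorPowers.

Section ExteriorMaps.
Variables (K : fieldType) (V W : lmodType K) (f : {linear V -> W}).
Implicit Types (a b : multivec V).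

Lemma ext_mapP c a b : ext_map f (c *: a + b) = c *: ext_map f a + ext_map f b.
Proof. exact: multivec_eq. Qed.

Lemma ext_map0 : ext_map f 0 = 0.
Proof. exact: multivec_eq. Qed.

Lemma ext_mapZ c a : ext_map f (c *: a) = c *: ext_map f a.
Proof. exact: multivec_eq. Qed.

Lemma ext_map_wedge a b : ext_map f (a ∧ b) = ext_map f a ∧ ext_map f b.
Proof.
apply: multivec_eq => w /=; congr (\val a _); apply: altform_eq => s /=.
by congr (\val b _); apply: altform_eq => t /=; rewrite map_cat.
Qed.

Lemma ext_pow_map (X : subspace V) (Y : subspace W) k a :
  (forall x, X x -> Y (f x)) -> ext_pow k X a -> ext_pow k Y (ext_map f a).
Proof.
move=> XY; move: a; apply: span_ind.
- by rewrite ext_map0; exact: ss0.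
- by move=> c x y ? ?; rewrite ext_mapP; exact: ssP.
move=> _ [s [sk sX] <-]; rewrite ext_map_blade.
by apply: ext_pow_blade; rewrite ?size_map// => _ /mapP[x /sX /XY + ->].
Qed.

Lemma lift_seq (X : subspace V) (Y : subspace W) t :
  (forall y, Y y -> exists2 x, X x & f x = y) -> (forall y, y \in t -> Y y) ->
  exists2 s, (forall x, x \in s -> X x) & map f s = t.
Proof.
move=> XY; elim: t => [|y t IH] tY; first by exists [::].
have [x Xx xy] := XY y (tY _ (mem_head _ _)).
have [z zt|s sX st] := IH; first by apply: tY; rewrite inE zt orbT.
exists (x :: s); last by rewrite /= xy st.
by move=> z; rewrite inE => /orP[/eqP ->|/sX].
Qed.

Lemma ext_pow_lift (X : subspace V) (Y : subspace W) k (b : multivec W) :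
  (forall y, Y y -> exists2 x, X x & f x = y) -> ext_pow k Y b ->
  exists2 a, ext_pow k X a & ext_map f a = b.
Proof.
move=> XY; move: b; apply: span_ind.
- by exists 0; [exact: ss0|rewrite ext_map0].
- move=> c _ _ [x Xx <-] [y Xy <-].
  by exists (c *: x + y); [exact: ssP|rewrite ext_mapP].
move=> _ [t [tk tY] <-]; have [s sX st] := lift_seq XY tY.
exists (blade s); last by rewrite ext_map_blade st.
by apply: ext_pow_blade => //; rewrite -tk -st size_map.
Qed.

(** Expanding b in blades of entries of sa ++ sb, the terms with an entry in sa
    vanish in all three products; the others are multiples of the blade of sb,
    so that the three products have a common coefficient. *)
Lemma quot_factor (B : subspace V) sa sb b :
  (forall x, B x -> span [set` sa ++ sb] x) -> (forall x, x \in sa -> f x = 0) ->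
  ext_pow (size sb) B b ->
  exists c : K, [/\ blade sa ∧ b = c *: blade (sa ++ sb),
    b ∧ blade sa = c *: blade (sb ++ sa) & ext_map f b = c *: blade (map f sb)].
Proof.
move=> Bs fsa.
pose P b := exists c : K, [/\ blade sa ∧ b = c *: blade (sa ++ sb),
    b ∧ blade sa = c *: blade (sb ++ sa) & ext_map f b = c *: blade (map f sb)].
have P0 : P 0.
  by exists 0; split; rewrite ?wedge0l ?wedge0r ?ext_map0 scale0r.
have PP c x y : P x -> P y -> P (c *: x + y).
  move=> [d [x1 x2 x3]] [e [y1 y2 y3]]; exists (c * d + e); split.
  - by rewrite wedgePr x1 y1 scalerA scalerDl.
  - by rewrite wedgePl x2 y2 scalerA scalerDl.
  - by rewrite ext_mapP x3 y3 scalerA scalerDl.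
apply: (ext_pow_expand (Z := Subspace P0 PP) Bs) => t ts tsb; rewrite /sscar.
have [tb|/allPn[x xt xsb]] := boolP (all (mem sb) t).
  have [c E] := blade_top (allP tb) tsb; exists c.
  by rewrite E wedgeZl wedgeZr ext_mapZ ext_map_blade !wedge_blade.
have xsa : x \in sa.
  by have := ts _ xt; rewrite mem_cat; case/orP => // xsb'; rewrite /= xsb' in xsb.
exists 0; rewrite !scale0r; case/splitPr: xt ts tsb => p q ts tsb.
split.
- rewrite wedge_blade blade_nuniq//; apply/negP; rewrite cat_uniq.
  case/and3P => _ /hasPn/(_ x) + _; rewrite mem_cat mem_head orbT.
  by move=> /(_ isT); rewrite /= xsa.
- rewrite wedge_blade blade_nuniq//; apply/negP; rewrite cat_uniq.
  case/and3P => _ /hasPn/(_ x xsa) + _.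
  by rewrite /= mem_cat mem_head orbT.
- by rewrite ext_map_blade map_cat /= fsa// blade0.
Qed.

End ExteriorMaps.

Lemma ext_map_comp (K : fieldType) (U V W : lmodType K) (f : {linear U -> V})
    (g : {linear V -> W}) (h : {linear U -> W}) a :
  (forall x, h x = g (f x)) -> ext_map h a = ext_map g (ext_map f a).
Proof.
move=> hgf; apply: multivec_eq => w /=; congr (\val a _).
apply: altform_eq => s /=; rewrite -map_comp; congr (\val w _).
exact: eq_map.
Qed.

Lemma ext_map_square (K : fieldType) (U V V' W : lmodType K)
    (f : {linear U -> V}) (g : {linear V -> W}) (f' : {linear U -> V'})
    (g' : {linear V' -> W}) a :
  (forall x, g (f x) = g' (f' x)) ->
  ext_map g (ext_map f a) = ext_map g' (ext_map f' a).
Proof.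
move=> gf; apply: multivec_eq => w /=; congr (\val a _).
apply: altform_eq => s /=; rewrite -!map_comp; congr (\val w _).
exact: eq_map.
Qed.

Section Bases.
Variables (K : fieldType) (V : lmodType K).
Implicit Types (X Y : subspace V) (s t : seq V) (a b : multivec V).

Lemma basisP X s :
  is_basis X s <-> (forall x, X x <-> span [set` s] x) /\ blade s <> 0.
Proof.
rewrite /is_basis; split=> -[Xs sI]; split=> //.
  by apply/independent_blade.
by move/independent_blade: sI.
Qed.

Lemma basis_mem X s x : is_basis X s -> x \in s -> X x.
Proof. by move=> [Xs _] xs; apply/Xs/mem_spans. Qed.

Lemma basis_gen X s x : is_basis X s -> X x -> span [set` s] x.
Proof. by move=> [Xs _] /Xs. Qed.

Lemma basis_intro X s : (forall x, x \in s -> X x) ->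
  (forall x, X x -> span [set` s] x) -> blade s <> 0 -> is_basis X s.
Proof.
by move=> sX Xs s0; apply/basisP; split=> // x; split; [exact: Xs|exact].
Qed.

Lemma basis_swap X s t : is_basis X (s ++ t) -> is_basis X (t ++ s).
Proof.
move=> sb; apply: basis_intro.
- by move=> x; rewrite mem_cat orbC -mem_cat; exact: basis_mem.
- move=> x /(basis_gen sb); apply: span_subset => y.
  by rewrite !mem_cat orbC.
- have [_ + E] := (basisP _ _).1 sb; apply.
  by have := blade_moves [::] s t [::]; rewrite !cats0 !cat0s E scaler0.
Qed.

Lemma span_blade_over s t : (forall x, x \in t -> span [set` s] x) ->
  (size s < size t)%N -> blade t = 0.
Proof.
move=> ts st.
have Z0 : [set 0 : multivec V] 0 by [].
have ZP (c : K) (x y : multivec V) :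
  [set 0 : multivec V] x -> [set 0 : multivec V] y -> [set 0 : multivec V] (c *: x + y).
  by move=> -> ->; rewrite scaler0 addr0.
apply: (blade_expand (Z := Subspace Z0 ZP) (k := size t) (s := s)) => // r rs rt.
by apply: blade_over rs _; rewrite rt.
Qed.

Lemma basis_size X s t : is_basis X s -> is_basis X t -> size s = size t.
Proof.
move=> sX tX; have [_ s0] := (basisP _ _).1 sX; have [_ t0] := (basisP _ _).1 tX.
apply/eqP; rewrite eqn_leq; apply/andP; split; rewrite leqNgt; apply/negP => st.
  by apply: s0; apply: span_blade_over st => x /(basis_mem sX)/(basis_gen tX).
by apply: t0; apply: span_blade_over st => x /(basis_mem tX)/(basis_gen sX).
Qed.

Lemma basis_dim X s : is_basis X s -> dim X = size s.
Proof.
move=> sX; rewrite /dim; case: xgetP => [n _ [t tX <-]|/(_ (size s))].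
  exact: basis_size tX sX.
by case; exists s.
Qed.

Lemma independent_cons s x : blade s <> 0 -> ~ span [set` s] x ->
  blade (x :: s) <> 0.
Proof.
move=> /independent_blade fs sx; apply/independent_blade => c.
rewrite big_ord_recl /= => E.
have c0 : c ord0 = 0.
  apply/eqP/negPn/negP => c0; apply: sx.
  rewrite -[x](scalerK c0); apply: ssZ.
  move/eqP: E; rewrite addr_eq0 => /eqP ->; apply: ssN; apply: ss_sum => i.
  by apply: ssZ; apply: mem_spans; exact: (mem_nth 0 (ltn_ord i)).
move: E; rewrite c0 scale0r add0r => /fs cs i.
by case: (unliftP ord0 i) => [j|] ->; [exact: cs|exact: c0].
Qed.

(** Exchange lemma, by induction on the excess of the size of the generating
    sequence e over that of s: independent sequences are not longer than e. *)
Lemma basis_extend X (e s : seq V) : (forall x, X x -> span [set` e] x) ->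
  (forall x, x \in s -> X x) -> blade s <> 0 -> exists t, is_basis X (s ++ t).
Proof.
move=> Xe; move: {2}(size e - size s)%N (leqnn (size e - size s)) => n.
elim: n s => [|n IH] s sn sX s0.
  have [Xs|/existsNP[x /not_implyP[Xx sx]]] :=
      pselect (forall x, X x -> span [set` s] x).
    by exists [::]; rewrite cats0; exact: basis_intro.
  case: (independent_cons s0 sx); apply: (@span_blade_over e).
    by move=> y; rewrite inE => /orP[/eqP ->|/sX /Xe//]; exact: Xe.
  by rewrite /= ltnS -subn_eq0 -leqn0.
have [Xs|/existsNP[x /not_implyP[Xx sx]]] :=
    pselect (forall x, X x -> span [set` s] x).
  by exists [::]; rewrite cats0; exact: basis_intro.
have [|||t] := IH (s ++ [:: x]); last by rewrite -catA; exists ([:: x] ++ t).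
- rewrite size_cat addn1 subnS -ltnS.
  by case: (size e - size s)%N sn => // m; rewrite ltnS.
- move=> y; rewrite mem_cat inE => /orP[/sX//|/eqP ->//].
- move=> E; apply: (independent_cons s0 sx).
  by have := blade_moves [::] [:: x] s [::]; rewrite !cats0 !cat0s E scaler0.
Qed.

Lemma finite_dim_sub X Y :
  (forall x, X x -> Y x) -> finite_dim Y -> finite_dim X.
Proof.
move=> XY [e eY].
have n0 : blade ([::] : seq V) <> 0 by apply/independent_blade => c _ [].
have [|//|t tX] := basis_extend (X := X) (e := e) _ _ n0; last by exists t.
by move=> x /XY /(basis_gen eY).
Qed.

Lemma basis_complete X s : finite_dim X -> (forall x, x \in s -> X x) ->
  blade s <> 0 -> exists t, is_basis X (s ++ t).
Proof.
by move=> [e eX]; exact: basis_extend (fun x => basis_gen eX).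
Qed.

Lemma basis_neq0 X s : is_basis X s -> blade s <> 0.
Proof. by move=> /basisP[]. Qed.

Lemma generates_blade X s : is_basis X s -> generates X (blade s).
Proof.
move=> sX; split; last exact: basis_neq0 sX.
by rewrite (basis_dim sX); apply: ext_pow_blade => // x; exact: basis_mem.
Qed.

Lemma ext_pow_top X s a : is_basis X s -> ext_pow (size s) X a ->
  exists c : K, a = c *: blade s.
Proof.
move=> sX.
have P0 : exists c : K, 0 = c *: blade s by exists 0; rewrite scale0r.
have PP (d : K) (x y : multivec V) : (exists c : K, x = c *: blade s) ->
    (exists c : K, y = c *: blade s) -> exists c : K, d *: x + y = c *: blade s.
  move=> [c ->] [e ->]; exists (d * c + e).
  by rewrite scalerDl scalerA.
apply: (ext_pow_expand (Z := Subspace P0 PP) (s := s)) => [x|].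
  exact: basis_gen.
by move=> t ts tsz; exact: blade_top.
Qed.

Lemma generatesP X s a : is_basis X s -> generates X a ->
  exists2 c : K, c != 0 & a = c *: blade s.
Proof.
move=> sX [aX a0]; move: aX; rewrite (basis_dim sX) => /(ext_pow_top sX)[c ac].
by exists c => //; apply/eqP => c0; apply: a0; rewrite ac c0 scale0r.
Qed.

Lemma generatesZ X c a : c != 0 -> generates X a -> generates X (c *: a).
Proof.
move=> c0 [aX a0]; split; first exact: ssZ.
by apply/eqP; rewrite scaler_eq0 (negbTE c0) /=; apply/eqP.
Qed.

Lemma homogeneous_blade X s : (forall x, x \in s -> X x) -> homogeneous X (blade s).
Proof. by move=> sX; exists (size s); exact: ext_pow_blade. Qed.

End Bases.

(** * Short exact sequences *)

(** 0 -> A -> B -> C -> 0 is exact, the map B -> C being the restriction of f. *)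
Definition ses (K : fieldType) (V W : lmodType K) (f : {linear V -> W})
    (A B : subspace V) (C : subspace W) :=
  (forall x, A x <-> B x /\ f x = 0) /\ (forall y, C y <-> exists2 x, B x & f x = y).

Section ShortExact.
Variables (K : fieldType) (V W : lmodType K) (f : {linear V -> W}).
Variables (A B : subspace V) (C : subspace W) (ABC : ses f A B C).
Implicit Types (a b : multivec V) (sa sb : seq V).

Lemma ses_basis_quot sa sb :
  is_basis A sa -> is_basis B (sa ++ sb) -> is_basis C (map f sb).
Proof.
move=> sA sB; have [Af Cf] := ABC.
have fsa x : span [set` sa] x -> f x = 0.
  move: x; apply: span_ind => [|c x y fx fy|x]; first exact: linear0.
    by rewrite linearP fx fy scaler0 addr0.
  by move=> /(basis_mem sA)/Af[].
apply: basis_intro.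
- move=> _ /mapP[x xs ->]; apply/Cf; exists x => //; apply: (basis_mem sB).
  by rewrite mem_cat xs orbT.
- move=> y /Cf[x /(basis_gen sB)/span_cat[u [v [/fsa fu sv ->]]] <-].
  rewrite linearD fu add0r; move: v sv.
  apply: span_ind => [|c v w fv fw|v vs]; first by rewrite linear0; exact: ss0.
    by rewrite linearP; exact: ssP.
  by apply: mem_spans; exact: map_f.
have [_ sI] := sB; have [L LP] := dual_family sI.
apply/independent_blade => c; rewrite size_map in c *.
under eq_bigr do rewrite (nth_map 0)//.
move=> E i.
have : span [set` sa] (\sum_(i < size sb) c i *: sb`_i).
  apply/(basis_gen sA)/Af; split.
    apply: ss_sum => j; apply/ssZ/(basis_mem sB).
    by rewrite mem_cat mem_nth ?orbT.
  by rewrite linear_sum -[RHS]E; apply: eq_bigr => j _; rewrite linearZ.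
set y := \sum_(_ < _) _ => sy.
have si j : (j < size sb)%N -> (size sa + j < size (sa ++ sb))%N.
  by rewrite size_cat ltn_add2l.
have -> : c i = L (size sa + i)%N y.
  rewrite linear_sum (bigD1 i)//= linearZ /= big1 ?addr0 => [|j].
    have := LP _ _ (si _ (ltn_ord i)) (si _ (ltn_ord i)).
    by rewrite nth_cat ltnNge leq_addr /= addKn eqxx => ->; rewrite /GRing.scale/= mulr1.
  rewrite linearZ /= => ji; have := LP _ _ (si _ (ltn_ord i)) (si _ (ltn_ord j)).
  rewrite nth_cat ltnNge leq_addr /= addKn eqn_add2l eq_sym.
  by move: ji; rewrite -val_eqE => /negbTE -> ->; rewrite scaler0.
move: (y) sy; apply: span_ind => [|d v w lv lw|v vs]; first exact: linear0.
  by rewrite linearP lv lw scaler0 addr0.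
have vi : (index v sa < size sa)%N by rewrite index_mem.
have := LP _ (index v sa) (si _ (ltn_ord i)).
rewrite nth_cat vi nth_index// size_cat => -> //; last first.
  by rewrite (leq_trans vi)// leq_addr.
by rewrite gtn_eqF// (leq_trans vi)// leq_addr.
Qed.

(** The sequence sa ++ sb generates B.  A basis sa ++ t of B has the same
    size, and the blade of sa ++ sb is a multiple of its blade, with the
    coefficient by which the image of the blade of sb, which is not 0, is a
    multiple of that of the blade of t. *)
Lemma ses_basis_mid sa sb : (forall x, x \in sb -> B x) ->
  is_basis A sa -> is_basis C (map f sb) -> is_basis B (sa ++ sb).
Proof.
move=> bB sA sC; have [Af Cf] := ABC.
have gen x : B x -> span [set` sa ++ sb] x.
  move=> Bx; have Cx : C (f x) by apply/Cf; exists x.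
  have [c E] := span_comb (basis_gen sC Cx); rewrite size_map in E.
  pose y := \sum_(i < size sb) c i *: sb`_i.
  have sy : span [set` sa ++ sb] y.
    apply: ss_sum => i; apply/ssZ/mem_spans.
    by rewrite mem_cat mem_nth ?orbT.
  rewrite -(subrK y x); apply: ssD => //.
  apply: (@span_subset _ _ sa) => [z|]; first by rewrite mem_cat => ->.
  apply/(basis_gen sA)/Af; split.
    by apply: ssB => //; apply: ss_sum => i; apply/ssZ/bB/mem_nth.
  rewrite linearB E linear_sum; apply/eqP; rewrite subr_eq0; apply/eqP.
  by apply: eq_bigr => i _; rewrite linearZ (nth_map 0).
have abB x : x \in sa ++ sb -> B x.
  by rewrite mem_cat => /orP[/(basis_mem sA)/Af[]|/bB].
have saf x : x \in sa -> f x = 0 by move=> /(basis_mem sA)/Af[].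
have saB x : x \in sa -> B x by move=> /(basis_mem sA)/Af[].
have [t tB] := basis_extend gen saB (basis_neq0 sA).
have tsb : size t = size sb.
  by have := basis_size (ses_basis_quot sA tB) sC; rewrite !size_map.
apply: basis_intro => // sab0.
have bt : ext_pow (size t) B (blade sb) by exact: ext_pow_blade.
have [c [ca _ cf]] := quot_factor (fun x => basis_gen tB) saf bt.
apply: (basis_neq0 sC); rewrite -ext_map_blade cf.
move: ca; rewrite wedge_blade sab0 => /esym/eqP.
rewrite scaler_eq0 => /orP[/eqP ->|/eqP/(basis_neq0 tB)//].
by rewrite scale0r.
Qed.

Lemma ses_bases : finite_dim B -> exists sa sb,
  [/\ is_basis A sa, is_basis B (sa ++ sb) & is_basis C (map f sb)].
Proof.
move=> fB; have [Af Cf] := ABC.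
have [sa sA] : finite_dim A by apply: finite_dim_sub fB => x /Af[].
have [|sb sB] := basis_complete fB _ (basis_neq0 sA).
  by move=> x /(basis_mem sA)/Af[].
by exists sa, sb; split=> //; exact: ses_basis_quot sA sB.
Qed.

Lemma ses_finite_dim_mid : finite_dim A -> finite_dim C -> finite_dim B.
Proof.
move=> [sa sA] [sc sC]; have [Af Cf] := ABC.
have [y|y|sb bB E] := @lift_seq _ _ _ f B C sc; first by move/Cf.
  exact: basis_mem.
by exists (sa ++ sb); apply: ses_basis_mid => //; rewrite E.
Qed.

Lemma ses_factor sa sb b : is_basis A sa -> is_basis B (sa ++ sb) ->
  homogeneous B b -> generates C (ext_map f b) ->
  exists c : K, [/\ c != 0, blade sa ∧ b = c *: blade (sa ++ sb),
    b ∧ blade sa = c *: blade (sb ++ sa) & ext_map f b = c *: blade (map f sb)].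
Proof.
move=> sA sB [k bk] [fbC fb0]; have [Af Cf] := ABC.
have sC := ses_basis_quot sA sB.
have kE : k = size sb.
  rewrite -(size_map f) -(basis_dim sC).
  have fk : ext_pow k C (ext_map f b).
    by apply: ext_pow_map bk => x Bx; apply/Cf; exists x.
  exact: ext_pow_deg fk fbC fb0.
subst k.
have fsa x : x \in sa -> f x = 0 by move=> /(basis_mem sA)/Af[].
have [c [ca cb cf]] := quot_factor (fun x => basis_gen sB) fsa bk.
exists c; split=> //; apply/eqP => c0; apply: fb0.
by rewrite cf c0 scale0r.
Qed.

Hypothesis fB : finite_dim B.
Variables (a b : multivec V).
Hypotheses (aA : generates A a) (bB : homogeneous B b).

(** Both sides say that the common coefficient of quot_factor is not 0. *)
Lemma ses_generates_l : generates B (a ∧ b) <-> generates C (ext_map f b).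
Proof.
have [Af Cf] := ABC; have [sa [sb [sA sB sC]]] := ses_bases fB.
have [e e0 ae] := generatesP sA aA.
split=> [[abB ab0]|bC]; last first.
  have [c [c0 + _ _]] := ses_factor sA sB bB bC.
  rewrite ae wedgeZl => ->; apply: generatesZ => //; apply: generatesZ => //.
  exact: generates_blade.
have [k bk] := bB.
have kE : k = size sb.
  apply/eqP; rewrite -(eqn_add2l (size sa)) -size_cat -(basis_dim sB); apply/eqP.
  have aB : ext_pow (size sa) B a.
    by rewrite ae; apply: ssZ; apply: ext_pow_blade => // x /(basis_mem sA)/Af[].
  exact: ext_pow_deg (ext_pow_wedge aB bk) abB ab0.
subst k.
have fsa x : x \in sa -> f x = 0 by move=> /(basis_mem sA)/Af[].
have [c [ca cb ->]] := quot_factor (fun x => basis_gen sB) fsa bk.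
apply: generatesZ; last exact: generates_blade.
by apply/eqP => c0; apply: ab0; rewrite ae wedgeZl ca c0 scale0r scaler0.
Qed.

Lemma generates_wedge_comm : generates B (a ∧ b) <-> generates B (b ∧ a).
Proof.
have [Af Cf] := ABC; have [k bk] := bB; have [aA' _] := aA.
have := wedge_comm aA' bk; set l := (_ * _)%N => E.
have E' : b ∧ a = (-1) ^+ l *: (a ∧ b).
  by rewrite E scalerA -expr2 sqrr_sign scale1r.
by split=> h; [rewrite E'|rewrite E]; apply: generatesZ h; rewrite signr_eq0.
Qed.

Lemma ses_generates_r : generates B (b ∧ a) <-> generates C (ext_map f b).
Proof.
split; last by move=> /ses_generates_l/generates_wedge_comm.
by move=> /generates_wedge_comm/ses_generates_l.
Qed.

End ShortExact.

(** * Lines and the isomorphisms psi *)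

Section Lines.
Variable K : fieldType.
Implicit Types L M : lmodType K.

Definition line_gen L (g : L) := g <> 0 /\ forall x, exists c : K, x = c *: g.

Definition zero_space L : subspace L.
Proof.
exists (fun x => x = 0) => // a x y -> ->; rewrite scaler0 addr0 //.
Defined.

Lemma line_form L (g : L) : g <> 0 -> exists l : {linear L -> K^o}, l g = 1.
Proof.
by move=> g0; have [|l [_ lg]] := @separating_form _ _ (zero_space L) g; last exists l.
Qed.

Lemma linear_scale L M (f : L -> M) c x : linear f -> f (c *: x) = c *: f x.
Proof. by move=> fl; have := linearZ_LR (linear_of fl) c x. Qed.

Lemma line_map L M (g : L) (m : M) : line_gen g ->
  exists f : L -> M, linear f /\ f g = m.
Proof.
move=> [g0 _]; have [l lg] := line_form g0.
exists (fun x => (l x : K) *: m); split; last by rewrite lg scale1r.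
by move=> a x y; rewrite linearP scalerDl scalerA.
Qed.

Lemma line_map_eq L M (f f' : L -> M) (g : L) : line_gen g -> linear f ->
  linear f' -> f g = f' g -> f = f'.
Proof.
move=> [_ gL] fl fl' fg; apply/funext => x; have [c ->] := gL x.
by rewrite !linear_scale// fg.
Qed.

Lemma line_map_bij L M (f : L -> M) (g : L) : line_gen g -> linear f ->
  line_gen (f g) -> bijective f.
Proof.
move=> gL fl fgL; have [h [hl hfg]] := line_map g fgL.
exists h => x.
  by have [c ->] := gL.2 x; rewrite linear_scale// linear_scale// hfg.
by have [c ->] := fgL.2 x; rewrite (linear_scale _ _ hl) hfg linear_scale.
Qed.

Lemma line_gen_inj L M (f : L -> M) (g : L) : linear f -> bijective f ->
  line_gen (f g) -> line_gen g.
Proof.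
move=> fl [h hK Kh] [g0 gM]; split=> [E|y].
  by apply: g0; rewrite E -(scale0r 0) linear_scale// scale0r.
have [c E] := gM (f y); exists c.
by apply: (can_inj hK); rewrite linear_scale.
Qed.

Lemma line_genZ L c (g : L) : c != 0 -> line_gen g -> line_gen (c *: g).
Proof.
move=> c0 [g0 gL]; split.
  by apply/eqP; rewrite scaler_eq0 (negbTE c0) /=; apply/eqP.
by move=> x; have [d ->] := gL x; exists (d / c); rewrite scalerA divfK.
Qed.

Lemma tensPl L M c (v v' : L) (w : M) :
  (c *: v + v') ⊗ w = c *: (v ⊗ w) + v' ⊗ w.
Proof.
apply/val_inj/val_inj/funext => -[b bP] /=.
by have /asboolP[b1 _] := bP; rewrite [LHS]b1.
Qed.

Lemma tensPr L M c (v : L) (w w' : M) :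
  v ⊗ (c *: w + w') = c *: (v ⊗ w) + v ⊗ w'.
Proof.
apply/val_inj/val_inj/funext => -[b bP] /=.
by have /asboolP[_ b2] := bP; rewrite [LHS]b2.
Qed.

Lemma tensZl L M c (v : L) (w : M) : (c *: v) ⊗ w = c *: (v ⊗ w).
Proof.
have l : linear (fun v : L => v ⊗ w) by move=> ? ? ?; exact: tensPl.
exact: (linear_scale c v l).
Qed.

Lemma tensZr L M c (v : L) (w : M) : v ⊗ (c *: w) = c *: (v ⊗ w).
Proof.
have l : linear (fun w : M => v ⊗ w) by move=> ? ? ?; exact: tensPr.
exact: (linear_scale c w l).
Qed.

Lemma line_gen_tens L M (g : L) (h : M) :
  line_gen g -> line_gen h -> line_gen (g ⊗ h).
Proof.
move=> [g0 gL] [h0 hM]; split.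
  have [l lg] := line_form g0; have [m mh] := line_form h0.
  have bP : bilinear_sub L M (fun vw => (l vw.1 : K) * (m vw.2 : K)).
    split=> z a x y /=; rewrite linearP; first by rewrite mulrDl -mulrA.
    by rewrite mulrDr /GRing.scale/= mulrCA.
  move=> E; have := congr1 (fun t : tensor L M => \val (\val t) (ssub bP)) E.
  by rewrite /= lg mh mulr1 => /eqP; rewrite oner_eq0.
move=> [x xP]; have : tensor_sub L M x by apply/asboolP.
move=> sx; suff [c E] : exists c : K, x = c *: pure_tensor g h.
  by exists c; apply/val_inj.
move: x sx {xP}; apply: span_ind.
- by exists 0; rewrite scale0r.
- move=> a _ _ [c ->] [d ->]; exists (a * c + d).
  by rewrite scalerDl scalerA.
move=> _ [[v w] _ <-] /=; have [c ->] := gL v; have [d ->] := hM w.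
exists (c * d).
have E : (c *: g) ⊗ (d *: h) = (c * d) *: (g ⊗ h).
  by rewrite tensZl tensZr scalerA.
exact: (congr1 \val E).
Qed.

Lemma dual_genE L (g : L) : g <> 0 -> \val (dual_gen g) g = 1.
Proof.
move=> g0; rewrite /dual_gen; case: xgetP => [f _ //|H].
have [l lg] := line_form g0.
by case: (H (mkdual (fun a x y => linearP l a x y))).
Qed.

Lemma dual_eq L (g : L) (f f' : dual L) : line_gen g ->
  \val f g = \val f' g -> f = f'.
Proof.
move=> gL fg; apply: val_inj; apply: (line_map_eq gL) => //.
  by apply/asboolP; exact: (valP f).
by apply/asboolP; exact: (valP f').
Qed.

Lemma dual_genZ L c (g : L) : line_gen g -> c != 0 ->
  dual_gen (c *: g) = c^-1 *: dual_gen g.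
Proof.
move=> gL c0; have cgL := line_genZ c0 gL; apply: (dual_eq cgL).
rewrite dual_genE; last by have [] := cgL.
have l : linear (\val (dual_gen g)) by apply/asboolP; exact: (valP (dual_gen g)).
rewrite /= fctE (linear_scale _ _ l) dual_genE; last by have [] := gL.
by rewrite /GRing.scale/= mulr1 mulVf.
Qed.

Lemma line_gen_dual L (g : L) : line_gen g -> line_gen (dual_gen g).
Proof.
move=> gL; have g0 := gL.1; split=> [E|f].
  have := dual_genE g0; rewrite E => /esym/eqP.
  by rewrite [X in _ == X](_ : _ = 0)// oner_eq0.
exists (\val f g); apply: (dual_eq gL).
by rewrite /= fctE dual_genE// /GRing.scale/= mulr1.
Qed.

End Lines.

Section DetLines.
Variables (K : fieldType) (V : lmodType K).
Implicit Types (A : subspace V).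

Lemma in_DetK A a : generates A a -> \val (in_Det A a) = a.
Proof. by move=> [aA _]; rewrite /in_Det insubdK//; apply/asboolP. Qed.

Lemma in_DetZ A c a : c != 0 -> generates A a ->
  in_Det A (c *: a) = c *: in_Det A a.
Proof.
move=> c0 aA; apply: val_inj; rewrite in_DetK; last exact: generatesZ.
by rewrite /= in_DetK.
Qed.

Lemma line_gen_Det A a : finite_dim A -> generates A a -> line_gen (in_Det A a).
Proof.
move=> [s sA] aA; split=> [E|[x xA]].
  by have := in_DetK aA; rewrite E => /esym; have [] := aA.
have [c c0 ac] := generatesP sA aA.
have xA' : ext_pow (dim A) A x by apply/asboolP.
have [d xd] : exists d : K, x = d *: blade s.
  by apply: (ext_pow_top sA); rewrite -(basis_dim sA).
exists (d / c); apply: val_inj; rewrite /= in_DetK// ac scalerA divfK//.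
Qed.

Lemma Det_gen A (xi : Det A) : xi <> 0 -> generates A (\val xi).
Proof.
case: xi => x xA xi0; split; first by apply/asboolP.
by move=> x0; apply: xi0; apply: val_inj.
Qed.

Lemma in_Det_val A (xi : Det A) : xi <> 0 -> in_Det A (\val xi) = xi.
Proof. by move=> xi0; apply: val_inj; rewrite in_DetK//; exact: Det_gen. Qed.

End DetLines.

Section DetElements.
Variables (K : fieldType) (V W : lmodType K).
Implicit Types (A : subspace V) (B : subspace W).

Definition det_elt A B (a : multivec V) (d : multivec W) :
    tensor (Det A) (dual (Det B)) :=
  in_Det A a ⊗ dual_gen (in_Det B d).

Lemma det_eltZ A B c a e d : finite_dim B -> generates A a -> generates B d ->
  c != 0 -> e != 0 ->
  det_elt A B (c *: a) (e *: d) = (c / e) *: det_elt A B a d.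
Proof.
move=> fB aA dB c0 e0; rewrite /det_elt !in_DetZ// dual_genZ//.
  by rewrite tensZl tensZr scalerA.
exact: line_gen_Det.
Qed.

Lemma det_elt_line A B a d : finite_dim A -> finite_dim B ->
  generates A a -> generates B d -> line_gen (det_elt A B a d).
Proof.
move=> fA fB aA dB; apply: line_gen_tens; first exact: line_gen_Det.
by apply: line_gen_dual; exact: line_gen_Det.
Qed.

End DetElements.

Definition cap (K : fieldType) (V : lmodType K) (X Y : subspace V) : subspace V.
Proof.
exists (fun x => X x /\ Y x); first by split; exact: ss0.
by move=> a x y [Xx Yx] [Xy Yy]; split; exact: ssP.
Defined.

Lemma quot_pi_eq0 (K : fieldType) (V : lmodType K) (X : subspace V) x :
  quot_pi X x = 0 <-> X x.
Proof. by rewrite -(linear0 (quot_pi X)) quot_piP subr0. Qed.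

Section Psi.
Variables (R : realType) (k : scalar_kind).
Variables V W : normedModType (scalars R k).
Variables (T : bop V W) (X : subspace W).

(** The sequence 0 -> ker T -> T^-1 X -> X -> coker T -> 0 is exact; it is cut
    at the intersection of ran T and X. *)
Lemma ses_preim : ses T (lker T) (lpreim T X) (cap (lran T) X).
Proof.
split=> [x|y]; split.
- by move=> Tx; split=> //; rewrite /sscar /= Tx; exact: ss0.
- by case.
- by move=> [[x <-] Xx]; exists x.
- by move=> [x Xx <-]; split=> //; exists x.
Qed.

Lemma ses_target_dec : (forall y, exists x z, X z /\ y = T x + z) ->
  ses (quot_pi (lran T)) (cap (lran T) X) X (fullspace (coker T)).
Proof.
move=> dec; split=> [x|c]; split.
- by move=> [Tx Xx]; split=> //; apply/quot_pi_eq0.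
- by move=> [Xx /quot_pi_eq0 Tx].
- move=> _; have [x [z [Xz E]]] := dec (repr c); exists z => //.
  rewrite -[RHS]quot_repr; apply/quot_piP; rewrite E opprD addrCA subrr addr0.
  by apply: ssN; exists x.
- by [].
Qed.

Hypotheses (TX : transversal X T) (fX : finite_dim X).

Lemma ses_target :
  ses (quot_pi (lran T)) (cap (lran T) X) X (fullspace (coker T)).
Proof. exact: ses_target_dec TX.2. Qed.

Lemma finite_dim_preim : finite_dim (lpreim T X).
Proof.
apply: (ses_finite_dim_mid ses_preim); first exact: TX.1.1.
by apply: finite_dim_sub fX => x [].
Qed.

Local Notation psi_elt := (det_elt (lpreim T X) X).
Local Notation det_gen := (det_elt (lker T) (fullspace (coker T))).

Lemma generates_pushforward a b : generates (lker T) a ->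
  homogeneous (lpreim T X) b -> generates (lpreim T X) (a ∧ b) ->
  generates (cap (lran T) X) (ext_map T b).
Proof.
by move=> ak bX abX; apply/(ses_generates_l ses_preim finite_dim_preim ak bX).
Qed.

(** Bases adapted to the exact sequence determine the value of f at one
    generator of the line Det T.  Another choice of alpha, beta, gamma multiplies
    both sides of the formula by the same scalar: by ses_factor, beta changes
    alpha /\ beta and T_* beta by the same factor, and gamma changes pi_* gamma
    and gamma /\ T_* beta by the same factor. *)
Lemma psi_exists : exists f : DetF T -> DetX X T, is_psi f.
Proof.
have [sa [sb [sak sabX sbR]]] := ses_bases ses_preim finite_dim_preim.
have [x|sc scX] := basis_complete fX _ (basis_neq0 sbR).
  by move=> /(basis_mem sbR)[].
have scC := ses_basis_quot ses_target sbR scX.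
have csX := basis_swap scX.
have fC : finite_dim (fullspace (coker T)) := TX.1.2.
have gl : line_gen (det_gen (blade sa) (blade (map (quot_pi (lran T)) sc))).
  by apply: det_elt_line => //; [exact: TX.1.1|exact: generates_blade..].
have [f [fl fg]] := line_map (psi_elt (blade (sa ++ sb)) (blade (sc ++ map T sb))) gl.
exists f; split=> // a b c bX cX ak abX cbX.
have bR := generates_pushforward ak bX abX.
have cC : generates (fullspace (coker T)) (ext_map (quot_pi (lran T)) c).
  exact/(ses_generates_r ses_target fX bR cX).
have [d d0 aE] := generatesP sak ak.
have [m [m0 mE _ TbE]] := ses_factor ses_preim sak sabX bX bR.
have [n [n0 _ nE ncE]] := ses_factor ses_target sbR scX cX cC.
rewrite -[LHS]/(f (det_gen _ _)) -[RHS]/(psi_elt _ _).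
rewrite ncE TbE aE wedgeZl mE wedgeZr nE !scalerA.
rewrite -[blade sa](scale1r) !scalerA !det_eltZ ?mulr1 ?mulf_neq0//;
  try exact: generates_blade.
rewrite linear_scale// fg; congr (_ *: _).
by rewrite invfM mulrA mulfK.
Qed.

Lemma psiP : is_psi (@psi R k V W X T).
Proof.
rewrite /psi; case: xgetP => [f _ //|H].
by have [f fP] := psi_exists; case: (H f).
Qed.

Lemma psi_bij : bijective (@psi R k V W X T).
Proof.
have [sa [sb [sak sabX sbR]]] := ses_bases ses_preim finite_dim_preim.
have [x|sc scX] := basis_complete fX _ (basis_neq0 sbR).
  by move=> /(basis_mem sbR)[].
have csX := basis_swap scX.
have scC := ses_basis_quot ses_target sbR scX.
have [fl fP] := psiP.
have gl : line_gen (det_gen (blade sa) (blade (map (quot_pi (lran T)) sc))).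
  by apply: det_elt_line => //; [exact: TX.1.1|exact: TX.1.2|exact: generates_blade..].
apply: (line_map_bij gl fl).
have := fP (blade sa) (blade sb) (blade sc).
rewrite !wedge_blade !ext_map_blade !wedge_blade => -> //.
- apply: det_elt_line => //; first exact: finite_dim_preim.
    exact: generates_blade.
  exact: generates_blade.
- apply: homogeneous_blade => x xs.
  by apply: (basis_mem sabX); rewrite mem_cat xs orbT.
- apply: homogeneous_blade => x xs.
  by apply: (basis_mem csX); rewrite mem_cat xs.
- exact: generates_blade.
- exact: generates_blade.
- exact: generates_blade.
Qed.

End Psi.

(** * The isomorphism phi *)

(** Contraction of Det B^* with Det B, transported to lines L1, L2, L3.  The
    spaces A and A' are kept apart because (TS)^-1 X and S^-1 (T^-1 X) are equal
    without being convertible. *)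
Lemma contraction (K : fieldType) (U V W L1 L2 L3 : lmodType K)
    (A A' : subspace U) (B : subspace V) (C : subspace W)
    (p1 : L1 -> tensor (Det A) (dual (Det B)))
    (p2 : L2 -> tensor (Det B) (dual (Det C)))
    (p3 : L3 -> tensor (Det A') (dual (Det C))) :
  A' = A -> finite_dim A -> finite_dim B -> finite_dim C ->
  linear p1 -> linear p2 -> linear p3 ->
  bijective p1 -> bijective p2 -> bijective p3 ->
  exists2 f : tensor L1 L2 -> L3, linear f & forall m n x e1 e2 e3,
    generates A' m -> generates B n -> generates C x ->
    p1 e1 = det_elt A B m n -> p2 e2 = det_elt B C n x ->
    p3 e3 = det_elt A' C m x -> f (e1 ⊗ e2) = e3.
Proof.
move=> AA; rewrite {}AA in p3 *.
move=> fA fB fC l1 l2 l3 b1 b2 b3; have [i1 i1K Ki1] := b1.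
have [i2 i2K Ki2] := b2; have [i3 i3K Ki3] := b3.
have [sm bm] := fA; have [sn bn] := fB; have [sx bx] := fC.
have gm := generates_blade bm; have gn := generates_blade bn.
have gx := generates_blade bx.
pose e1 := i1 (det_elt A B (blade sm) (blade sn)).
pose e2 := i2 (det_elt B C (blade sn) (blade sx)).
pose e3 := i3 (det_elt A C (blade sm) (blade sx)).
have sc (L M : lmodType K) (f : L -> M) g c d e : linear f -> cancel f g ->
    f d = c *: f e -> d = c *: e.
  by move=> fl fg E; apply: (can_inj fg); rewrite E linear_scale.
have g1 : line_gen e1.
  by apply: (line_gen_inj l1 b1); rewrite Ki1; exact: det_elt_line.
have g2 : line_gen e2.
  by apply: (line_gen_inj l2 b2); rewrite Ki2; exact: det_elt_line.
have [f [fl fE]] := line_map e3 (line_gen_tens g1 g2).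
exists f => // m n x d1 d2 d3 mM nN xX E1 E2 E3.
have [a a0 ma] := generatesP bm mM; have [b b0 nb] := generatesP bn nN.
have [c c0 xc] := generatesP bx xX.
have -> : d1 = (a / b) *: e1.
  apply: (sc _ _ _ _ _ _ _ l1 i1K); rewrite Ki1 E1 ma nb; exact: det_eltZ.
have -> : d2 = (b / c) *: e2.
  apply: (sc _ _ _ _ _ _ _ l2 i2K); rewrite Ki2 E2 xc nb; exact: det_eltZ.
have -> : d3 = (a / c) *: e3.
  apply: (sc _ _ _ _ _ _ _ l3 i3K); rewrite Ki3 E3 ma xc; exact: det_eltZ.
(* The factor b of the generator of Det B cancels. *)
rewrite tensZl tensZr scalerA linear_scale// fE; congr (_ *: _).
by rewrite mulrA mulfVK.
Qed.

Section BoundedOperatorAlgebra.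
Variables (R : realType) (k : scalar_kind).
Variables (V W : normedModType (scalars R k)) (T : bop V W).

Lemma bop0 : T 0 = 0. Proof. exact: linear0. Qed.
Lemma bopB x y : T (x - y) = T x - T y. Proof. exact: linearB. Qed.
Lemma bopN x : T (- x) = - T x. Proof. exact: linearN. Qed.
Lemma bopD x y : T (x + y) = T x + T y. Proof. exact: linearD. Qed.
Lemma bopZ a x : T (a *: x) = a *: T x. Proof. exact: linearZ. Qed.

End BoundedOperatorAlgebra.

Section Composition.
Variables (R : realType) (k : scalar_kind).
Variables V1 V2 V3 : normedModType (scalars R k).
Variables (S : bop V1 V2) (T : bop V2 V3).
Local Notation TS := (bop_comp T S).
Local Notation piS := (quot_pi (lran S)).
Local Notation piT := (quot_pi (lran T)).
Local Notation piTS := (quot_pi (lran TS)).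
Local Notation full c := (fullspace (coker c)).

Lemma coker_compE y : coker_comp S T (piS y) = piTS (T y).
Proof. exact: quot_mapE. Qed.

Lemma coker_projE z : coker_proj S T (piTS z) = piT z.
Proof. exact: quot_mapE. Qed.

(** The exact sequence
      0 -> ker S -> ker TS -> ker T -> coker S -> coker TS -> coker T -> 0
    is cut at the images of its maps into this short exact sequence and the next
    three. *)
Lemma ses_ker_comp : ses S (lker S) (lker TS) (cap (lran S) (lker T)).
Proof.
split=> [x|y]; split.
- move=> Sx; split=> //.
  by have : T (S x) = 0 by rewrite (Sx : S x = 0) linear0.
- by case.
- by move=> [[x <-] Tx]; exists x.
- by move=> [x Tx <-]; split=> //; exists x.
Qed.

Lemma ses_ker_coker :
  ses piS (cap (lran S) (lker T)) (lker T) (lker (coker_comp S T)).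
Proof.
split=> [y|c]; split.
- by move=> [Sy Ty]; split=> //; apply/quot_pi_eq0.
- by move=> [Ty /quot_pi_eq0].
- rewrite -[c]quot_repr {1}/sscar /= coker_compE => /quot_pi_eq0[x E].
  exists (repr c - S x).
    have : T (repr c - S x) = 0.
      by rewrite bopB -E subrr.
    exact.
  by apply/quot_piP; rewrite addrAC subrr add0r; apply: ssN; exists x.
- move=> [y Ty <-]; rewrite /sscar /= coker_compE.
  by rewrite (Ty : T y = 0) linear0.
Qed.

Lemma ses_coker_comp :
  ses (coker_comp S T) (lker (coker_comp S T)) (full S) (lran (coker_comp S T)).
Proof.
split=> c; split=> //; first by case.
  by move=> [d <-]; exists d.
by move=> [d _ <-]; exists d.
Qed.

Lemma ses_coker_proj :
  ses (coker_proj S T) (lran (coker_comp S T)) (full TS) (full T).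
Proof.
split=> [c|c]; split=> //.
- move=> [d <-]; split=> //; rewrite -[d]quot_repr /= coker_compE coker_projE.
  by apply/quot_pi_eq0; exists (repr d).
- rewrite -[c]quot_repr /= coker_projE => -[_ /quot_pi_eq0[y <-]].
  by exists (piS y); rewrite /= coker_compE.
- by move=> _; exists (piTS (repr c)); rewrite //= coker_projE quot_repr.
Qed.

Hypotheses (fS : fredholm S) (fT : fredholm T).

Lemma fredholm_comp : fredholm TS.
Proof.
split.
  apply: (ses_finite_dim_mid ses_ker_comp); first exact: fS.1.
  by apply: finite_dim_sub fT.1 => x [].
apply: (ses_finite_dim_mid ses_coker_proj); last exact: fT.2.
by have [s [t [_ _ tP]]] := ses_bases ses_coker_comp fS.2; eexists; exact: tP.
Qed.

(** Generators of the lines in the six-term sequence, as needed to evaluate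
    a solution of is_phi. *)
Lemma phi_data : exists a1 a2 a3 a4 a5,
  [/\ [/\ homogeneous (lker TS) a2, homogeneous (lker T) a3,
      homogeneous (full S) a4 & homogeneous (full TS) a5],
    generates (lker S) a1 /\ generates (lker TS) (a1 ∧ a2),
    generates (lker T) (a3 ∧ ext_map S a2) /\
      generates (full S) (ext_map piS a3 ∧ a4),
    generates (full TS) (a5 ∧ ext_map (coker_comp S T) a4)
    & generates (full T) (ext_map (coker_proj S T) a5)].
Proof.
have [fTSk fTSc] := fredholm_comp.
have [s1 [s2 [b1 b12 b2]]] := ses_bases ses_ker_comp fTSk.
have [x|s3 b23] := basis_complete fT.1 _ (basis_neq0 b2).
  by move=> /(basis_mem b2)[].
have b3 := ses_basis_quot ses_ker_coker b2 b23.
have [//|s4 b34] := basis_complete fS.2 _ (basis_neq0 b3).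
have b4 := ses_basis_quot ses_coker_comp b3 b34.
have [//|s5 b45] := basis_complete fTSc _ (basis_neq0 b4).
have b5 := ses_basis_quot ses_coker_proj b4 b45.
exists (blade s1), (blade s2), (blade s3), (blade s4), (blade s5).
rewrite !ext_map_blade !wedge_blade.
have b32 := basis_swap b23; have b54 := basis_swap b45.
split; [split|split; exact: generates_blade|split; exact: generates_blade|exact: generates_blade|exact: generates_blade].
- apply: homogeneous_blade => x xs.
  by apply: (basis_mem b12); rewrite mem_cat xs orbT.
- apply: homogeneous_blade => x xs.
  by apply: (basis_mem b32); rewrite mem_cat xs.
- exact: homogeneous_blade.
- exact: homogeneous_blade.
Qed.

Lemma is_phi_value f : is_phi S T f -> exists a1 d3 d4 a5 a12 d54,
  [/\ generates (lker S) a1 /\ generates (full S) d3,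
      generates (lker T) d4 /\ generates (full T) a5,
      generates (lker TS) a12 /\ generates (full TS) d54
    & f (det_elt (lker S) (full S) a1 d3 ⊗ det_elt (lker T) (full T) d4 a5) =
      (-1) ^+ rho S T *: det_elt (lker TS) (full TS) a12 d54].
Proof.
move=> [_ fP]; have [a1 [a2 [a3 [a4 [a5 [[h2 h3 h4 h5] [g1 g12] [g32 g34] g54 g5]]]]]] := phi_data.
do 6!eexists; split; last exact: fP h2 h3 h4 h5 g1 g12 g32 g34 g54 g5.
all: by [].
Qed.

Lemma det_gen_line (U W : normedModType (scalars R k)) (A : bop U W) a d :
  fredholm A -> generates (lker A) a -> generates (full A) d ->
  line_gen (det_elt (lker A) (full A) a d).
Proof. by move=> [fk fc]; exact: det_elt_line. Qed.

Lemma is_phi_bij f : is_phi S T f -> bijective f.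
Proof.
move=> fP; have [a1 [d3 [d4 [a5 [a12 [d54 [[g1 g3] [g4 g5] [g12 g54] E]]]]]]] :=
  is_phi_value fP.
have gl := line_gen_tens (det_gen_line fS g1 g3) (det_gen_line fT g4 g5).
apply: (line_map_bij gl fP.1); rewrite E.
apply: line_genZ; first by rewrite signr_eq0.
exact: det_gen_line fredholm_comp g12 g54.
Qed.

Lemma is_phi_uniq f f' : is_phi S T f -> is_phi S T f' -> f = f'.
Proof.
move=> [fl fP] [fl' fP'].
have [a1 [a2 [a3 [a4 [a5 [[h2 h3 h4 h5] [g1 g12] [g32 g34] g54 g5]]]]]] := phi_data.
have gl := line_gen_tens (det_gen_line fS g1 g34) (det_gen_line fT g32 g5).
apply: (line_map_eq gl fl fl').
exact: etrans (fP _ _ _ _ _ h2 h3 h4 h5 g1 g12 g32 g34 g54 g5)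
  (esym (fP' _ _ _ _ _ h2 h3 h4 h5 g1 g12 g32 g34 g54 g5)).
Qed.

Variable X : subspace V3.
Hypotheses (TSX : transversal X TS) (fX : finite_dim X).
Local Notation N := (lpreim T X).

Lemma transversal_comp_l : transversal X T.
Proof.
split=> // y; have [x [z [Xz ->]]] := TSX.2 y; by exists (S x), z.
Qed.

Lemma transversal_comp_r : transversal N S.
Proof.
split=> // y; have [x [z [Xz E]]] := TSX.2 (T y); exists x, (y - S x).
split; last by rewrite addrC subrK.
have : X (T (y - S x)) by rewrite bopB E /bop_fun /= addrC addKr.
exact.
Qed.

Lemma preim_comp : lpreim TS X = lpreim S N.
Proof. exact: subspace_eq. Qed.

Let fN : finite_dim N := finite_dim_preim transversal_comp_l fX.
Local Notation psiS := (@psi R k V1 V2 N S).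
Local Notation psiT := (@psi R k V2 V3 X T).
Local Notation psiTS := (@psi R k V1 V3 X TS).

(** In terms of psi, phi is the contraction of Det N^* with Det N. *)
Definition contracts (f : tensor (DetF S) (DetF T) -> DetF TS) :=
  forall m n x e1 e2 e3, generates (lpreim TS X) m -> generates N n ->
    generates X x -> psiS e1 = det_elt _ _ m n -> psiT e2 = det_elt _ _ n x ->
    psiTS e3 = det_elt _ _ m x -> f (e1 ⊗ e2) = e3.

Lemma contracts_exists : exists2 f, linear f & contracts f.
Proof.
have TX := transversal_comp_l; have SN := transversal_comp_r.
have fM : finite_dim (lpreim S N).
  by rewrite -preim_comp; exact: finite_dim_preim.
exact: (contraction preim_comp fM fN fX (psiP SN fN).1 (psiP TX fX).1
  (psiP TSX fX).1 (psi_bij SN fN) (psi_bij TX fX) (psi_bij TSX fX)).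
Qed.

(** Let b complete a1 /\ a2 to a generator of Det ((TS)^-1 X), and let b4, b5
    lift a4, a5 to N and X.  Then psi maps the elements of Det S, Det T and
    Det TS in the formula for phi to tensors of the generators
    - a1 /\ a2 /\ b of Det ((TS)^-1 X),
    - a3 /\ b4 /\ S_* (a2 /\ b) or a3 /\ S_* a2 /\ b4 /\ S_* b of Det N,
    - b5 /\ T_* b4 /\ (TS)_* b of Det X.
    The two generators of Det N differ by the sign which it takes to move S_* a2
    past b4, and this sign is (-1) ^ rho. *)
Lemma contracts_is_phi f : linear f -> contracts f -> is_phi S T f.
Proof.
move=> fl fC; split=> // a1 a2 a3 a4 a5 h2 h3 h4 h5 g1 g12 g32 g34 g54 g5.
have TX := transversal_comp_l; have SN := transversal_comp_r.
have fM := finite_dim_preim TSX fX.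
have [sa [sb [sak sab sbR]]] := ses_bases (ses_preim TS X) fM.
pose b := blade sb.
have hb : homogeneous (lpreim TS X) b.
  by apply: homogeneous_blade => x xs; apply: (basis_mem sab); rewrite mem_cat xs orbT.
have gb : generates (cap (lran TS) X) (ext_map TS b).
  by rewrite ext_map_blade; exact: generates_blade.
have gm : generates (lpreim TS X) (a1 ∧ a2 ∧ b).
  exact/(ses_generates_l (ses_preim TS X) fM g12 hb).
have [k2 a2k] := h2; have [k4 a4k] := h4; have [k5 a5k] := h5.
have liftN c : full S c -> exists2 y, N y & piS y = c.
  by move=> fc; have [_ /(_ c)[/(_ fc)[y Ny yc] _]] := ses_target SN; exists y.
have [b4 b4k b4E] := ext_pow_lift liftN a4k.
have liftX c : full TS c -> exists2 y, X y & piTS y = c.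
  by move=> fc; have [_ /(_ c)[/(_ fc)[y Ny yc] _]] := ses_target TSX; exists y.
have [b5 b5k b5E] := ext_pow_lift liftX a5k.
have h2M : homogeneous (lpreim TS X) a2.
  apply: homogeneous_sub h2 => x; rewrite {1}/sscar /= => E.
  by rewrite /sscar /= E; exact: ss0.
have h2b : homogeneous (lpreim S N) (a2 ∧ b).
  by rewrite -preim_comp; exact: homogeneous_wedge.
have gm' : generates (lpreim S N) (a1 ∧ (a2 ∧ b)).
  by rewrite -preim_comp wedgeA.
have fM' : finite_dim (lpreim S N) by rewrite -preim_comp.
have gS : generates (cap (lran S) N) (ext_map S (a2 ∧ b)).
  exact/(ses_generates_l (ses_preim S N) fM' g1 h2b).
have h3N : homogeneous N a3.
  apply: homogeneous_sub h3 => x; rewrite {1}/sscar /= => E.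
  by rewrite /sscar /= E; exact: ss0.
have h4N : homogeneous N b4 by exists k4.
have h34 := homogeneous_wedge h3N h4N.
have gn : generates N (a3 ∧ b4 ∧ ext_map S (a2 ∧ b)).
  apply/(ses_generates_r (ses_target SN) fN gS h34).
  by rewrite ext_map_wedge b4E.
have hT4 : homogeneous X (ext_map T b4).
  by exists k4; apply: ext_pow_map b4k.
have h5X : homogeneous X b5 by exists k5.
have cE : ext_map piTS (b5 ∧ ext_map T b4) = a5 ∧ ext_map (coker_comp S T) a4.
  rewrite ext_map_wedge b5E -b4E; congr (_ ∧ _).
  by apply: ext_map_square => y; rewrite /= coker_compE.
have gx : generates X (b5 ∧ ext_map T b4 ∧ ext_map TS b).
  apply/(ses_generates_r (ses_target TSX) fX gb); last by rewrite cE.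
  exact: homogeneous_wedge.
have xE : b5 ∧ ext_map T b4 ∧ ext_map TS b = b5 ∧ ext_map T (b4 ∧ ext_map S b).
  by rewrite ext_map_wedge wedgeA -(ext_map_comp (h := TS)).
have hSb : homogeneous N (ext_map S b).
  by have [l bl] := hb; exists l; apply: ext_pow_map bl.
have Sa2k : ext_pow k2 (fullspace V2) (ext_map S a2) by apply: ext_pow_map a2k.
have nE : a3 ∧ b4 ∧ ext_map S (a2 ∧ b) =
    (-1) ^+ (k4 * k2) *: (a3 ∧ ext_map S a2 ∧ (b4 ∧ ext_map S b)).
  rewrite ext_map_wedge !wedgeA -[a3 ∧ b4 ∧ _]wedgeA (wedge_comm b4k Sa2k).
  by rewrite wedgeZr wedgeZl wedgeA.
have sgn0 : (-1) ^+ (k4 * k2) != 0 :> scalars R k by rewrite signr_eq0.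
have gn' : generates N (a3 ∧ ext_map S a2 ∧ (b4 ∧ ext_map S b)).
  have := generatesZ sgn0 gn; rewrite nE scalerA -expr2 sqrr_sign scale1r.
  exact.
have dker : dim (lker TS) = (dim (lker S) + k2)%N.
  have [g1t _] := g1; have [g12t g120] := g12.
  have g1t' : ext_pow (dim (lker S)) (lker TS) a1.
    apply: ext_pow_sub g1t => x Sx.
    by have : T (S x) = 0 by rewrite (Sx : S x = 0) bop0.
  exact: ext_pow_deg g12t (ext_pow_wedge g1t' a2k) g120.
have dcok : dim (full TS) = (dim (full T) + k4)%N.
  have [g5t g50] := g5; have [g54t g540] := g54.
  have p5k : ext_pow k5 (full T) (ext_map (coker_proj S T) a5).
    by apply: ext_pow_map a5k.
  rewrite -(ext_pow_deg p5k g5t g50).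
  have c4k : ext_pow k4 (full TS) (ext_map (coker_comp S T) a4).
    by apply: ext_pow_map a4k.
  exact: ext_pow_deg g54t (ext_pow_wedge a5k c4k) g540.
(* Modulo 2, dim ker S + dim ker TS = k2 and dim coker T + dim coker TS = k4. *)
have -> : (-1) ^+ rho S T = (-1) ^+ (k4 * k2) :> scalars R k.
  rewrite -signr_odd -[RHS]signr_odd; congr (_ ^+ _); congr nat_of_bool.
  by rewrite /rho dker dcok !oddM !oddD !addbA !addbb /= andbC.
pose e1 : DetF S := det_elt (lker S) (full S) a1 (ext_map piS a3 ∧ a4).
pose e2 : DetF T := det_elt (lker T) (full T) (a3 ∧ ext_map S a2)
  (ext_map (coker_proj S T) a5).
pose e3 : DetF TS := det_elt (lker TS) (full TS) (a1 ∧ a2)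
  (a5 ∧ ext_map (coker_comp S T) a4).
have p3 : psiTS e3 = det_elt (lpreim TS X) X (a1 ∧ a2 ∧ b) (b5 ∧ ext_map T b4 ∧ ext_map TS b).
  rewrite /e3 -cE; apply: (psiP TSX fX).2 => //.
  exact: homogeneous_wedge.
have p1 : psiS e1 = det_elt (lpreim S N) N (a1 ∧ (a2 ∧ b)) (a3 ∧ b4 ∧ ext_map S (a2 ∧ b)).
  rewrite /e1 -b4E -ext_map_wedge; exact: (psiP SN fN).2.
have p5 : ext_map piT b5 = ext_map (coker_proj S T) a5.
  by rewrite -b5E; apply: ext_map_comp => y; rewrite /= coker_projE.
have p2 : psiT e2 = det_elt N X (a3 ∧ ext_map S a2 ∧ (b4 ∧ ext_map S b))
    (b5 ∧ ext_map T b4 ∧ ext_map TS b).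
  rewrite /e2 -p5 xE; apply: (psiP TX fX).2 => //; first exact: homogeneous_wedge.
  by rewrite -xE.
have p1' : psiS ((-1) ^+ (k4 * k2) *: e1) = det_elt (lpreim S N) N
    (a1 ∧ a2 ∧ b) (a3 ∧ ext_map S a2 ∧ (b4 ∧ ext_map S b)).
  rewrite (linear_scale _ _ (psiP SN fN).1) p1 nE -[a1 ∧ (a2 ∧ b)]scale1r.
  rewrite det_eltZ// ?oner_eq0// div1r scalerA divff// scale1r wedgeA//.
suff E : f (e1 ⊗ e2) = (-1) ^+ (k4 * k2) *: e3 by exact: E.
rewrite -(fC _ _ _ _ _ _ gm gn' gx p1' p2 p3).
by rewrite tensZl linear_scale// scalerA -expr2 sqrr_sign scale1r.
Qed.

Lemma phi_is_phi : is_phi S T (phi S T).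
Proof.
rewrite /phi; case: xgetP => [f _ //|H].
by have [f fl fC] := contracts_exists; case: (H f); exact: contracts_is_phi.
Qed.

Lemma phi_contracts : contracts (phi S T).
Proof.
have [f fl fC] := contracts_exists.
by rewrite (is_phi_uniq phi_is_phi (contracts_is_phi fl fC)).
Qed.

End Composition.

Lemma finite_dim_span (K : fieldType) (V : lmodType K) (s : seq V) :
  finite_dim (span [set` s]).
Proof.
have n0 : blade ([::] : seq V) <> 0 by apply/independent_blade => c _ [].
by have [//|//|t tX] := basis_extend (X := span [set` s]) (e := s) _ _ n0; exists t.
Qed.

(** Representatives of a basis of the cokernel span a transversal subspace. *)
Lemma fredholm_transversal (R : realType) (k : scalar_kind)
    (V W : normedModType (scalars R k)) (T : bop V W) :
  fredholm T -> exists2 X, finite_dim X & transversal X T.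
Proof.
move=> fT; have [_ [s sC]] := fT.
exists (span [set` map repr s]); first exact: finite_dim_span.
split=> // y; have /span_comb[c E] := basis_gen sC (I : fullspace _ (quot_pi (lran T) y)).
pose z := \sum_(i < size s) c i *: (repr s`_i : W).
have [x Tx] : lran T (y - z).
  apply/quot_piP; rewrite E linear_sum; apply: eq_bigr => i _.
  by rewrite linearZ /= quot_repr.
exists x, z; split; last by rewrite Tx subrK.
apply: ss_sum => i; apply: ssZ; apply: mem_spans.
by apply/mapP; exists s`_i => //; exact: mem_nth.
Qed.

Lemma phiP (R : realType) (k : scalar_kind)
    (V1 V2 V3 : normedModType (scalars R k)) (S : bop V1 V2) (T : bop V2 V3) :
  fredholm S -> fredholm T -> is_phi S T (phi S T).
Proof.
move=> fS fT; have [X fX TSX] := fredholm_transversal (fredholm_comp fS fT).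
exact (phi_is_phi fS fT TSX fX).
Qed.

(** * Comparison of psi for two subspaces *)

Section ComparisonCore.
Variables (K : fieldType) (V W : lmodType K) (f : {linear V -> W}).
Variable E E' : {linear W -> V}.

Lemma graph_linear : linear (fun u : V => (u, f u) : V * W).
Proof. by move=> a x y; rewrite linearP. Qed.
Definition graph_map := linear_of graph_linear.

Lemma inl_linear : linear (fun u : V => (u, 0) : V * W).
Proof.
by move=> a x y; congr pair; rewrite /= scaler0 addr0.
Qed.
Definition inl_map := linear_of inl_linear.

Lemma defect_linear : linear (fun w : W => (E w, f (E w) - w) : V * W).
Proof.
move=> a x y; congr pair; rewrite /=; first exact: linearP.
by rewrite !linearP /= addrACA -scalerDr.
Qed.
Definition defect_map := linear_of defect_linear.

Lemma cograph_linear : linear (fun w : W => (E' w, w) : V * W).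
Proof. by move=> a x y; rewrite linearP. Qed.
Definition cograph_map := linear_of cograph_linear.

Lemma span_map (g : {linear V -> (V * W)%type}) s z :
  span [set` s] z -> span [set` map g s] (g z).
Proof.
move: z; apply: span_ind => [|a x y gx gy|x xs].
- by rewrite linear0; exact: ss0.
- by rewrite linearP; exact: ssP.
- by apply: mem_spans; exact: map_f.
Qed.

(* In the application, sa is a basis of the kernel of f, completed by sb and sb'
   to bases of f^-1 X and f^-1 X', and sc lifts a basis of the cokernel to X.
   The vectors c' c of X' lift its opposite. *)
Variables (X X' : subspace W) (sa sb sb' : seq V) (sc : seq W).
Variables (c' : W -> W) (w : W -> V).
Hypothesis fa : forall x, x \in sa -> f x = 0.
Hypothesis sab : forall z, X (f z) -> span [set` sa ++ sb] z.
Hypothesis sab' : forall z, X' (f z) -> span [set` sa ++ sb'] z.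
Hypothesis EX : forall y, X (f (E y) - y).
Hypothesis EX' : forall y, X' (f (E' y) - y).
Hypothesis cX : forall c, c \in sc -> X c.
Hypothesis cX' : forall c, c \in sc -> X' (c' c).
Hypothesis fw : forall c, c \in sc -> f (w c) = c + c' c.

(** Both blades reduce, by adding multiples of their other entries, to blades
    on the same vectors (a, 0), (b, f b), (b', 0) and (w c, c). *)
Lemma comparison_core :
  blade (map graph_map (sa ++ sb) ++
         map defect_map (map c' sc ++ map f sb')) =
  (-1) ^+ (size sb * size sc + size sb * size sb' + size sc * size sb') *:
  blade (map inl_map (sa ++ sb') ++ map cograph_map (sc ++ map f sb)).
Proof.
have L : blade (map graph_map (sa ++ sb) ++
         map defect_map (map c' sc ++ map f sb')) =
    blade (map graph_map (sa ++ sb) ++ map (fun c => (w c, c)) sc ++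
           map inl_map sb').
  rewrite [map defect_map _]map_cat -!map_comp.
  rewrite (@blade_congr _ _ _ _ (fun c => (w c, c)) _ sc) => [|c cs].
    rewrite catA -[X in blade (_ ++ X)]cats0.
    rewrite (@blade_congr _ _ _ _ inl_map _ sb') ?cats0 -?catA// => b bs.
    pose z := E (f b) - b.
    have -> : (defect_map \o f) b - inl_map b = graph_map z.
      apply: injective_projections; first exact: erefl.
      by rewrite [RHS]linearB; exact: subr0.
    apply: (@span_subset _ _ (map graph_map (sa ++ sb))).
      by move=> y; rewrite mem_cat => ->.
    by apply/span_map/sab; rewrite /z linearB; exact: EX.
  pose z := E (c' c) - w c.
  have -> : (defect_map \o c') c - (w c, c) = graph_map z.
    apply: injective_projections; first exact: erefl.
    rewrite [RHS]linearB fw// opprD addrA addrAC; exact: erefl.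
  apply: (@span_subset _ _ (map graph_map (sa ++ sb))).
    by move=> y; rewrite mem_cat => ->.
  apply/span_map/sab; rewrite /z linearB fw// opprD addrA addrAC.
  by apply: ssB; [exact: EX|exact: cX].
have R : blade (map inl_map (sa ++ sb') ++ map cograph_map (sc ++ map f sb)) =
    blade (map inl_map (sa ++ sb') ++ map (fun c => (w c, c)) sc ++
           map graph_map sb).
  rewrite [map cograph_map _]map_cat -map_comp.
  rewrite (@blade_congr _ _ _ _ (fun c => (w c, c)) _ sc) => [|c cs].
    rewrite catA -[X in blade (_ ++ X)]cats0.
    rewrite (@blade_congr _ _ _ _ graph_map _ sb) ?cats0 -?catA// => b bs.
    pose z := E' (f b) - b.
    have -> : (cograph_map \o f) b - graph_map b = inl_map z.
      apply: injective_projections; first exact: erefl.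
      exact: subrr.
    apply: (@span_subset _ _ (map inl_map (sa ++ sb'))).
      by move=> y; rewrite mem_cat => ->.
    by apply/span_map/sab'; rewrite /z linearB; exact: EX'.
  pose z := E' c - w c.
  have -> : cograph_map c - (w c, c) = inl_map z.
    apply: injective_projections; first exact: erefl.
    exact: subrr.
  apply: (@span_subset _ _ (map inl_map (sa ++ sb'))).
    by move=> y; rewrite mem_cat => ->.
  apply/span_map/sab'; rewrite /z linearB fw// opprD addrA.
  by apply: ssB; [exact: EX'|exact: cX'].
rewrite L R !map_cat.
have -> : map graph_map sa = map inl_map sa.
  by apply/eq_in_map => a as_; apply: injective_projections; [exact: erefl|exact: fa].
set A := map inl_map sa; set B := map graph_map sb; set B' := map inl_map sb'.
set C := map _ sc.
rewrite -!catA.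
have E1 := blade_moves A B (C ++ B') [::]; rewrite !cats0 -!catA in E1.
have E2 := blade_moves A C B' B.
rewrite E1 E2 scalerA -exprD size_cat mulnDr /A /B /B' /C !size_map.
by congr (_ ^+ _ *: _).
Qed.

End ComparisonCore.

Lemma blade_opp (K : fieldType) (V : lmodType K) (s : seq V) :
  blade (map -%R s) = (-1) ^+ size s *: blade s.
Proof.
suff H p : blade (p ++ map -%R s) = (-1) ^+ size s *: blade (p ++ s).
  exact: (H [::]).
elim: s p => [|x s IH] p /=; first by rewrite scale1r.
have := blade_lin p (map -%R s) (-1) x 0; rewrite addr0 scaleN1r blade0 addr0 => ->.
by rewrite -cat1s catA IH -catA exprS mulN1r scaleNr scaleN1r.
Qed.

Section Comparison.
Variables (R : realType) (k : scalar_kind).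
Local Notation K := (scalars R k).
Variables V W : normedModType K.
Variable S : bop V W.

(** E w is determined by the two properties, because P is injective on S^-1 X;
    hence E is linear. *)
Lemma algebraic_section (X : subspace W) (P : {linear V -> V}) :
  transversal X S -> (forall x, X (S x) -> P x = 0 -> x = 0) ->
  (forall x, exists2 y, X (S y) & P y = P x) ->
  exists E : {linear W -> V}, (forall w, X (S (E w) - w)) /\
    (forall w, P (E w) = 0).
Proof.
move=> SX inj sur.
have ex w : exists v, X (S v - w) /\ P v = 0.
  have [x [z [Xz ->]]] := SX.2 w; have [y Xy Pxy] := sur x.
  exists (x - y); split; last by rewrite linearB Pxy subrr.
  rewrite bopB opprD addrA [_ - _ - S x]addrAC subrr add0r -opprD.
  by apply: ssN; exact: ssD.
have [E EP] := choice ex.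
have El : linear E.
  move=> a x y; apply/eqP; rewrite -subr_eq0; apply/eqP; apply: inj; last first.
    by rewrite linearB linearP !(EP _).2 scaler0 addr0 subrr.
  rewrite bopB bopD bopZ.
  have -> : S (E (a *: x + y)) - (a *: S (E x) + S (E y)) =
      (S (E (a *: x + y)) - (a *: x + y)) - (a *: (S (E x) - x) + (S (E y) - y)).
    by rewrite scalerBr addrACA -!opprD opprB addrA subrK.
  by apply: ssB; [exact: (EP _).1|apply: ssP; exact: (EP _).1].
by exists (linear_of El); split=> w; have [] := EP w.
Qed.

Variables (X X' : subspace W) (fX : finite_dim X) (fX' : finite_dim X').
Hypotheses (SX : transversal X S) (SX' : transversal X' S).
Variables (E E' : {linear W -> V}).
Hypothesis EX : forall w, X (S (E w) - w).
Hypothesis EX' : forall w, X' (S (E' w) - w).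

(** Let Z be the space of the pairs (v, y) in V x W with y in X and S v - y in X'.
    The exact sequences
      0 -> S^-1 X -> Z -> X' -> 0   and   0 -> S^-1 X' -> Z -> X -> 0,
    in which v maps to (v, S v) and (v, y) to S v - y, respectively v to (v, 0)
    and (v, y) to y, identify Det (S^-1 X) (x) Det X' and Det (S^-1 X') (x) Det X
    with Det Z.  Hence the ratio of the generators of Det S defined by X and X'
    is, up to sign, the ratio of two generators of Det Z. *)
Lemma comparison t x t' x' (e e' : DetF S) h :
  generates (lpreim S X) t -> generates X x ->
  generates (lpreim S X') t' -> generates X' x' ->
  psi X e = det_elt (lpreim S X) X t x ->
  psi X' e' = det_elt (lpreim S X') X' t' x' -> e = h *: e' ->
  ext_map (graph_map S) t ∧ ext_map (defect_map S E) x' =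
  ((-1) ^+ (dim X * dim X') * h) *:
    (ext_map (inl_map V W) t' ∧ ext_map (cograph_map E') x).
Proof.
move=> gt gx gt' gx' pe pe' eh.
have fM := finite_dim_preim SX fX; have fM' := finite_dim_preim SX' fX'.
have [sa [sb [sak sab sbR]]] := ses_bases (ses_preim S X) fM.
have [x0|sb' sab'] := basis_complete fM' _ (basis_neq0 sak).
  by move=> /(basis_mem sak) Sx; rewrite /sscar /= (Sx : S x0 = 0); exact: ss0.
have sbR' := ses_basis_quot (ses_preim S X') sak sab'.
have [x0|sc scX] := basis_complete fX _ (basis_neq0 sbR).
  by move=> /(basis_mem sbR)[].
have scC := ses_basis_quot (ses_target SX) sbR scX.
pose pi := quot_pi (lran S).
have gex c : exists p : W * V, X' p.1 /\ S p.2 = c + p.1.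
  have [v [z [Xz ->]]] := SX'.2 c; exists (- z, v); split; first exact: ssN.
  by rewrite /= addrK.
have [g gP] := choice gex.
pose c' c := (g c).1; pose w c := (g c).2.
have scm c : c \in sc -> X c.
  by move=> cs; apply: (basis_mem scX); rewrite mem_cat cs orbT.
(* The sign makes up for the fact that c' c lifts the class of - c. *)
pose q := size sc.
have piE : ext_map pi ((-1) ^+ q *: blade (map c' sc)) = blade (map pi sc).
  rewrite ext_mapZ ext_map_blade -map_comp.
  have -> : map (pi \o c') sc = map -%R (map pi sc).
    rewrite -map_comp; apply/eq_in_map => c _ /=; apply/eqP.
    rewrite -addr_eq0 -linearD; apply/eqP/quot_pi_eq0; exists (w c).
    by rewrite addrC; exact: (gP c).2.
  by rewrite blade_opp size_map scalerA -expr2 sqrr_sign scale1r.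
have hb : homogeneous (lpreim S X) (blade sb).
  by apply: homogeneous_blade => v vs; apply: (basis_mem sab); rewrite mem_cat vs orbT.
have hb' : homogeneous (lpreim S X') (blade sb').
  by apply: homogeneous_blade => v vs; apply: (basis_mem sab'); rewrite mem_cat vs orbT.
have hc : homogeneous X (blade sc) by exact: homogeneous_blade.
have hc' : homogeneous X' ((-1) ^+ q *: blade (map c' sc)).
  exists q; apply: ssZ; apply: ext_pow_blade; last by rewrite size_map.
  by move=> _ /mapP[c _ ->]; exact: (gP c).1.
have ga := generates_blade sak; have gC := generates_blade scC.
pose m := blade sa ∧ blade sb; pose n := blade sc ∧ ext_map S (blade sb).
pose m' := blade sa ∧ blade sb'.
pose n' := ((-1) ^+ q *: blade (map c' sc)) ∧ ext_map S (blade sb').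
have gm : generates (lpreim S X) m by rewrite /m wedge_blade; exact: generates_blade.
have gm' : generates (lpreim S X') m'.
  by rewrite /m' wedge_blade; exact: generates_blade.
have gn : generates X n.
  by rewrite /n ext_map_blade wedge_blade; apply: generates_blade; exact: basis_swap.
have gn' : generates X' n'.
  have gR := generates_blade sbR'; rewrite -ext_map_blade in gR.
  by apply/(ses_generates_r (ses_target SX') fX' gR hc'); rewrite piE.
pose e0 : DetF S := det_elt (lker S) (fullspace (coker S)) (blade sa) (blade (map pi sc)).
have p0 : psi X e0 = det_elt (lpreim S X) X m n.
  rewrite /e0 -ext_map_blade; exact: (psiP SX fX).2.
have p0' : psi X' e0 = det_elt (lpreim S X') X' m' n'.
  rewrite /e0 -piE; exact: (psiP SX' fX').2.
have l0 : line_gen e0 := det_gen_line SX.1 ga gC.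
have prop (U : lmodType K) (A : subspace U) a b : finite_dim A ->
    generates A a -> generates A b -> exists2 c : K, c != 0 & b = c *: a.
  move=> [s sA] /(generatesP sA)[c c0 ->] /(generatesP sA)[d d0 ->].
  by exists (d / c); rewrite ?mulf_neq0 ?invr_eq0// scalerA divfK.
have [a a0 ta] := prop _ _ _ _ fM gm gt; have [b b0 xb] := prop _ _ _ _ fX gn gx.
have [a' a0' ta'] := prop _ _ _ _ fM' gm' gt'.
have [b' b0' xb'] := prop _ _ _ _ fX' gn' gx'.
have sc' (L M : lmodType K) (p : L -> M) r d d' : linear p -> bijective p ->
    p d = r *: p d' -> d = r *: d'.
  by move=> pl /bij_inj pI E0; apply: pI; rewrite E0 linear_scale.
have eE : e = (a / b) *: e0.
  apply: (sc' _ _ _ _ _ _ (psiP SX fX).1 (psi_bij SX fX)).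
  rewrite pe p0 ta xb; exact: det_eltZ.
have eE' : e' = (a' / b') *: e0.
  apply: (sc' _ _ _ _ _ _ (psiP SX' fX').1 (psi_bij SX' fX')).
  rewrite pe' p0' ta' xb'; exact: det_eltZ.
have hE : a * b' = h * a' * b.
  have : a / b = h * (a' / b').
    apply/eqP; rewrite -subr_eq0; apply/negPn/negP => d0; apply: l0.1.
    apply: (scalerI d0); rewrite scaler0 scalerBl -eE -scalerA -eE' -eh.
    exact: subrr.
  move=> /(congr1 (fun z => z * b * b')) /=; rewrite divfK//.
  by move=> ->; rewrite [LHS]mulrAC -[in LHS](mulrA h) divfK.
have dX : dim X = (size sb + q)%N.
  by rewrite (basis_dim scX) size_cat !size_map.
have dX' : dim X' = (size sb' + q)%N.
  have [gn't gn'0] := gn'; apply: ext_pow_deg gn't _ gn'0.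
  rewrite addnC; apply: (@ext_pow_wedge _ _ X').
    apply: ssZ; apply: ext_pow_blade; last by rewrite size_map.
    by move=> _ /mapP[c _ ->]; exact: (gP c).1.
  rewrite ext_map_blade; apply: ext_pow_blade; last by rewrite size_map.
  by move=> y /(basis_mem sbR')[].
have core := comparison_core (f := S) (E := E) (E' := E') (X := X) (X' := X')
  (sa := sa) (sb := sb) (sb' := sb') (sc := sc) (c' := c') (w := w).
rewrite ta xb ta' xb' !ext_mapZ !wedgeZl !wedgeZr /m /n /m' /n'.
rewrite wedgeZl ext_mapZ wedgeZr !scalerA !wedge_blade !ext_map_blade.
rewrite !wedge_blade !ext_map_blade !wedge_blade core//.
- rewrite !scalerA; congr (_ *: _).
  have sgn : (-1) ^+ q * (-1) ^+ (size sb * size sc + size sb * size sb' +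
      size sc * size sb') = (-1) ^+ (dim X * dim X') :> K.
    rewrite -exprD -signr_odd -[RHS]signr_odd dX dX' /q !oddD !oddM !oddD.
    by case: (odd (size sb)); case: (odd (size sc)); case: (odd (size sb')).
  by rewrite hE -[LHS]mulrA sgn mulrC -!mulrA.
- by move=> v /(basis_mem sak).
- by move=> z Xz; apply: (basis_gen sab).
- by move=> z Xz; apply: (basis_gen sab').
- by move=> c _; exact: (gP c).1.
- by move=> c _; exact: (gP c).2.
Qed.

(** The form with coordinates L has the value 1 on the second blade of
    comparison, because l vanishes on the values of E'.  On the first blade its
    value, which is then the ratio h up to sign, is a determinant in which E'
    does not occur and u' only occurs through the forms l. *)
Lemma comparison_det (u u' : seq V) (x x' : seq W) (l : nat -> {linear V -> K^o})
    (xi : nat -> {linear W -> K^o}) (e e' : DetF S) :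
  is_basis (lpreim S X) u -> is_basis X x ->
  is_basis (lpreim S X') u' -> is_basis X' x' ->
  psi X e = det_elt (lpreim S X) X (blade u) (blade x) ->
  psi X' e' = det_elt (lpreim S X') X' (blade u') (blade x') ->
  (forall i j, (i < size u')%N -> (j < size u')%N -> l i u'`_j = (i == j)%:R) ->
  (forall i j, (i < size x)%N -> (j < size x)%N -> xi i x`_j = (i == j)%:R) ->
  (forall i w, (i < size u')%N -> l i (E' w) = 0) ->
  let L j (p : V * W) := if (j < size u')%N then l j p.1
                         else xi (j - size u')%N p.2 in
  let r := map (graph_map S) u ++ map (defect_map S E) x' in
  e = ((-1) ^+ (size x * size x') *
       \det (\matrix_(i < size u' + size x, j < size u' + size x)
               (L j r`_i : K))) *: e'.
Proof.
move=> bu bx bu' bx' pe pe' lu' xix lE' L r.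
have fM := finite_dim_preim SX fX; have fM' := finite_dim_preim SX' fX'.
have gu := generates_blade bu; have gx := generates_blade bx.
have gu' := generates_blade bu'; have gx' := generates_blade bx'.
have le : line_gen e.
  apply: (line_gen_inj (psiP SX fX).1 (psi_bij SX fX)).
  by rewrite pe; exact: det_elt_line.
have le' : line_gen e'.
  apply: (line_gen_inj (psiP SX' fX').1 (psi_bij SX' fX')).
  by rewrite pe'; exact: det_elt_line.
have [h eh] := le'.2 e.
have Ll j : linear (L j : V * W -> K^o).
  by move=> a p q; rewrite /L; case: ifP => _; exact: linearP.
pose form := detform (size u' + size x) (fun j => linear_of (Ll j)).
have formE t : \val form t = if size t == (size u' + size x)%N then
    \det (\matrix_(i < size u' + size x, j < size u' + size x) (L j t`_i : K))
    else 0 := erefl.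
have := congr1 (fun b => \val b form) (comparison gu gx gu' gx' pe pe' eh).
rewrite !ext_map_blade !wedge_blade -/r.
set r' := _ ++ _; set s := _ * _.
have -> : \val (s *: blade r') form = s.
  rewrite /= fctE; set d := (X in s *: X).
  suff -> : d = 1 by exact: mulr1.
  rewrite [LHS]formE /r' size_cat !size_map eqxx.
  rewrite (_ : \matrix_(_, _) _ = 1%:M) ?det1//.
  apply/matrixP => i j; rewrite !mxE nth_cat size_map /L -val_eqE.
  have [iu|ui] := ltnP i (size u'); have [ju|uj] := ltnP j (size u').
  - by rewrite (nth_map 0)//= lu'// eq_sym.
  - rewrite (nth_map 0)//= linear0 [val i == _]ltn_eqF//.
    exact: leq_trans iu uj.
  - have xi' : (i - size u' < size x)%N by rewrite ltn_subLR.
    rewrite (nth_map 0)//= lE'// [val i == _]gtn_eqF//.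
    exact: leq_trans ju ui.
  - have xi' : (i - size u' < size x)%N by rewrite ltn_subLR.
    have xj' : (j - size u' < size x)%N by rewrite ltn_subLR.
    rewrite (nth_map 0)//= xix//; congr (nat_of_bool _)%:R.
    by rewrite -(eqn_add2r (size u')) !subnK// eq_sym.
rewrite [LHS in LHS = _ -> _]formE; case: eqP => [_ E1|_ /esym/eqP]; last first.
  rewrite /s mulf_eq0 signr_eq0 /= => /eqP h0.
  by case: le; rewrite eh h0 scale0r.
rewrite eh; congr (_ *: _); rewrite [X in _ * X]E1 /s.
rewrite (basis_dim bx) (basis_dim bx') mulrA -expr2 sqrr_sign mul1r//.
Qed.

End Comparison.

(** * Real norms and limits *)

Section RealNorm.
Variables (R : realType) (k : scalar_kind).
Local Notation K := (scalars R k).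
Implicit Types (V W : normedModType K).

(** Norms take their values in K, which is not totally ordered if K is complex;
    this is the norm as a real number. *)
Definition rnorm V (x : V) : R := to_real `|x|.

Lemma of_real_rnorm V (x : V) : of_real k (rnorm x) = `|x|.
Proof. exact: to_realK. Qed.

Lemma rnorm_ge0 V (x : V) : 0 <= rnorm x.
Proof. by rewrite -(of_real_le k) of_real_rnorm of_real0. Qed.

Lemma rnorm0 V : rnorm (0 : V) = 0.
Proof. by rewrite /rnorm normr0 -(of_real0 R k) of_realK. Qed.

Lemma rnorm_eq0 V (x : V) : rnorm x = 0 -> x = 0.
Proof. by move=> x0; apply: normr0_eq0; rewrite -of_real_rnorm x0 of_real0. Qed.

Lemma rnormN V (x : V) : rnorm (- x) = rnorm x.
Proof. by rewrite /rnorm normrN. Qed.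

Lemma rnormD V (x y : V) : rnorm (x + y) <= rnorm x + rnorm y.
Proof. by rewrite -(of_real_le k) of_realD !of_real_rnorm ler_normD. Qed.

Lemma rnormB V (x y : V) : rnorm (x - y) <= rnorm x + rnorm y.
Proof. by rewrite -(rnormN y); exact: rnormD. Qed.

Lemma rnormC V (x y : V) : rnorm (x - y) = rnorm (y - x).
Proof. by rewrite -rnormN opprB. Qed.

Lemma rnorm_trans V (y x z : V) : rnorm (x - z) <= rnorm (x - y) + rnorm (y - z).
Proof. by have := rnormD (x - y) (y - z); rewrite addrA subrK. Qed.

Lemma of_real_inj : injective (of_real k : R -> K).
Proof. by move=> x y E; rewrite -(of_realK k x) E of_realK. Qed.

Lemma rnormZ V (a : K) (x : V) : rnorm (a *: x) = rnorm (a : K^o) * rnorm x.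
Proof.
by apply: of_real_inj; rewrite of_realM !of_real_rnorm normrZ.
Qed.

Lemma of_real1 : of_real k 1 = 1 :> K.
Proof. by case: k. Qed.

Lemma of_real_lt (x y : R) : (of_real k x < of_real k y) = (x < y).
Proof. by rewrite !lt_neqAle of_real_le (inj_eq of_real_inj). Qed.

Lemma rnorm_of_real (x : R) : 0 <= x -> rnorm (of_real k x : K^o) = x.
Proof.
move=> x0; rewrite /rnorm ger0_norm ?of_realK//.
by rewrite -(of_real0 R k) of_real_le.
Qed.

Lemma pos_of_real (e : K) : 0 < e -> exists2 d : R, 0 < d & of_real k d = e.
Proof.
move=> e0; exists (to_real e); last by rewrite to_realK// ltW.
by rewrite -of_real_lt of_real0 to_realK// ltW.
Qed.

Lemma nearP V (a : V) (P : V -> Prop) : (\forall x \near a, P x) <->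
  exists2 d : R, 0 < d & forall x, rnorm (x - a) < d -> P x.
Proof.
split=> [/nbhs_normP[e /= /pos_of_real[d d0 <-] H]|[d d0 H]].
  exists d => // x xa; apply: H; rewrite /ball_ /=.
  by rewrite -of_real_rnorm rnormC of_real_lt.
apply/nbhs_normP; exists (of_real k d); first by rewrite /= -(of_real0 R k) of_real_lt.
by move=> x; rewrite /ball_ /= -of_real_rnorm of_real_lt rnormC => /H.
Qed.

Lemma rnorm_sum V (I : Type) (q : seq I) (u : I -> V) :
  rnorm (\sum_(i <- q) u i) <= \sum_(i <- q) rnorm (u i).
Proof.
elim: q => [|i q IH]; first by rewrite !big_nil rnorm0.
rewrite !big_cons; apply: (le_trans (rnormD _ _)); exact: lerD.
Qed.

Definition rlim V (u : nat -> V) (l : V) := forall e : R, 0 < e ->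
  exists N, forall n, (N <= n)%N -> rnorm (u n - l) < e.

Lemma rlim_cvg V (u : nat -> V) (l : V) : (u @ \oo --> l) <-> rlim u l.
Proof.
split=> [ul e e0|ul].
  have e0' : (0 : K) < of_real k e by rewrite -(of_real0 R k) of_real_lt.
  have [N _ NP] := (@cvgrPdist_lt _ _ _ _ _ u l).1 ul _ e0'.
  by exists N => n /NP; rewrite /= -of_real_rnorm of_real_lt rnormC.
apply/cvgrPdist_lt => _ /pos_of_real[e e0 <-]; have [N NP] := ul e e0.
by exists N => // n /NP; rewrite /= -of_real_rnorm of_real_lt rnormC.
Qed.

Lemma rlim_uniq V (u : nat -> V) (l l' : V) : rlim u l -> rlim u l' -> l = l'.
Proof.
move=> ul ul'; apply/eqP; rewrite -subr_eq0; apply/eqP/rnorm_eq0.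
apply/eqP; rewrite eq_le rnorm_ge0 andbT; apply/ler_addgt0Pr => e e0.
have e2 : 0 < e / 2 by rewrite divr_gt0.
have [N NP] := ul _ e2; have [M MP] := ul' _ e2.
have h1 := NP (maxn N M) (leq_maxl _ _); have h2 := MP (maxn N M) (leq_maxr _ _).
have := rnorm_trans (u (maxn N M)) l l'; rewrite (rnormC l (u _)); lra.
Qed.

Lemma pow_half_lt (C e : R) : 0 < e -> exists N, forall n, (N <= n)%N ->
  C * (2^-1) ^+ n < e.
Proof.
move=> e0; have h1 : `|2^-1 : R| < 1 by rewrite ger0_norm; lra.
have := @cvg_geometric R C 2^-1 h1.
move=> /cvgrPdist_lt/(_ _ e0)[N _ NP]; exists N => n /NP /=.
rewrite sub0r normrN; exact: le_lt_trans (ler_norm _).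
Qed.

Lemma rlim_half V (u : nat -> V) (l : V) (C : R) :
  (forall n, rnorm (u n - l) <= C * (2^-1) ^+ n) -> rlim u l.
Proof.
move=> ul e e0; have [N NP] := pow_half_lt C e0; exists N => n /NP.
exact: le_lt_trans (ul n).
Qed.

Lemma rlim_lip V W (f : V -> W) (C : R) (u : nat -> V) (l : V) :
  (forall x y, rnorm (f x - f y) <= C * rnorm (x - y)) ->
  rlim u l -> rlim (fun n => f (u n)) (f l).
Proof.
move=> fC ul e e0; have C0 : 0 < `|C| + 1 by rewrite ltr_wpDl.
have [N NP] := ul (e / (`|C| + 1)) (divr_gt0 e0 C0); exists N => n /NP h.
apply: le_lt_trans (fC _ _) _.
apply: le_lt_trans (_ : (`|C| + 1) * rnorm (u n - l) < e); last first.
  by rewrite mulrC -ltr_pdivlMr.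
apply: ler_wpM2r; first exact: rnorm_ge0.
by apply: (le_trans (ler_norm C)); rewrite lerDl.
Qed.

Lemma rlim_ball V (u : nat -> V) (l a : V) (C : R) :
  rlim u l -> (forall n, rnorm (u n - a) <= C) -> rnorm (l - a) <= C.
Proof.
move=> ul uC; apply/ler_addgt0Pr => e e0; have [N NP] := ul e e0.
have := NP N (leqnn _); have := uC N; have := rnorm_trans (u N) l a.
by rewrite (rnormC l (u _)); lra.
Qed.

Lemma rlimD V (u v : nat -> V) (l m : V) : rlim u l -> rlim v m ->
  rlim (fun n => u n + v n) (l + m).
Proof.
move=> ul vm e e0; have e2 : 0 < e / 2 by rewrite divr_gt0.
have [N NP] := ul _ e2; have [M MP] := vm _ e2; exists (maxn N M) => n.
rewrite geq_max => /andP[/NP h1 /MP h2]; have := rnormD (u n - l) (v n - m).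
by rewrite addrACA -opprD; lra.
Qed.

Lemma rlimS V (u : nat -> V) (l : V) : rlim u l -> rlim (fun n => u n.+1) l.
Proof.
by move=> ul e /ul[N NP]; exists N => n Nn; apply: NP; rewrite (leq_trans Nn).
Qed.

Lemma rlim_cst V (l : V) : rlim (fun=> l) l.
Proof. by move=> e e0; exists 0 => n _; rewrite subrr rnorm0. Qed.

(** A quantitative Cauchy condition, which gives limits with a rate. *)
Definition half_steps V (u : nat -> V) (C : R) :=
  forall n, rnorm (u n.+1 - u n) <= C * (2^-1) ^+ n.

Lemma half_steps_dist V (u : nat -> V) (C : R) n m : half_steps u C ->
  (n <= m)%N -> rnorm (u m - u n) <= 2 * C * ((2^-1) ^+ n - (2^-1) ^+ m).
Proof.
move=> uC; elim: m => [|m IH].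
  by rewrite leqn0 => /eqP ->; rewrite !subrr mulr0 rnorm0.
rewrite leq_eqVlt => /orP[/eqP ->|]; first by rewrite !subrr mulr0 rnorm0.
rewrite ltnS => /IH h; have := rnorm_trans (u m) (u m.+1) (u n).
have := uC m; rewrite exprS; move: ((2^-1 : R) ^+ m) ((2^-1 : R) ^+ n) h => x y; lra.
Qed.

Lemma half_steps_cvg (V : completeNormedModType K) (u : nat -> V) (C : R) :
  half_steps u C -> exists l, rlim u l /\
    forall n, rnorm (l - u n) <= 2 * C * (2^-1) ^+ n.
Proof.
move=> uC.
have C0 : 0 <= C by have := uC 0%N; rewrite expr0 mulr1; apply: le_trans (rnorm_ge0 _).
have cau : cauchy (u @ \oo).
  apply: cauchy_exP => _ /pos_of_real[e e0 <-].
  have [N NP] := pow_half_lt (2 * C) (e := e) e0.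
  exists (u N); exists N => // n /= Nn; rewrite -ball_normE /ball_ /=.
  rewrite -of_real_rnorm of_real_lt rnormC.
  apply: le_lt_trans (half_steps_dist uC Nn) _; apply: le_lt_trans (NP _ (leqnn _)).
  apply: ler_wpM2l; first by lra.
  by rewrite gerBl exprn_ge0//; lra.
have /cvg_ex[l ul] : cvg (u @ \oo) by exact: cauchy_cvg.
have {}ul : rlim u l by exact/rlim_cvg.
exists l; split=> // n.
apply: (@rlim_ball _ (fun m => u (n + m)%N)) => [e /ul[N NP]|m].
  by exists N => j Nj; apply: NP; rewrite (leq_trans Nj)// leq_addl.
apply: le_trans (half_steps_dist uC (leq_addr m n)) _.
apply: ler_wpM2l; first by lra.
by rewrite gerBl exprn_ge0//; lra.
Qed.

End RealNorm.

(** * Bounded operators and the closed graph theorem *)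

Section BoundedOperators.
Variables (R : realType) (k : scalar_kind).
Local Notation K := (scalars R k).
Implicit Types (U V W : normedModType K).

Lemma rnorm_bop V W (T : bop V W) x : rnorm (T x) <= rnorm T * rnorm x.
Proof.
rewrite -(of_real_le k) of_realM !of_real_rnorm; exact: opnorm_bound.
Qed.

Lemma rnorm_bop_le V W (T : bop V W) C : 0 <= C ->
  (forall x, rnorm (T x) <= C * rnorm x) -> rnorm T <= C.
Proof.
move=> C0 TC; rewrite -(of_real_le k) of_real_rnorm; apply: opnorm_le.
  by rewrite -(of_real0 R k) of_real_le.
by move=> x; rewrite -!of_real_rnorm -of_realM of_real_le.
Qed.

Lemma rnorm_comp U V W (T : bop V W) (S : bop U V) :
  rnorm (bop_comp T S) <= rnorm T * rnorm S.
Proof.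
apply: rnorm_bop_le => [|x]; first by rewrite mulr_ge0// rnorm_ge0.
apply: (le_trans (rnorm_bop T (S x))); rewrite -mulrA.
by apply: ler_wpM2l; [exact: rnorm_ge0|exact: rnorm_bop].
Qed.

Lemma bop_eq V W (T T' : bop V W) : (forall x, T x = T' x) -> T = T'.
Proof. by move=> TT; apply/val_inj/funext. Qed.

Lemma bop_subE V W (T T' : bop V W) x : bop_fun (T - T') x = T x - T' x.
Proof. by []. Qed.

Lemma bop_addE V W (T T' : bop V W) x : bop_fun (T + T') x = T x + T' x.
Proof. by []. Qed.

Lemma bop_scaleE V W a (T : bop V W) x : bop_fun (a *: T) x = a *: T x.
Proof. by []. Qed.

Lemma bop_sumE V W n (T : 'I_n -> bop V W) x :
  bop_fun (\sum_(i < n) T i) x = \sum_(i < n) T i x.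
Proof. by elim/big_ind2: _ => // S u S' u' <- <-. Qed.

Lemma bop_intro V W (f : V -> W) : linear f ->
  (exists C : R, forall x, rnorm (f x) <= C * rnorm x) ->
  exists T : bop V W, forall x, T x = f x.
Proof.
move=> fl [C fC].
have fB : bop_sub V W f.
  split=> //; exists (of_real k C) => x.
  by rewrite -!of_real_rnorm -of_realM of_real_le.
by exists (ssub fB).
Qed.

(** The limit is pointwise; the rate is uniform on the unit ball. *)
Lemma bop_complete V (W : completeNormedModType K) (u : nat -> bop V W) (C : R) :
  half_steps u C -> exists l : bop V W,
    forall n, rnorm (l - u n) <= 2 * C * (2^-1) ^+ n.
Proof.
move=> uC.
have uxC x : half_steps (fun n => u n x) (C * rnorm x).
  move=> n; apply: (le_trans (rnorm_bop (u n.+1 - u n) x)).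
  by rewrite mulrAC; apply: ler_wpM2r; [exact: rnorm_ge0|exact: uC].
have C0 : 0 <= C by have := uC 0%N; rewrite expr0 mulr1; apply: le_trans (rnorm_ge0 _).
have [l lP] := choice (fun x => half_steps_cvg (uxC x)).
have ll : linear l.
  move=> a x y; have [lxy _] := lP (a *: x + y).
  apply: (rlim_uniq lxy).
  have -> : (fun n => u n (a *: x + y)) = (fun n => a *: u n x + u n y).
    by apply/funext => n; rewrite bopD bopZ.
  apply: rlimD (lP y).1.
  apply: (rlim_lip (f := fun z : W => a *: z) (C := rnorm (a : K^o)) _ (lP x).1).
  by move=> z t; rewrite -scalerBr rnormZ.
have [|L LE] := bop_intro ll.
  exists (rnorm (u 0%N) + 2 * C) => x; rewrite mulrDl.
  have := (lP x).2 0%N; rewrite expr0 mulr1 mulrA => h.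
  have := rnormD (l x - u 0%N x) (u 0%N x); rewrite subrK.
  by have := rnorm_bop (u 0%N) x; lra.
exists L => n; apply: rnorm_bop_le => [|x].
  by rewrite mulr_ge0 ?exprn_ge0//; [lra|lra].
rewrite -[_ x]/(L x - u n x) LE; apply: (le_trans ((lP x).2 n)).
by rewrite !mulrA mulrAC.
Qed.

(** Closed graph theorem.  A Baire argument gives a ball in the closure of
    the vectors with image in a ball; successive approximation then removes
    the closure. *)
Section ClosedGraph.
Variables (V W : completeNormedModType K) (f : W -> V).
Hypothesis fl : linear f.
Hypothesis fgraph : forall (u : nat -> W) w v,
  rlim u w -> rlim (fun n => f (u n)) v -> f w = v.

Let fZ a x : f (a *: x) = a *: f x.
Proof. exact: linear_scale. Qed.
Let fB x y : f (x - y) = f x - f y.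
Proof. exact: (linearB (linear_of fl)). Qed.

Lemma rnorm_scale_pos (U : normedModType K) (t : R) (x : U) : 0 <= t ->
  rnorm (of_real k t *: x) = t * rnorm x.
Proof. by move=> t0; rewrite rnormZ rnorm_of_real. Qed.

Lemma closed_graph_baire : exists a (r : R) (n : nat), 0 < r /\
  forall x, rnorm (x - a) < r -> forall e : R, 0 < e ->
    exists2 w, rnorm (w - x) < e & rnorm (f w) <= n%:R.
Proof.
(* Otherwise there are nested balls, with radii at least halved at each step,
   such that |f| > n on the n-th one; they have a point l in common. *)
apply: contrapT => nH.
have step (p : nat * (W * R)) : exists q : W * R, 0 < p.2.2 ->
    [/\ rnorm (q.1 - p.2.1) <= p.2.2 / 2, 0 < q.2, q.2 <= p.2.2 / 2 &
     forall w, rnorm (w - q.1) <= q.2 -> p.1%:R < rnorm (f w)].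
  case: p => n [a r] /=; have [r0|r0] := boolP (0 < r); last by exists (a, r).
  have [x [xa [e e0 eP]]] : exists x, rnorm (x - a) < r / 2 /\
      exists2 e : R, 0 < e & forall w, rnorm (w - x) < e -> n%:R < rnorm (f w).
    apply: contrapT => H; apply: nH; exists a, (r / 2), n.
    split=> [|x xa e e0]; first by rewrite divr_gt0.
    apply: contrapT => He; apply: H; exists x; split=> //; exists e => // w we.
    by rewrite ltNge; apply/negP => wn; apply: He; exists w.
  exists (x, Num.min (e / 2) (r / 2)) => _ /=; split; first exact: ltW.
  - by rewrite lt_min !divr_gt0.
  - by rewrite ge_min lexx orbT.
  - move=> w; rewrite le_min => /andP[we _]; apply: eP; lra.
have [g gP] := choice step.
pose ar := fix ar n := if n is m.+1 then g (m, ar m) else (0 : W, 1 : R).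
pose a n := (ar n).1; pose r n := (ar n).2.
have r0 n : 0 < r n.
  by elim: n => [|n IH]; [exact: ltr01|have [] := gP (n, ar n) IH].
have r2 n : r n.+1 <= r n / 2 by have [] := gP (n, ar n) (r0 n).
have ra n : rnorm (a n.+1 - a n) <= r n / 2 by have [] := gP (n, ar n) (r0 n).
have rm n m : r (n + m)%N <= r n * (2^-1) ^+ m.
  elim: m => [|m IH]; first by rewrite addn0 expr0 mulr1.
  by rewrite addnS exprSr; have := r2 (n + m)%N; lra.
have hs n : half_steps (fun m => a (n + m)%N) (r n / 2).
  move=> m; rewrite addnS; apply: (le_trans (ra _)).
  by rewrite mulrAC; have := rm n m; lra.
have [l [al _]] := half_steps_cvg (hs 0%N).
have la n : rnorm (l - a n) <= r n.
  apply: (@rlim_ball _ _ _ (fun m => a (n + m)%N)) => [e /al[N NP]|m].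
    by exists N => j Nj; have := NP (n + j)%N; apply; rewrite (leq_trans Nj)// leq_addl.
  have := half_steps_dist (hs n) (leq0n m); rewrite /= addn0 expr0.
  have h : 0 <= (2^-1 : R) ^+ m by apply: exprn_ge0; lra.
  rewrite [2 * _]mulrC divfK ?pnatr_eq0// mulrBr mulr1 => hh.
  by apply: (le_trans hh); have := mulr_ge0 (ltW (r0 n)) h; lra.
pose n := Num.bound (rnorm (f l)).
have [_ _ _ h] := gP (n, ar n) (r0 n).
have := h l (la n.+1); apply/negP; rewrite -leNgt ltW//.
by apply: archi_boundP; exact: rnorm_ge0.
Qed.

Lemma closed_graph_approx : exists (r M : R), [/\ 0 < r, 0 <= M &
  forall x i, rnorm x < r * (2^-1) ^+ i -> exists2 w,
    rnorm (x - w) < r * (2^-1) ^+ i.+1 & rnorm (f w) <= M * (2^-1) ^+ i].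
Proof.
have [a [r [n [r0 H]]]] := closed_graph_baire.
exists r, (2 * n%:R); split=> // [|x i xr]; first by rewrite mulr_ge0 ?ler0n//; lra.
set h := (2^-1) ^+ i in xr *; have h0 : 0 < h by apply: exprn_gt0; lra.
(* After rescaling to y, both y + a and a are approximated by vectors whose
   images have norm at most n. *)
pose y := of_real k h^-1 *: x.
have yr : rnorm y < r.
  by rewrite rnorm_scale_pos ?invr_ge0; [rewrite mulrC ltr_pdivrMr|exact: ltW].
have [||w1 w1e w1n] := H (y + a) _ (r / 4); [by rewrite addrK|lra|].
have [||w2 w2e w2n] := H a _ (r / 4); [by rewrite subrr rnorm0|lra|].
have xE : x = of_real k h *: y.
  rewrite scalerA -of_realM divff ?of_real1 ?scale1r//; exact: lt0r_neq0.
exists (of_real k h *: (w1 - w2)).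
  rewrite xE -scalerBr (rnorm_scale_pos _ (ltW h0)) exprS -/h.
  have : rnorm (y - (w1 - w2)) < r / 2.
    have -> : y - (w1 - w2) = (w2 - a) - (w1 - (y + a)).
      by rewrite !opprB [y + a]addrC -(addrA a) (addrA (w2 - a)) subrK addrCA.
    by apply: (le_lt_trans (rnormB _ _)); lra.
  move: h0 r0; nra.
rewrite fZ (rnorm_scale_pos _ (ltW h0)) fB mulrC.
apply: ler_wpM2r; first exact: ltW.
by have := rnormB (f w1) (f w2); lra.
Qed.

Lemma closed_graph : exists C : R, forall w, rnorm (f w) <= C * rnorm w.
Proof.
have [r [M [r0 M0 H]]] := closed_graph_approx.
have bound x : rnorm x < r -> rnorm (f x) <= 2 * M.
  move=> xr.
  have ex (p : nat * W) : exists w, rnorm p.2 < r * (2^-1) ^+ p.1 ->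
      rnorm (p.2 - w) < r * (2^-1) ^+ p.1.+1 /\ rnorm (f w) <= M * (2^-1) ^+ p.1.
    have [pr|pr] := boolP (rnorm p.2 < r * (2^-1) ^+ p.1); last by exists 0.
    by have [w w1 w2] := H _ _ pr; exists w.
  have [g gP] := choice ex.
  (* The remainders y n tend to 0 and the approximants u n to x. *)
  pose y := fix y n := if n is m.+1 then y m - g (m, y m) else x.
  have yr n : rnorm (y n) < r * (2^-1) ^+ n.
    elim: n => [|n IH]; first by rewrite expr0 mulr1.
    by have [] := gP (n, y n) IH.
  pose u n := x - y n.
  have ux : rlim u x.
    apply: (rlim_half (C := r)) => n.
    by rewrite /u addrC addKr rnormN ltW.
  have fu : half_steps (fun n => f (u n)) M.
    move=> n; rewrite -fB.
    have -> : u n.+1 - u n = g (n, y n).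
      by rewrite /u /= !opprB addrA -(addrA x) subrK addrAC subrr add0r.
    by have [] := gP (n, y n) (yr n).
  have [v [fv vu]] := half_steps_cvg fu.
  rewrite (fgraph ux fv); have := vu 0%N.
  by rewrite /u /= subrr (_ : f 0 = 0) ?subr0 ?expr0 ?mulr1// -(scale0r 0) fZ scale0r.
exists (4 * M / r) => w; have [->|w0] := eqVneq w 0.
  by rewrite -(scale0r 0) fZ !scale0r !rnorm0 mulr0.
have w_gt0 : 0 < rnorm w.
  by rewrite lt_neqAle rnorm_ge0 andbT eq_sym; apply/eqP => /rnorm_eq0/eqP; apply/negP.
pose t := r / (2 * rnorm w).
have t0 : 0 < t by rewrite divr_gt0// mulr_gt0.
have := bound (of_real k t *: w); rewrite fZ !(rnorm_scale_pos _ (ltW t0)).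
have tw : t * rnorm w = r / 2.
  by rewrite /t invfM mulrA mulfVK// lt0r_neq0.
rewrite tw => h; have {}h : t * rnorm (f w) <= 2 * M by apply: h; lra.
rewrite -(ler_pM2l t0); apply: (le_trans h).
by rewrite mulrCA tw le_eqVlt; apply/orP; left; apply/eqP; field; exact: lt0r_neq0.
Qed.

End ClosedGraph.
End BoundedOperators.

(** * Power series *)

Section PowerSeries.
Variables (R : realType) (k : scalar_kind).
Local Notation K := (scalars R k).
Implicit Types (E F G H : normedModType K).

Definition upd (T : Type) (v : nat -> T) i x : nat -> T :=
  fun j => if j == i then x else v j.

(** Coefficients of a power series with positive radius of convergence.  The
    n-linear coefficient takes a sequence of arguments and only uses the first
    n of them, which spares casts between index types. *)
Definition coefficients E F (A : nat -> (nat -> E) -> F) (M r : R) :=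
  [/\ 0 <= M /\ 0 <= r,
      forall n v v', (forall i, (i < n)%N -> v i = v' i) -> A n v = A n v',
      forall n i v, (i < n)%N -> linear (fun x => A n (upd v i x))
    & forall n v, rnorm (A n v) <= M * r ^+ n * \prod_(i < n) rnorm (v i)].

(** A variant of analytic_at with real constants. *)
Definition analytic E F (f : E -> F) (a : E) :=
  exists A M r d, [/\ coefficients A M r, 0 < d &
    forall h, rnorm h < d -> rlim (fun N => \sum_(n < N) A n (fun=> h)) (f (a + h))].

Lemma of_real_prod n (c : 'I_n -> R) :
  of_real k (\prod_(i < n) c i) = \prod_(i < n) (of_real k (c i) : K).
Proof.
by apply: (big_morph (@of_real R k)); [exact: of_realM|exact: of_real1].
Qed.

Lemma of_realX (x : R) n : of_real k (x ^+ n) = of_real k x ^+ n.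
Proof. by elim: n => [|n IH]; rewrite ?expr0 ?of_real1// !exprS of_realM IH. Qed.

Lemma analytic_analytic_at E F (f : E -> F) a : analytic f a -> analytic_at f a.
Proof.
move=> [A [M [r [d [[[M0 r0] loc mult bnd] d0 Af]]]]].
pose ext n (v : 'I_n -> E) i := oapp v 0 (insub i).
have extE n (v : 'I_n -> E) (i : 'I_n) : ext n v i = v i.
  by rewrite /ext valK.
exists (fun n v => A n (ext n v)), (of_real k M), (of_real k r); split.
- move=> n i v; have := mult n i (ext n v) (ltn_ord i).
  rewrite (_ : (fun x => A n (upd _ _ _)) =
    (fun x : E => A n (ext n (@dfwith 'I_n (fun=> E) v i x)))) //.
  apply/funext => x; apply: loc => j jn.
  rewrite (extE n _ (Ordinal jn)) /upd; case: (eqVneq j i) => [ji|ji].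
    have -> : Ordinal jn = i by exact: val_inj.
    by rewrite dfwithin.
  rewrite dfwithout ?(extE n v (Ordinal jn))//.
  by apply: contra_neq ji => ->.
- move=> n v; rewrite -!of_real_rnorm -of_realX.
  have -> : \prod_(i < n) `|v i| = of_real k (\prod_(i < n) rnorm (ext n v i)).
    by rewrite of_real_prod; apply: eq_bigr => i _; rewrite extE of_real_rnorm.
  by rewrite -!of_realM of_real_le.
- apply/nearP; exists d => // h; rewrite subr0 => hd; apply/rlim_cvg.
  move=> e e0; have [N NP] := Af h hd e e0; exists N => n Nn.
  rewrite /series /= big_mkord (eq_bigr (fun n : 'I__ => A n (fun=> h))) => [|i _].
    exact: NP.
  by apply: loc => j ji; rewrite (extE i _ (Ordinal ji)).
Qed.

Lemma analytic_affine E F (f L : E -> F) a c (C : R) : linear L ->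
  (forall h, rnorm (L h) <= C * rnorm h) -> (forall h, f (a + h) = c + L h) ->
  analytic f a.
Proof.
move=> Ll LC fE; have LZ := linear_scale _ _ Ll.
pose A n (v : nat -> E) := match n with 0%N => c | 1%N => L (v 0%N) | _ => 0 end.
have C0 : 0 <= rnorm c + `|C| by rewrite addr_ge0 ?rnorm_ge0.
exists A, (rnorm c + `|C|), 1, 1; split=> //; first split=> //.
- by move=> [|[|n]] v v' vv //=; rewrite vv.
- by move=> [|[|n]] [|i] v //= _ b x y; rewrite ?scaler0 ?addr0//= /upd /= Ll.
- move=> [|[|n]] v; rewrite expr1n mulr1.
  + by rewrite big_ord0 mulr1 lerDl normr_ge0.
  + rewrite big_ord1 (le_trans (LC _))//; apply: ler_wpM2r; first exact: rnorm_ge0.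
    by rewrite (le_trans (ler_norm C))// lerDr rnorm_ge0.
  + rewrite rnorm0 mulr_ge0// prodr_ge0// => i _; exact: rnorm_ge0.
- move=> h _ e e0; exists 2%N => -[|[|n]]// _.
  rewrite !big_ord_recl big1 => [|i _] //=.
  by rewrite addr0 fE subrr rnorm0.
Qed.

Lemma analytic_cst E F (a : E) (c : F) : analytic (fun=> c) a.
Proof.
apply: (@analytic_affine _ _ _ (fun=> 0) a c 0); last by move=> h; rewrite addr0.
  by move=> b x y; rewrite scaler0 addr0.
by move=> h; rewrite rnorm0 mul0r.
Qed.

Lemma analytic_linear E F (L : E -> F) a (C : R) : linear L ->
  (forall h, rnorm (L h) <= C * rnorm h) -> analytic L a.
Proof.
move=> Ll LC; apply: (analytic_affine (c := L a) Ll LC) => h.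
by have := Ll 1 a h; rewrite !scale1r.
Qed.

Lemma analyticD E F (f g : E -> F) a :
  analytic f a -> analytic g a -> analytic (fun x => f x + g x) a.
Proof.
move=> [A [M [r [d [[[M0 r0] Al Am Ab] d0 Af]]]]].
move=> [B [N [s [e [[[N0 s0] Bl Bm Bb] e0 Bg]]]]].
exists (fun n v => A n v + B n v), (M + N), (r + s), (Num.min d e).
split; [split|by rewrite lt_min d0|].
- by split; apply: addr_ge0.
- by move=> n v v' vv; rewrite (Al n v v')// (Bl n v v').
- move=> n i v ni b x y /=; rewrite (Am n i v ni) (Bm n i v ni) scalerDr.
  by rewrite addrACA.
- move=> n v; apply: (le_trans (rnormD _ _)); rewrite !mulrDl.
  have p0 : 0 <= \prod_(i < n) rnorm (v i).
    by apply: prodr_ge0 => i _; exact: rnorm_ge0.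
  apply: lerD.
    apply: (le_trans (Ab n v)); apply: ler_wpM2r => //; apply: ler_wpM2l => //.
    by apply: lerXn2r; rewrite ?nnegrE ?addr_ge0// lerDl.
  apply: (le_trans (Bb n v)); apply: ler_wpM2r => //; apply: ler_wpM2l => //.
  by apply: lerXn2r; rewrite ?nnegrE ?addr_ge0// lerDr.
- move=> h; rewrite lt_min => /andP[/Af fh /Bg gh].
  have := rlimD fh gh; congr rlim; apply/funext => n.
  by rewrite big_split.
Qed.

Lemma analytic_comp_linear E E' F (f : E -> F) (p : E' -> E) a : linear p ->
  (forall h, rnorm (p h) <= rnorm h) -> analytic f (p a) ->
  analytic (fun x => f (p x)) a.
Proof.
move=> pl pC [A [M [r [d [[[M0 r0] Al Am Ab] d0 Af]]]]].
exists (fun n v => A n (p \o v)), M, r, d; split=> //; first split=> //.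
- by move=> n v v' vv; apply: Al => i ni /=; rewrite vv.
- move=> n i v ni b x y.
  have E0 z : A n (p \o upd v i z) = A n (upd (p \o v) i (p z)).
    by apply: Al => j _; rewrite /= /upd; case: ifP.
  by rewrite !E0 pl (Am n i _ ni).
- move=> n v; apply: (le_trans (Ab _ _)); apply: ler_wpM2l.
    by rewrite mulr_ge0// exprn_ge0.
  by apply: ler_prod => i _; rewrite rnorm_ge0 pC.
- move=> h hd; have -> : p (a + h) = p a + p h.
    by have := pl 1 a h; rewrite !scale1r.
  exact: Af (le_lt_trans (pC h) hd).
Qed.

Lemma prod_split (c : nat -> R) i m :
  \prod_(j < i + m) c j = \prod_(j < i) c j * \prod_(j < m) c (i + j)%N.
Proof.
elim: m => [|m IH]; first by rewrite addn0 big_ord0 mulr1.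
by rewrite addnS !big_ord_recr /= IH mulrA.
Qed.

(** Close enough to the center, the terms of a power series decrease at least
    like the powers of 1 / 4.  The error in the Cauchy product, of order m / 4 ^ m,
    is then bounded by a multiple of 1 / 2 ^ m. *)
Lemma coefficients_small E F (A : nat -> (nat -> E) -> F) M r h : coefficients A M r ->
  r * rnorm h <= 4^-1 -> forall n, rnorm (A n (fun=> h)) <= M * (4^-1) ^+ n.
Proof.
move=> [[M0 r0] _ _ Ab] rh n; apply: (le_trans (Ab _ _)).
rewrite -mulrA; apply: ler_wpM2l => //; rewrite prodr_const card_ord -exprMn.
by apply: lerXn2r; rewrite ?nnegrE ?mulr_ge0 ?rnorm_ge0//; lra.
Qed.

Lemma small_tail F (u : nat -> F) (l : F) (M : R) : 0 <= M ->
  (forall n, rnorm (u n) <= M * (4^-1) ^+ n) ->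
  rlim (fun N => \sum_(n < N) u n) l ->
  forall N, rnorm (l - \sum_(n < N) u n) <= 2 * M * (4^-1) ^+ N.
Proof.
move=> M0 uM ul N.
have q0 m : 0 <= (4^-1 : R) ^+ m by apply: exprn_ge0; lra.
have hs : half_steps (fun m => \sum_(n < N + m) u n) (M * (4^-1) ^+ N).
  move=> m; rewrite addnS big_ord_recr /= addrAC subrr add0r.
  apply: (le_trans (uM _)); rewrite exprD mulrA.
  apply: ler_wpM2l; first by rewrite mulr_ge0.
  by apply: lerXn2r; rewrite ?nnegrE; lra.
apply: (@rlim_ball _ _ _ (fun m => \sum_(n < N + m) u n)) => [e /ul[P PP]|m].
  by exists P => j Pj; apply: PP; rewrite (leq_trans Pj)// leq_addl.
have := half_steps_dist hs (leq0n m); rewrite /= addn0 expr0 mulrBr mulr1 mulrA.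
move=> h; apply: (le_trans h); rewrite lerBlDr lerDl mulr_ge0//.
  by rewrite !mulr_ge0//; lra.
by apply: exprn_ge0; lra.
Qed.

(** Cauchy product of power series along a bounded bilinear map. *)
Lemma analytic_bilinear E F G H (b : F -> G -> H) (C : R) (f : E -> F) (g : E -> G) a :
  (forall y, linear (b^~ y)) -> (forall x, linear (b x)) -> 0 <= C ->
  (forall x y, rnorm (b x y) <= C * rnorm x * rnorm y) ->
  analytic f a -> analytic g a -> analytic (fun x => b (f x) (g x)) a.
Proof.
move=> bl br C0 bC [A [M [r [d [Ac d0 Af]]]]] [B [N [s [e [Bc e0 Bg]]]]].
have [[M0 r0] Al Am Ab] := Ac; have [[N0 s0] Bl Bm Bb] := Bc.
pose P n v := \sum_(i < n.+1) b (A i v) (B (n - i)%N (fun j => v (i + j)%N)).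
have Pc : coefficients P (C * M * N) (2 * (r + s)).
  split.
  - by split; rewrite !mulr_ge0// addr_ge0.
  - move=> n v v' vv; apply: eq_bigr => i _; congr b.
      by apply: Al => j ji; apply: vv; rewrite (leq_trans ji)// -ltnS.
    by apply: Bl => j jn; apply: vv; rewrite -ltn_subRL.
  - move=> n m v mn.
    have lin (i : 'I_n.+1) : linear (fun x =>
        b (A i (upd v m x)) (B (n - i)%N (fun j => upd v m x (i + j)%N))).
      have [mi|im] := ltnP m i.
        have E0 x : B (n - i)%N (fun j => upd v m x (i + j)%N) =
            B (n - i)%N (fun j => v (i + j)%N).
          by apply: Bl => j _; rewrite /upd gtn_eqF// ltn_addr.
        by move=> c x y; rewrite !E0 Am// bl.
      have E1 x : A i (upd v m x) = A i v.
        by apply: Al => j ji; rewrite /upd ltn_eqF// (leq_trans ji).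
      have E2 x : B (n - i)%N (fun j => upd v m x (i + j)%N) =
          B (n - i)%N (upd (fun j => v (i + j)%N) (m - i)%N x).
        apply: Bl => j _; rewrite /upd.
        by rewrite -{1}(subnKC im) eqn_add2l.
      move=> c x y; rewrite !E1 !E2 Bm ?br// ltn_sub2r//.
      exact: leq_ltn_trans im mn.
    move=> c x y; rewrite /P scaler_sumr -big_split /=.
    by apply: eq_bigr => i _; exact: lin.
  - move=> n v.
    apply: (le_trans (rnorm_sum _ _)).
    set p := \prod_(i < n) rnorm (v i).
    have p0 : 0 <= p by apply: prodr_ge0 => i _; exact: rnorm_ge0.
    have rs0 : 0 <= r + s by exact: addr_ge0.
    apply: (@le_trans _ _ (\sum_(i < n.+1) C * M * N * (r + s) ^+ n * p)).
      apply: ler_sum => i _; have iln : (i <= n)%N by rewrite -ltnS.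
      apply: (le_trans (bC _ _)).
      have hA := Ab i v; have hB := Bb (n - i)%N (fun j => v (i + j)%N).
      apply: (le_trans (ler_pM _ _ (ler_wpM2l C0 hA) hB)); rewrite ?mulr_ge0 ?rnorm_ge0//.
      have -> : p = \prod_(j < i) rnorm (v j) * \prod_(j < n - i) rnorm (v (i + j)%N).
        by rewrite -(prod_split (fun j => rnorm (v j))) subnKC.
      set p1 := \prod_(j < i) _; set p2 := \prod_(j < n - i) _.
      have p10 : 0 <= p1 by apply: prodr_ge0 => j _; exact: rnorm_ge0.
      have p20 : 0 <= p2 by apply: prodr_ge0 => j _; exact: rnorm_ge0.
      have -> : C * (M * r ^+ i * p1) * (N * s ^+ (n - i) * p2) =
          C * M * N * (r ^+ i * s ^+ (n - i)) * (p1 * p2) by ring.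
      apply: ler_wpM2r; first exact: mulr_ge0.
      apply: ler_wpM2l; first by rewrite !mulr_ge0.
      have -> : (r + s) ^+ n = (r + s) ^+ i * (r + s) ^+ (n - i).
        by rewrite -exprD subnKC.
      by apply: ler_pM; rewrite ?exprn_ge0//; apply: lerXn2r; rewrite ?nnegrE// ?lerDl// lerDr.
    (* The number n + 1 of terms is at most 2 ^ n. *)
    rewrite sumr_const card_ord -[leLHS]mulr_natl.
    have -> : C * M * N * (2 * (r + s)) ^+ n * p =
      2 ^+ n * (C * M * N * (r + s) ^+ n * p) by rewrite exprMn; ring.
    apply: ler_wpM2r; first by rewrite !mulr_ge0// exprn_ge0.
    by rewrite -natrX ler_nat ltn_expl.
pose t := (4 * (r + s + 1))^-1.
have rs0 : 0 < r + s + 1 by rewrite ltr_wpDl// addr_ge0.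
have t0 : 0 < t by rewrite invr_gt0 mulr_gt0.
exists P, (C * M * N), (2 * (r + s)), (Num.min t (Num.min d e)).
split=> //; first by rewrite !lt_min t0 d0.
move=> h; rewrite !lt_min => /and3P[ht hd he].
have small q : 0 <= q -> q <= r + s + 1 -> q * rnorm h <= 4^-1.
  move=> q0 qr; apply: (@le_trans _ _ ((r + s + 1) * t)).
    apply: ler_pM => //; [exact: rnorm_ge0|exact: ltW].
  by rewrite /t invfM mulrCA divff ?mulr1//; exact: lt0r_neq0.
have hA := coefficients_small Ac (small r r0 _).
have hB := coefficients_small Bc (small s s0 _).
have {}hA n : rnorm (A n (fun=> h)) <= M * (4^-1) ^+ n by apply: hA; lra.
have {}hB n : rnorm (B n (fun=> h)) <= N * (4^-1) ^+ n by apply: hB; lra.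
have tB := small_tail N0 hB (Bg h he).
have fh := Af h hd.
pose GN m := \sum_(j < m) B j (fun=> h).
(* The triangle of the indices i + j < m, summed by rows. *)
have PE m : \sum_(n < m) P n (fun=> h) = \sum_(i < m) b (A i (fun=> h)) (GN (m - i)%N).
  elim: m => [|m IH]; first by rewrite !big_ord0.
  rewrite big_ord_recr /= IH /P !big_ord_recr /= addrA -big_split /=.
  rewrite subnn subSnn [GN 1%N]big_ord1; congr (_ + _).
  apply: eq_bigr => i _; rewrite subSn 1?ltnW// /GN big_ord_recr /=.
  by have := br (A i (fun=> h)) 1 (\sum_(j < m - i) B j (fun=> h)) (B (m - i)%N (fun=> h));
    rewrite !scale1r => <-.
(* The rows are compared with those of b (A_0 + ... + A_(m-1)) (g (a + h)). *)
have blip x y z : rnorm (b x z - b y z) <= (C * rnorm z) * rnorm (x - y).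
  have -> : b x z - b y z = b (x - y) z.
    by have := bl z (-1) y x; rewrite !scaleN1r [- y + x]addrC => ->; rewrite addrC.
  by rewrite mulrAC; exact: bC.
have lim1 := rlim_lip (f := b^~ (g (a + h))) (fun x y => blip x y _) fh.
have sumb m : b (\sum_(n < m) A n (fun=> h)) (g (a + h)) =
    \sum_(n < m) b (A n (fun=> h)) (g (a + h)).
  exact: (linear_sum (linear_of (bl (g (a + h))))).
have lim2 : rlim (fun m => \sum_(n < m) P n (fun=> h) -
    b (\sum_(n < m) A n (fun=> h)) (g (a + h))) 0.
  apply: (rlim_half (C := C * M * (2 * N))) => m; rewrite subr0 PE sumb -sumrB.
  apply: (le_trans (rnorm_sum _ _)).
  apply: (@le_trans _ _ (\sum_(i < m) C * M * (2 * N) * (4^-1) ^+ m)).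
    apply: ler_sum => i _.
    have -> : b (A i (fun=> h)) (GN (m - i)%N) - b (A i (fun=> h)) (g (a + h)) =
        b (A i (fun=> h)) (GN (m - i)%N - g (a + h)).
      have := br (A i (fun=> h)) (-1) (g (a + h)) (GN (m - i)%N).
      by rewrite !scaleN1r [- g (a + h) + _]addrC => ->; rewrite addrC.
    apply: (le_trans (bC _ _)).
    have h2 := tB (m - i)%N; rewrite rnormC in h2.
    apply: (le_trans (ler_pM _ _ (ler_wpM2l C0 (hA i)) h2)); rewrite ?mulr_ge0 ?rnorm_ge0//.
    have -> : C * (M * 4^-1 ^+ i) * (2 * N * 4^-1 ^+ (m - i)) =
      C * M * (2 * N) * (4^-1 ^+ i * 4^-1 ^+ (m - i)) by ring.
    by rewrite -exprD subnKC// ltnW.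
  rewrite sumr_const card_ord -[leLHS]mulr_natl mulrCA.
  apply: ler_wpM2l; first by rewrite !mulr_ge0//; lra.
  have -> : (4^-1 : R) = 2^-1 * 2^-1 by field.
  rewrite exprMn mulrA ler_piMl//; first by apply: exprn_ge0; lra.
  rewrite exprVn ler_pdivrMr ?exprn_gt0// mul1r -natrX ler_nat ltnW//.
  exact: ltn_expl.
have := rlimD lim2 lim1; rewrite add0r; congr rlim; apply/funext => m.
by rewrite subrK.
Qed.

End PowerSeries.

(** * Bounded forms and projectors on Hilbert spaces *)

Lemma conj0 (R : realType) (k : scalar_kind) : @conj R k 0 = 0.
Proof. by case: k => //; apply/eqP; rewrite eq_complex /= oppr0 !eqxx. Qed.

Section HilbertDuals.
Variables (R : realType) (k : scalar_kind) (H : hilbertType R k).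
Local Notation K := (scalars R k).

Lemma pythagoras (e w : H) : inner H e w = 0 -> `|w| ^+ 2 <= `|e + w| ^+ 2.
Proof.
move=> ew; have we : inner H w e = 0.
  have E : conj (inner H e w) = 0 by rewrite ew conj0.
  by apply: etrans (hermitian_subproof _ _) _; rewrite expr0 mul1r; exact: E.
rewrite -!inner_norm linearDl /= !linearDr /= ew we addr0 add0r lerDr.
by rewrite inner_norm exprn_ge0.
Qed.

(** The form z |-> <z, u> / <u, u> is bounded because z minus its component
    along u is orthogonal to u. *)
Lemma hilbert_form (u : H) : u != 0 ->
  exists l : {linear H -> K^o}, l u = 1 /\
    exists C : R, forall z, rnorm (l z) <= C * rnorm z.
Proof.
move=> u0; have uu0 : inner H u u != 0.
  by rewrite inner_norm expf_neq0// normr_eq0.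
pose f z : K^o := inner H z u / inner H u u.
have fl : linear f.
  by move=> a x y; rewrite /f linearPl mulrDl /GRing.scale /= mulrA.
exists (linear_of fl); split; first by rewrite /= /f divff.
have ru : 0 < rnorm u.
  rewrite lt_neqAle rnorm_ge0 andbT eq_sym; apply/eqP => /rnorm_eq0 E.
  by rewrite E eqxx in u0.
exists (rnorm u)^-1 => z; rewrite mulrC ler_pdivlMr// -rnormZ.
pose e := z - (f z : K) *: u.
have eu : inner H e u = 0.
  by rewrite /e linearBl /= linearZl_LR /= /f divfK// subrr.
have : `|(f z : K) *: u| ^+ 2 <= `|z| ^+ 2.
  rewrite -[in leRHS](subrK ((f z : K) *: u) z); apply: pythagoras.
  by rewrite linearZr_LR /= eu mulr0.
rewrite -!of_real_rnorm -!of_realX of_real_le.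
by rewrite ler_pXn2r ?nnegrE ?rnorm_ge0.
Qed.

(** Induction on the sequence: x minus its component p x along s carries a
    bounded form f, and f (z - p z) is 1 at x and 0 on s.  Subtracting multiples
    of this form makes the dual family of s vanish at x. *)
Lemma hilbert_dual_family (s : seq H) : blade s <> 0 ->
  exists l : nat -> bop H K^o, forall i j, (i < size s)%N -> (j < size s)%N ->
    l i s`_j = (i == j)%:R.
Proof.
elim: s => [|x s IH] s0; first by exists (fun=> 0).
have [|l lP] := IH.
  by move=> E; apply: s0; rewrite -cat1s -wedge_blade E wedge0r.
pose p z := \sum_(j < size s) (l j z : K) *: s`_j.
have pl : linear p.
  move=> a y z; rewrite /p scaler_sumr -big_split /=; apply: eq_bigr => j _.
  by rewrite bopD bopZ scalerDl scalerA.
have ps j : (j < size s)%N -> p s`_j = s`_j.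
  move=> js; rewrite /p (bigD1 (Ordinal js))//= lP// eqxx scale1r big1 ?addr0// => i.
  by rewrite -val_eqE /= => /negbTE ij; rewrite lP// ij scale0r.
pose u := x - p x.
have u0 : u != 0.
  apply/eqP => E; apply: s0; apply: (blade_dep (p := [::])).
  rewrite -(subrK (p x) x) -/u E add0r; apply: ss_sum => j.
  by apply/ssZ/mem_spans/mem_nth.
have [f [fu [C fC]]] := hilbert_form u0.
have pC : exists D : R, forall z, rnorm (p z) <= D * rnorm z.
  exists (\sum_(j < size s) rnorm (l j) * rnorm s`_j) => z.
  rewrite mulr_suml /p; elim/big_ind2: _ => [|a b c d ab cd|j _].
  - by rewrite rnorm0.
  - exact: le_trans (rnormD _ _) (lerD ab cd).
  - rewrite rnormZ mulrAC; apply: ler_wpM2r; first exact: rnorm_ge0.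
    exact: rnorm_bop.
have [D DP] := pC.
have [||m mE] := @bop_intro R k H K^o (fun z => f (z - p z)).
- move=> a y z; rewrite -linearP; congr (f _).
  by rewrite pl opprD addrACA scalerBr.
- exists (`|C| * (1 + D)) => z; apply: (le_trans (fC _)).
  rewrite -mulrA; apply: (@le_trans _ _ (`|C| * rnorm (z - p z))).
    by apply: ler_wpM2r; [exact: rnorm_ge0|exact: ler_norm].
  apply: ler_wpM2l => //; rewrite mulrDl mul1r.
  exact: le_trans (rnormB _ _) (lerD (lexx _) (DP z)).
have mx : m x = 1 by rewrite mE.
have ms j : (j < size s)%N -> m s`_j = 0.
  by move=> js; rewrite mE ps// subrr linear0.
exists (fun i => if i is i'.+1 then l i' - (l i' x : K) *: m else m).
move=> [|i] [|j] //= si sj; first exact: ms.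
- rewrite bop_subE bop_scaleE mx.
  by rewrite /GRing.scale /= mulr1 subrr.
- rewrite bop_subE bop_scaleE ms// scaler0 subr0.
  by rewrite lP// eqSS.
Qed.

Lemma hilbert_projector (X : subspace H) : finite_dim X ->
  exists P : bop H H, (forall x, X (P x)) /\ (forall x, X x -> P x = x).
Proof.
move=> [s sX]; have [l lP] := hilbert_dual_family (basis_neq0 sX).
have [||P PE] := @bop_intro R k H H (fun z => \sum_(j < size s) (l j z : K) *: s`_j).
- move=> a y z; rewrite scaler_sumr -big_split /=; apply: eq_bigr => j _.
  by rewrite bopD bopZ scalerDl scalerA.
- exists (\sum_(j < size s) rnorm (l j) * rnorm s`_j) => z.
  rewrite mulr_suml; elim/big_ind2: _ => [|a b c d ab cd|j _].
  - by rewrite rnorm0.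
  - exact: le_trans (rnormD _ _) (lerD ab cd).
  - rewrite rnormZ mulrAC; apply: ler_wpM2r; first exact: rnorm_ge0.
    exact: rnorm_bop.
exists P; split=> x.
  by rewrite PE; apply: ss_sum => j; apply: ssZ; apply: (basis_mem sX); exact: mem_nth.
move=> /(basis_gen sX)/span_comb[c ->].
rewrite PE; apply: eq_bigr => i _; congr (_ *: _).
rewrite [l i _](linear_sum (l i)) (bigD1 i)//= bopZ lP// eqxx big1 ?addr0.
  by rewrite /GRing.scale /= mulr1.
move=> j ji; rewrite bopZ lP// -val_eqE eq_sym /= in ji *.
by rewrite (negbTE ji) scaler0.
Qed.

End HilbertDuals.

(** * Charts of the inverse images of a subspace *)

Section Charts.
Variables (R : realType) (k : scalar_kind).
Local Notation K := (scalars R k).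

(** The domain of the trivialization of the bundle of DetX_bundle X given by
    the projector P. *)
Definition chart_dom (V W : normedModType K) (X : subspace W) (P : bop V V)
    (T : bop V W) :=
  [/\ transversal X T, forall x, X (T x) -> P x = 0 -> x = 0
    & forall y, lran P y -> exists x, X (T x) /\ P x = y].

Variables V W : completeNormedModType K.
Variables (X : subspace W) (Q : bop W W) (P : bop V V).
(* Q is a projector with kernel X: membership in X becomes the equation Q w = 0,
   which is preserved by limits. *)
Hypothesis XQ : forall w, X (w - Q w).
Hypothesis QX : forall w, X w -> Q w = 0.

Let Q0 w : Q w = 0 -> X w.
Proof. by move=> Qw; have := XQ w; rewrite Qw subr0. Qed.

Let QQ w : Q (Q w) = Q w.
Proof. by apply/esym/eqP; rewrite -subr_eq0 -bopB; apply/eqP/QX/XQ. Qed.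

Lemma rlim_bop (U U' : normedModType K) (T : bop U U') u l :
  rlim u l -> rlim (fun n => T (u n)) (T l).
Proof.
apply: (rlim_lip (C := rnorm T)) => x y; rewrite -bopB; exact: rnorm_bop.
Qed.

(** The linear section of T0 modulo X with values in the kernel of P is unique;
    hence its graph is closed, and it is bounded. *)
Lemma chart_section T0 : chart_dom X P T0 -> exists A : bop W V,
  (forall w, X (T0 (A w) - w)) /\ (forall w, P (A w) = 0).
Proof.
move=> [T0X inj sur].
have [|x|E [EX PE]] := @algebraic_section _ _ _ _ T0 X P T0X.
- exact: inj.
- by have [|y [Xy Py]] := sur (P x); [exists x|exists y].
have [C EC] : exists C : R, forall w, rnorm (E w) <= C * rnorm w.
  apply: closed_graph => [a x y|u w v uw Ev]; first exact: linearP.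
  apply/eqP; rewrite -subr_eq0; apply/eqP; apply: inj; last first.
    rewrite bopB PE sub0r; apply/eqP; rewrite oppr_eq0; apply/eqP.
    apply: (rlim_uniq (rlim_bop P Ev)).
    by under eq_fun do rewrite PE; exact: rlim_cst.
  have Q1 : Q (T0 v) = Q w.
    apply: (rlim_uniq (rlim_bop Q (rlim_bop T0 Ev))).
    have -> : (fun n => Q (T0 (E (u n)))) = (fun n => Q (u n)).
      apply/funext => n; apply/eqP; rewrite -subr_eq0 -bopB; apply/eqP.
      by apply: QX; exact: EX.
    exact: rlim_bop.
  apply: Q0; rewrite bopB bopB Q1.
  by rewrite -bopB; apply: QX; exact: EX.
have [||A AE] := @bop_intro _ _ W V E; first by move=> a x y; exact: linearP.
  by exists C.
by exists A; split=> w; rewrite AE; [exact: EX|exact: PE].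
Qed.

Section Neumann.
Variables (T0 : bop V W) (A : bop W V).
Hypotheses (AX : forall w, X (T0 (A w) - w)) (PA : forall w, P (A w) = 0).

Let QTA w : Q (T0 (A w)) = Q w.
Proof. by apply/eqP; rewrite -subr_eq0 -bopB; apply/eqP/QX. Qed.

(** The multilinear maps whose diagonal values are the terms of the Neumann
    series A - A Q h A + A Q h A Q h A - ..., the section modulo X of T0 + h. *)
Fixpoint neumann n (v : nat -> bop V W) : bop W V :=
  if n is m.+1 then
    - bop_comp A (bop_comp Q (bop_comp (v 0%N) (neumann m (fun i => v i.+1))))
  else A.

Let neumannS n v w : neumann n.+1 v w =
  - A (Q (bop_fun (v 0%N) (neumann n (fun i => v i.+1) w))).
Proof. by []. Qed.

Lemma neumann_coefficients :
  coefficients neumann (rnorm A) (rnorm A * rnorm Q).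
Proof.
split.
- by rewrite mulr_ge0 ?rnorm_ge0.
- elim=> // n IH v v' vv; apply: bop_eq => w; rewrite !neumannS vv//.
  by rewrite (IH _ (fun i => v' i.+1)) // => i ni; exact: vv.
- elim=> [//|n IH] [|i] v; rewrite ?ltnS => ni a x y; apply: bop_eq => w.
    rewrite bop_addE bop_scaleE !neumannS /upd /= bop_addE bop_scaleE.
    by rewrite !(bopD, bopZ) opprD scalerN.
  have E z : neumann n (fun j => upd v i.+1 z j.+1) =
      neumann n (upd (fun j => v j.+1) i z) by [].
  rewrite bop_addE bop_scaleE !neumannS !E (IH i (fun j => v j.+1) ni).
  by rewrite bop_addE bop_scaleE !(bopD, bopZ) opprD scalerN.
- elim=> [v|n IH v]; first by rewrite expr0 big_ord0 !mulr1.
  apply: rnorm_bop_le => [|w].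
    by rewrite !mulr_ge0 ?exprn_ge0 ?mulr_ge0 ?rnorm_ge0// prodr_ge0// => i _;
      rewrite rnorm_ge0.
  rewrite neumannS rnormN big_ord_recl exprS.
  have h1 := rnorm_bop A (Q (bop_fun (v 0%N) (neumann n (fun i => v i.+1) w))).
  have h2 := rnorm_bop Q (bop_fun (v 0%N) (neumann n (fun i => v i.+1) w)).
  have h3 := rnorm_bop (v 0%N) (neumann n (fun i => v i.+1) w).
  have h4 := rnorm_bop (neumann n (fun i => v i.+1)) w.
  have h5 := IH (fun i => v i.+1).
  have le l b c d : 0 <= l -> (b <= c -> d <= l * b -> d <= l * c :> R).
    by move=> l0 bc dl; apply: (le_trans dl); exact: ler_wpM2l.
  have h6 := le _ _ _ _ (rnorm_ge0 A) (le _ _ _ _ (rnorm_ge0 Q)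
    (le _ _ _ _ (rnorm_ge0 (v 0%N)) (le_trans h4 (ler_wpM2r (rnorm_ge0 w) h5)) h3) h2) h1.
  apply: (le_trans h6); rewrite le_eqVlt; apply/orP; left; apply/eqP => /=.
  set p := \prod_(_ < n) _; set q := (_ * _) ^+ n.
  ring.
Qed.

Let r := rnorm A * rnorm Q.

Let r0 : 0 <= r.
Proof. by rewrite mulr_ge0 ?rnorm_ge0. Qed.

Let neumann_le n (h : bop V W) : r * rnorm h <= 2^-1 ->
  rnorm (neumann n (fun=> h)) <= rnorm A * (2^-1) ^+ n.
Proof.
move=> rh; have [_ _ _ b] := neumann_coefficients; apply: (le_trans (b _ _)).
rewrite -/r -mulrA; apply: ler_wpM2l; first exact: rnorm_ge0.
rewrite prodr_const card_ord -exprMn.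
by apply: lerXn2r; rewrite ?nnegrE ?mulr_ge0 ?rnorm_ge0//; lra.
Qed.

Let partial (h : bop V W) N : bop W V := \sum_(n < N) neumann n (fun=> h).

Let neumann_telescope (h : bop V W) N w :
  Q (bop_fun (T0 + h) (partial h N.+1 w)) = Q w + Q (h (neumann N (fun=> h) w)).
Proof.
elim: N => [|N IH].
  by rewrite /partial big_ord1 bop_addE bopD QTA.
have -> : partial h N.+2 w = partial h N.+1 w + neumann N.+1 (fun=> h) w.
  by rewrite /partial big_ord_recr bop_addE.
rewrite bopD bopD IH -addrA.
congr (_ + _); rewrite bop_addE bopD.
have -> : Q (T0 (neumann N.+1 (fun=> h) w)) = - Q (h (neumann N (fun=> h) w)).
  by rewrite neumannS !bopN QTA QQ.
by rewrite addrA subrr add0r.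
Qed.

Lemma neumann_inverse : exists E : bop V W -> bop W V, analytic E T0 /\
  forall T : bop V W, r * rnorm (T - T0) <= 2^-1 ->
    (forall w, X (T (E T w) - w)) /\ (forall w, P (E T w) = 0).
Proof.
have lim (h : bop V W) : exists l : bop W V, r * rnorm h <= 2^-1 -> rlim (partial h) l.
  have [rh|rh] := boolP (r * rnorm h <= 2^-1); last by exists 0.
  have [n|l lP] := @bop_complete _ _ _ _ (partial h) (rnorm A).
    by rewrite /partial big_ord_recr /= addrAC subrr add0r; exact: neumann_le.
  by exists l => _; apply: (rlim_half (C := 2 * rnorm A)) => n; rewrite rnormC.
have [l lP] := choice lim; exists (fun T => l (T - T0)); split.
  have r1 : 0 < r + 1 by rewrite ltr_wpDl.
  exists neumann, (rnorm A), r, (2 * (r + 1))^-1; split.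
  - exact: neumann_coefficients.
  - by rewrite invr_gt0 mulr_gt0.
  - move=> h hd; rewrite (_ : T0 + h - T0 = h); last by rewrite addrC addKr.
    apply: lP; apply: (@le_trans _ _ ((r + 1) * (2 * (r + 1))^-1)).
      by apply: ler_pM; [exact: r0|exact: rnorm_ge0|lra|exact: ltW].
    by rewrite invfM mulrCA divff ?mulr1// lt0r_neq0.
move=> T rT; have lT := lP _ rT.
pose h : bop V W := T - T0; rewrite -/h in rT lT *.
have TE : T = T0 + h by rewrite /h addrC subrK.
have ev w : rlim (fun n => partial h n w) (l h w).
  apply: (rlim_lip (f := fun S : bop W V => S w) (C := rnorm w) _ lT) => S S'.
  by rewrite -bop_subE mulrC; exact: rnorm_bop.
split=> w; last first.
  apply: (rlim_uniq (rlim_bop P (ev w))).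
  have -> : (fun n => P (partial h n w)) = (fun=> 0).
    apply/funext => n; rewrite /partial bop_sumE.
    rewrite (linear_sum P) big1// => m _; case: (nat_of_ord m) => [|{}m].
      exact: PA.
    by rewrite [X in P X = _]neumannS bopN PA oppr0.
  exact: rlim_cst.
apply: Q0; rewrite bopB; apply/eqP; rewrite subr_eq0; apply/eqP.
have lim1 := rlim_bop Q (rlim_bop T (rlimS (ev w))).
apply: (rlim_uniq lim1).
have -> : (fun n => Q (T (partial h n.+1 w))) =
    (fun n => Q w + Q (h (neumann n (fun=> h) w))).
  by apply/funext => n; rewrite {1}TE neumann_telescope.
rewrite -[X in rlim _ X]addr0; apply: rlimD; first exact: rlim_cst.
apply: (rlim_half (C := rnorm Q * (rnorm h * (rnorm A * rnorm w)))) => n.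
rewrite subr0; apply: (le_trans (rnorm_bop _ _)); rewrite -mulrA.
apply: ler_wpM2l; first exact: rnorm_ge0.
apply: (le_trans (rnorm_bop _ _)); rewrite -mulrA.
apply: ler_wpM2l; first exact: rnorm_ge0.
apply: (le_trans (rnorm_bop _ _)); rewrite mulrAC.
by apply: ler_wpM2r; [exact: rnorm_ge0|exact: neumann_le].
Qed.

End Neumann.

Hypotheses (fX : finite_dim X) (fP : finite_dim (lran P)).

(** The map P embeds the kernel of T in ran P, and X maps onto the cokernel. *)
Lemma chart_fredholm (T : bop V W) : (forall y, exists x z, X z /\ y = T x + z) ->
  (forall x, X (T x) -> P x = 0 -> x = 0) -> fredholm T.
Proof.
move=> dec inj; split; last first.
  by have [s [t [_ _ b]]] := ses_bases (ses_target_dec dec) fX; eexists; exact: b.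
have [C [sC CP]] : exists C : subspace V, ses P (zero_space V) (lker T) C /\
    forall y, C y -> lran P y.
  have C0 : exists2 x, T x = 0 & P x = 0 by exists 0; exact: bop0.
  have CP a y z : (exists2 x, T x = 0 & P x = y) -> (exists2 x, T x = 0 & P x = z) ->
      exists2 x, T x = 0 & P x = a *: y + z.
    move=> [x Tx <-] [x' Tx' <-]; exists (a *: x + x').
      by rewrite bopD bopZ Tx Tx' scaler0 addr0.
    by rewrite bopD bopZ.
  exists (Subspace C0 CP); split; last by move=> y [x _ <-]; exists x.
  split=> [x|y]; split=> //.
    by move=> ->; split; exact: bop0.
  move=> [Tx Px]; apply: inj => //.
  by rewrite (Tx : T x = 0); exact: ss0.
apply: (ses_finite_dim_mid sC); last exact: finite_dim_sub CP fP.
exists [::]; apply: basis_intro => // [x ->|]; first exact: ss0.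
by apply/independent_blade => c _ [].
Qed.

Lemma chart_dom_intro (T : bop V W) (E : bop W V) : (forall x, X (T x) -> P x = 0 -> x = 0) ->
  (forall w, X (T (E w) - w)) -> (forall w, P (E w) = 0) -> chart_dom X P T.
Proof.
move=> inj EX PE.
have dec y : exists x z, X z /\ y = T x + z.
  exists (E y), (y - T (E y)); split; last by rewrite addrC subrK.
  by rewrite -opprB; exact: ssN.
split=> //; first by split=> //; exact: chart_fredholm.
move=> y [x Px]; exists (x - E (T x)); split.
  by rewrite bopB -opprB; exact: ssN.
by rewrite bopB PE subr0.
Qed.

Lemma chart_analytic T0 : chart_dom X P T0 ->
  exists E : bop V W -> bop W V, analytic E T0 /\
    exists2 d : R, 0 < d & forall T : bop V W, rnorm (T - T0) < d ->
      [/\ chart_dom X P T, forall w, X (T (E T w) - w) & forall w, P (E T w) = 0].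
Proof.
move=> dom0; have [_ inj0 _] := dom0; have [A [AX PA]] := chart_section dom0.
have [E [Ea EP]] := neumann_inverse AX PA.
exists E; split=> //; set r := rnorm A * rnorm Q in EP.
have r0 : 0 <= r by rewrite mulr_ge0 ?rnorm_ge0.
exists (2 * (r + 1))^-1; first by rewrite invr_gt0 mulr_gt0// ltr_wpDl.
move=> T hT; have rT : r * rnorm (T - T0) <= 2^-1.
  apply: (@le_trans _ _ ((r + 1) * (2 * (r + 1))^-1)).
    by apply: ler_pM; [exact: r0|exact: rnorm_ge0|lra|exact: ltW].
  by rewrite invfM mulrCA divff ?mulr1// lt0r_neq0// ltr_wpDl.
have [EX PE] := EP T rT; split=> //.
apply: (chart_dom_intro _ EX PE).
move=> x XTx Px.
have A0 z : X z -> A z = 0.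
  move=> Xz; apply: inj0; last exact: PA.
  by rewrite -(subrK z (T0 _)); apply: ssD.
have xE : x = A (T0 x).
  apply/eqP; rewrite -subr_eq0; apply/eqP; apply: inj0; last first.
    by rewrite bopB Px PA subrr.
  by rewrite bopB -opprB; exact: ssN.
(* For x in T^-1 X with P x = 0, x = A T0 x = - A Q (T - T0) x. *)
have xh : x = - A (Q (bop_fun (T - T0) x)).
  rewrite {1}xE -[T0 x](subrK (Q (T0 x))) bopD (A0 _ (XQ _)) add0r.
  rewrite bop_subE bopB (QX XTx) sub0r.
  by rewrite !bopN opprK.
have xr : rnorm x <= 2^-1 * rnorm x.
  rewrite {1}xh rnormN; apply: (le_trans (rnorm_bop _ _)).
  apply: (le_trans (ler_wpM2l (rnorm_ge0 A) (rnorm_bop Q _))).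
  rewrite mulrA -/r; apply: (le_trans (ler_wpM2l r0 (rnorm_bop _ _))).
  by rewrite mulrA; apply: ler_wpM2r => //; exact: rnorm_ge0.
by apply: rnorm_eq0; have := rnorm_ge0 x; lra.
Qed.

End Charts.

(** * Calculus of analytic maps *)

Section AnalyticMore.
Variables (R : realType) (k : scalar_kind).
Local Notation K := (scalars R k).
Implicit Types (B V W : normedModType K).

Lemma bop_comp_linear_l (U V W : normedModType K) (S : bop U V) :
  linear (fun T : bop V W => bop_comp T S).
Proof. by move=> a T T'; apply: bop_eq. Qed.

Lemma bop_comp_linear_r (U V W : normedModType K) (T : bop V W) :
  linear (fun S : bop U V => bop_comp T S).
Proof.
move=> a S S'; apply: bop_eq => x; rewrite bop_addE bop_scaleE.
rewrite -[LHS]/(T (bop_fun (a *: S + S') x)) bop_addE bop_scaleE bopD bopZ.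
by [].
Qed.

Lemma analytic_apply B V W (T : B -> bop V W) (x : B -> V) a :
  analytic T a -> analytic x a -> analytic (fun b => T b (x b)) a.
Proof.
apply: (analytic_bilinear (b := fun (T : bop V W) (x : V) => T x) (C := 1)).
- by move=> y c S S'; rewrite bop_addE bop_scaleE.
- by move=> S c y z; rewrite bopD bopZ.
- by [].
- by move=> S y; rewrite mul1r; exact: rnorm_bop.
Qed.

Lemma analyticZ B V (c : B -> K^o) (x : B -> V) a :
  analytic c a -> analytic x a -> analytic (fun b => (c b : K) *: x b) a.
Proof.
apply: (analytic_bilinear (b := fun (c : K^o) (x : V) => (c : K) *: x) (C := 1)).
- by move=> y d e e'; rewrite scalerDl scalerA.
- by move=> d e y z; rewrite scalerDr !scalerA mulrC.
- by [].
- by move=> d y; rewrite mul1r rnormZ.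
Qed.

Lemma analyticB B V (f g : B -> V) a :
  analytic f a -> analytic g a -> analytic (fun b => f b - g b) a.
Proof.
move=> fa ga; have := analyticD fa (analyticZ (analytic_cst a (-1 : K^o)) ga).
by congr analytic; apply/funext => b; rewrite scaleN1r.
Qed.

Lemma analytic_det B n (c : 'I_n -> 'I_n -> B -> K) a :
  (forall i j, analytic (c i j : B -> K^o) a) ->
  analytic (fun b => \det (\matrix_(i, j) c i j b) : K^o) a.
Proof.
move=> ca.
have sum_an (I : Type) (r : seq I) (f : I -> B -> K^o) :
    (forall i, analytic (f i) a) -> analytic (fun b => \sum_(i <- r) f i b) a.
  move=> fa; elim: r => [|i r IH].
    have := analytic_cst a (0 : K^o).
    by congr analytic; apply/funext => b; rewrite big_nil.
  have := analyticD (fa i) IH.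
  by congr analytic; apply/funext => b; rewrite big_cons.
have prod_an (I : Type) (r : seq I) (f : I -> B -> K^o) :
    (forall i, analytic (f i) a) ->
    analytic (fun b => \prod_(i <- r) (f i b : K) : K^o) a.
  move=> fa; elim: r => [|i r IH].
    have := analytic_cst a (1 : K^o).
    by congr analytic; apply/funext => b; rewrite big_nil.
  have := analyticZ (fa i) IH.
  by congr analytic; apply/funext => b; rewrite big_cons.
have := sum_an _ (index_enum _) (fun (s : 'S_n) b =>
  ((-1) ^+ s : K) *: (\prod_i c i (s i) b : K^o)).
rewrite (_ : (fun b => _) = (fun b => \det (\matrix_(i, j) c i j b))).
  apply=> s; apply: analyticZ; first exact: analytic_cst.
  by apply: (prod_an _ _ (fun i => c i (s i))) => i; exact: ca.
apply/funext => b; rewrite /determinant; apply: eq_bigr => s _.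
by congr (_ * _); apply: eq_bigr => i _; rewrite mxE.
Qed.

Lemma rnorm_fst B V (p : (B * V)%type) : rnorm p.1 <= rnorm p.
Proof.
rewrite -(of_real_le k) !of_real_rnorm prod_normE /= /Order.max.
by case: ifP => // /ltW.
Qed.

Lemma rnorm_snd B V (p : (B * V)%type) : rnorm p.2 <= rnorm p.
Proof.
rewrite -(of_real_le k) !of_real_rnorm prod_normE /= /Order.max.
case: ifP => // /negbT; rewrite -!of_real_rnorm of_real_lt -leNgt.
by rewrite of_real_le.
Qed.

Lemma analytic_fst B V W (f : B -> W) (p : (B * V)%type) :
  analytic f p.1 -> analytic (fun q : (B * V)%type => f q.1) p.
Proof.
by apply: (analytic_comp_linear (p := fst)) => // h; exact: rnorm_fst.
Qed.

Lemma analytic_snd B V W (f : V -> W) (p : (B * V)%type) :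
  analytic f p.2 -> analytic (fun q : (B * V)%type => f q.2) p.
Proof.
by apply: (analytic_comp_linear (p := snd)) => // h; exact: rnorm_snd.
Qed.

Lemma analytic_id B (a : B) : analytic (fun b : B => b) a.
Proof. by apply: (@analytic_linear _ _ _ _ id a 1) => // h; rewrite mul1r. Qed.

Lemma analytic_comp_bop (U V W : normedModType K)
    (p : (bop U V * bop V W)%type) :
  analytic (fun q : (bop U V * bop V W)%type => bop_comp q.2 q.1) p.
Proof.
apply: (analytic_bilinear (b := fun (T : bop V W) (S : bop U V) => bop_comp T S) (C := 1)).
- exact: bop_comp_linear_l.
- exact: bop_comp_linear_r.
- by [].
- by move=> T S; rewrite mul1r; exact: rnorm_comp.
- exact: analytic_snd (analytic_id _).
- exact: analytic_fst (analytic_id _).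
Qed.

Lemma bop_comp_sub (U V W : normedModType K) (T T' : bop V W) (S S' : bop U V) :
  bop_comp T' S' - bop_comp T S = bop_comp T (S' - S) + bop_comp (T' - T) S'.
Proof.
apply: bop_eq => x; rewrite bop_subE bop_addE.
have -> : bop_comp T (S' - S) x = T (S' x) - T (S x) by rewrite -bopB.
have -> : bop_comp (T' - T) S' x = T' (S' x) - T (S' x) by [].
by rewrite [RHS]addrC addrA subrK.
Qed.

Lemma comp_continuous (U V W : normedModType K) (p : (bop U V * bop V W)%type)
    (d : R) : 0 < d ->
  exists2 e : R, 0 < e & forall q, rnorm (q - p) < e ->
    rnorm (bop_comp q.2 q.1 - bop_comp p.2 p.1) < d.
Proof.
move=> d0; pose m := rnorm p.2 + rnorm p.1 + 1.
have m0 : 0 < m by rewrite ltr_wpDl// addr_ge0 ?rnorm_ge0.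
exists (Num.min 1 (d / m)); first by rewrite lt_min ltr01 divr_gt0.
move=> q; rewrite lt_min => /andP[q1 qd].
have h1 := rnorm_fst (q - p); have h2 := rnorm_snd (q - p).
rewrite bop_comp_sub.
apply: (@le_lt_trans _ _ (rnorm (q - p) * m)); last by rewrite -ltr_pdivlMr.
have h3 := rnorm_comp p.2 (q.1 - p.1); have h4 := rnorm_comp (q.2 - p.2) q.1.
have h5 : rnorm q.1 <= rnorm p.1 + 1.
  by have := rnormD (q.1 - p.1) p.1; rewrite subrK -[q.1 - p.1]/((q - p).1); lra.
apply: (le_trans (rnormD _ _)).
have -> : rnorm (q - p) * m = rnorm p.2 * rnorm (q - p) +
    rnorm (q - p) * (rnorm p.1 + 1) by rewrite /m; ring.
apply: lerD.
  by apply: (le_trans h3); apply: ler_wpM2l h1; exact: rnorm_ge0.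
apply: (le_trans h4); apply: ler_pM h2 h5; exact: rnorm_ge0.
Qed.

End AnalyticMore.

(** * Local frames of the determinant bundle *)

Section Frames.
Variables (R : realType) (k : scalar_kind).
Local Notation K := (scalars R k).

Lemma chart_basis (V W : normedModType K) (X : subspace W) (P : bop V V)
    (T : bop V W) (u : seq V) :
  chart_dom X P T -> (forall x, x \in u -> X (T x)) -> is_basis (lran P) (map P u) ->
  is_basis (lpreim T X) u.
Proof.
move=> [_ inj sur] uX yP.
have z0 : is_basis (zero_space V) [::].
  apply: basis_intro => // [x ->|]; first exact: ss0.
  by apply/independent_blade => c _ [].
apply: (@ses_basis_mid _ _ _ P (zero_space V) (lpreim T X) (lran P) _ [::]) => //.
split=> [x|y]; split.
- by move=> ->; split; [exact: ss0|exact: bop0].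
- by move=> [Xx Px]; apply: inj.
- by move=> /sur[x [Xx Px]]; exists x.
- by move=> [x _ <-]; exists x.
Qed.

(** For a basis u0 of T0^-1 X which P maps to y, the vectors u0_i - E(T) T u0_i
    are in T^-1 X because T E(T) is the identity modulo X, and have the same
    images under P because P E(T) = 0. *)
Lemma chart_family (V W : hilbertType R k) (X : subspace W) (P : bop V V)
    (T0 : bop V W) (y : seq V) :
  finite_dim X -> is_basis (lran P) y -> (forall x, P (P x) = P x) ->
  chart_dom X P T0 ->
  exists (E : bop V W -> bop W V) (u : nat -> bop V W -> V),
    [/\ analytic E T0, forall i, analytic (u i) T0
    & exists2 d : R, 0 < d & forall T : bop V W, rnorm (T - T0) < d ->
      [/\ chart_dom X P T, forall w, X (T (E T w) - w),
          is_basis (lpreim T X) (mkseq (u^~ T) (size y))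
        & map P (mkseq (u^~ T) (size y)) = y]].
Proof.
move=> fX yP PP dom0; have [Pr [PrX PrE]] := hilbert_projector fX.
have [||Q QE] := @bop_intro R k W W (fun w => w - Pr w).
- move=> a w z; rewrite bopD bopZ opprD addrACA scalerBr//.
- exists (1 + rnorm Pr) => w; rewrite mulrDl mul1r.
  exact: le_trans (rnormB _ _) (lerD (lexx _) (rnorm_bop _ _)).
have XQ w : X (w - Q w) by rewrite QE opprB addrC subrK; exact: PrX.
have QX w : X w -> Q w = 0 by move=> Xw; rewrite QE PrE// subrr.
have fP : finite_dim (lran P) by exists y.
have [E [Ea [d d0 EP]]] := chart_analytic XQ QX fX fP dom0.
have lift z : lran P z -> exists2 x, lpreim T0 X x & P x = z.
  by have [_ _ sur] := dom0; move=> /sur[x [Xx Px]]; exists x.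
have [u0 u0X u0y] := lift_seq lift (fun x xy => basis_mem yP xy).
exists E, (fun i T => u0`_i - E T (T u0`_i)); split=> //.
  move=> i; apply: analyticB; first exact: analytic_cst.
  apply: analytic_apply => //; apply: analytic_apply; first exact: analytic_id.
  exact: analytic_cst.
exists d => // T /EP[dom EX PE].
have uE : mkseq (fun i => u0`_i - E T (T u0`_i)) (size y) =
    map (fun x => x - E T (T x)) u0.
  rewrite -u0y size_map; apply: (@eq_from_nth _ 0).
    by rewrite size_mkseq size_map.
  by move=> i; rewrite size_mkseq => iu; rewrite nth_mkseq// (nth_map 0).
have Pu : map P (map (fun x => x - E T (T x)) u0) = y.
  rewrite -map_comp -u0y; apply/eq_map => x /=.
  by rewrite bopB PE subr0.
split=> //; rewrite uE//.
apply: (chart_basis dom); last by rewrite Pu.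
move=> _ /mapP[x _ ->]; rewrite bopB -opprB; apply: ssN; exact: EX.
Qed.

Lemma comparison_analytic (B V W : normedModType K) (a : B) (S : B -> bop V W)
    (E : B -> bop W V) (u : nat -> B -> V) (x' : nat -> B -> W) (n m n' N : nat)
    (l : nat -> bop V K^o) (xi : nat -> bop W K^o) :
  analytic S a -> analytic E a -> (forall i, analytic (u i) a) ->
  (forall i, analytic (x' i) a) ->
  analytic (fun b => \det (\matrix_(i < N, j < N)
    ((if (j < n')%N
      then l j ((map (graph_map (S b)) (mkseq (u^~ b) n) ++
                 map (defect_map (S b) (E b)) (mkseq (x'^~ b) m))`_i).1
      else xi (j - n')%N ((map (graph_map (S b)) (mkseq (u^~ b) n) ++
                 map (defect_map (S b) (E b)) (mkseq (x'^~ b) m))`_i).2) : K)) : K^o) a.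
Proof.
move=> Sa Ea ua xa; apply: analytic_det => i j.
have nthE b : (map (graph_map (S b)) (mkseq (u^~ b) n) ++
    map (defect_map (S b) (E b)) (mkseq (x'^~ b) m))`_i =
    if (i < n)%N then (u i b, S b (u i b)) else
    if (i - n < m)%N then (E b (x' (i - n)%N b),
      S b (E b (x' (i - n)%N b)) - x' (i - n)%N b) else 0.
  rewrite nth_cat size_map size_mkseq; case: ltnP => ni.
    by rewrite (nth_map 0) ?size_mkseq// nth_mkseq.
  case: ltnP => mi; last by rewrite nth_default// size_map size_mkseq.
  by rewrite (nth_map 0) ?size_mkseq// nth_mkseq.
pose p1 b := if (i < n)%N then u i b else
  if (i - n < m)%N then E b (x' (i - n)%N b) else 0.
pose p2 b := if (i < n)%N then S b (u i b) else
  if (i - n < m)%N then S b (E b (x' (i - n)%N b)) - x' (i - n)%N b else 0.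
have p1a : analytic p1 a.
  rewrite /p1; case: (i < n)%N => //.
  by case: (i - n < m)%N; [exact: analytic_apply|exact: analytic_cst].
have p2a : analytic p2 a.
  rewrite /p2; case: (i < n)%N; first exact: analytic_apply.
  case: (i - n < m)%N; last exact: analytic_cst.
  by apply: analyticB => //; apply: analytic_apply => //; exact: analytic_apply.
case: (j < n')%N.
  have := analytic_apply (analytic_cst a (l j)) p1a.
  congr analytic; apply/funext => b; rewrite nthE /p1.
  by case: ifP => // _; case: ifP.
have := analytic_apply (analytic_cst a (xi (j - n')%N)) p2a.
congr analytic; apply/funext => b; rewrite nthE /p2.
by case: ifP => // _; case: ifP.
Qed.

Section FrameValues.
Variables V W : normedModType K.
Implicit Types (X : subspace W) (P : bop V V) (T : bop V W).

(** The coefficient of theta on the blade of u is that of theta0 = P_* theta on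
    the blade of y = P u, which is independent of T. *)
Lemma frame_value X P theta0 (xi : Det X) y x :
  finite_dim X -> is_basis (lran P) y -> is_basis X x ->
  generates (lran P) theta0 -> xi <> 0 -> exists2 c : K, c != 0 &
    forall T (s : DetF T) theta u, transversal X T ->
      generates (lpreim T X) theta -> ext_map P theta = theta0 ->
      psi X s = in_Det (lpreim T X) theta ⊗ dual_gen xi ->
      is_basis (lpreim T X) u -> map P u = y ->
      forall e, psi X e = det_elt (lpreim T X) X (blade u) (blade x) -> s = c *: e.
Proof.
move=> fX yP bx g0 xi0; have [a a0 aE] := generatesP yP g0.
have gxi := Det_gen xi0; have [b b0 bE] := generatesP bx gxi.
exists (a / b); first by rewrite mulf_neq0// invr_eq0.
move=> T s theta u TX gth Pth ps bu uy e pe.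
have [a' a'0 a'E] := generatesP bu gth.
have aa : a' = a.
  apply/eqP; rewrite -subr_eq0; apply/negPn/negP => d0.
  apply: (basis_neq0 yP); apply: (scalerI d0); rewrite scaler0 scalerBl -aE -Pth.
  by rewrite a'E ext_mapZ ext_map_blade uy subrr.
have [pl _] := psiP TX fX; apply: (bij_inj (psi_bij TX fX)).
rewrite linear_scale// pe ps a'E aa -(in_Det_val xi0) bE.
apply: det_eltZ => //; exact: generates_blade.
Qed.

Lemma psi_surj X T q : transversal X T -> finite_dim X ->
  exists e : DetF T, psi X e = q.
Proof. by move=> TX fX; have [g _ gK] := psi_bij TX fX; exists (g q). Qed.

End FrameValues.

(** For a finite dimensional X transversal to T0, a projector onto T0^-1 X defines
    a frame near T0. *)
Lemma frame_exists (V W : hilbertType R k) (T0 : bop V W) : fredholm T0 ->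
  exists U s, frame (Det_bundle V W) U s /\ U T0.
Proof.
move=> fT; have [X fX TX] := fredholm_transversal fT.
have fN := finite_dim_preim TX fX; have [P [PN PE]] := hilbert_projector fN.
have PP x : P (P x) = P x by apply: PE.
have ranP x : lran P x <-> lpreim T0 X x.
  by split=> [[z <-]|Xx]; [exact: PN|exists x; exact: PE].
have fP : finite_dim (lran P) by apply: finite_dim_sub fN => x /ranP.
have [y yP] := fP; have [x bx] := fX.
pose U : set (bop V W) := transversal X `&`
  [set T | (forall x, X (T x) -> P x = 0 -> x = 0) /\
           (forall y, lran P y -> exists x, X (T x) /\ P x = y)].
pose good T (v : DetF T) := exists theta,
  [/\ generates (lpreim T X) theta, ext_map P theta = blade y
    & psi X v = in_Det (lpreim T X) theta ⊗ dual_gen (in_Det X (blade x))].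
pose s T : DetF T := xget 0 [set v : DetF T | good T v].
exists U, s; split; last first.
  split=> //; split=> [z Xz|z Pz].
    by rewrite PE// => Xz'.
  by exists z; split; [exact/ranP|apply: PE; exact/ranP].
exists X; split=> //.
exists P, (blade y), (in_Det X (blade x)); split=> //.
- exact: generates_blade.
- have [] := line_gen_Det fX (generates_blade bx); exact.
move=> T [TX' [inj sur]]; rewrite /s; case: xgetP => [v _ //|H].
have dom : chart_dom X P T by split.
have lift z : lran P z -> exists2 v, lpreim T X v & P v = z.
  by move=> /sur[v [Xv Pv]]; exists v.
have [u uX uy] := lift_seq lift (fun x xy => basis_mem yP xy).
have bu : is_basis (lpreim T X) u by apply: (chart_basis dom) => //; rewrite uy.
have [v vE] := psi_surj (in_Det (lpreim T X) (blade u) ⊗ dual_gen (in_Det X (blade x))) TX' fX.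
case: (H v); exists (blade u); split=> //; first exact: generates_blade.
by rewrite ext_map_blade uy.
Qed.

End Frames.

(** * The map phi in local frames *)

Section PhiInFrames.
Variables (R : realType) (k : scalar_kind).
Local Notation K := (scalars R k).

(** The determinant of comparison_det: up to sign, the ratio of the elements of
    Det S given by two pairs of bases. *)
Definition ratio_det (V W : normedModType K) (S : bop V W) (E : bop W V)
    (u : seq V) (x' : seq W) (l : nat -> bop V K^o) (xi : nat -> bop W K^o)
    (n' N : nat) : K :=
  \det (\matrix_(i < N, j < N)
    ((if (j < n')%N
      then l j ((map (graph_map S) u ++ map (defect_map S E) x')`_i).1
      else xi (j - n')%N ((map (graph_map S) u ++ map (defect_map S E) x')`_i).2)
      : K)).

(** The section E' of S modulo X' with P' E' = 0 makes the forms l P', which are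
    dual to u', vanish on its values. *)
Lemma chart_ratio (V W : normedModType K) (S : bop V W) (X X' : subspace W)
    (E : bop W V) (P' : bop V V) u x u' x' y'
    (l : nat -> bop V K^o) (xi : nat -> bop W K^o) (e e' : DetF S) :
  finite_dim X -> finite_dim X' -> transversal X S -> transversal X' S ->
  (forall x, X' (S x) -> P' x = 0 -> x = 0) ->
  (forall y, lran P' y -> exists x, X' (S x) /\ P' x = y) ->
  (forall w, X (S (E w) - w)) ->
  is_basis (lpreim S X) u -> is_basis X x ->
  is_basis (lpreim S X') u' -> is_basis X' x' -> map P' u' = y' ->
  psi X e = det_elt (lpreim S X) X (blade u) (blade x) ->
  psi X' e' = det_elt (lpreim S X') X' (blade u') (blade x') ->
  (forall i j, (i < size y')%N -> (j < size y')%N -> l i y'`_j = (i == j)%:R) ->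
  (forall i j, (i < size x)%N -> (j < size x)%N -> xi i x`_j = (i == j)%:R) ->
  e = ((-1) ^+ (size x * size x') *
    ratio_det S E u x' (fun i => bop_comp (l i) P') xi (size u') (size u' + size x))
    *: e'.
Proof.
move=> fX fX' SX SX' inj sur EX bu bx bu' bx' uy pe pe' ly xix.
have sy : size u' = size y' by rewrite -uy size_map.
have [||E' [EX' PE']] := @algebraic_section _ _ _ _ S X' P' SX'.
- exact: inj.
- by move=> z; have [|v [Xv Pv]] := sur (P' z); [exists z|exists v].
apply: (comparison_det fX fX' SX SX' (E := E) (E' := E') EX EX' bu bx bu' bx' pe pe'
  (l := fun i => bop_comp (l i) P') (xi := fun i => xi i) _ xix).
- move=> i j iu ju; rewrite -[LHS]/(l i (P' u'`_j)).
  by rewrite -(nth_map 0 0 P' ju) uy ly// -sy.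
- move=> i w _; rewrite -[LHS]/(l i (P' (E' w))).
  by rewrite PE' bop0.
Qed.

Variables V1 V2 V3 : normedModType K.
Variables (S : bop V1 V2) (T : bop V2 V3).
Local Notation TS := (bop_comp T S).

(** With N = T^-1 X3, the ratio of phi in frames factors through the frame of
    Det S defined by N and the frame of Det T defined by X3. *)
Lemma phi_in_frames (X1 : subspace V2) (X2 X3 : subspace V3)
    (E1 : bop V2 V1) (E2 : bop V3 V2) (P3 : bop V1 V1) (PN : bop V2 V2)
    u1 x1 u2 x2 u3 x3 n y3 yN (l3 : nat -> bop V1 K^o) (lN : nat -> bop V2 K^o)
    (xi1 : nat -> bop V2 K^o) (xi2 : nat -> bop V3 K^o) e1 e2 e3 :
  fredholm S -> fredholm T ->
  finite_dim X1 -> finite_dim X2 -> finite_dim X3 ->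
  transversal X1 S -> transversal X2 T ->
  chart_dom X3 P3 TS -> chart_dom X3 PN T ->
  (forall w, X1 (S (E1 w) - w)) -> (forall w, X2 (T (E2 w) - w)) ->
  is_basis (lpreim S X1) u1 -> is_basis X1 x1 ->
  is_basis (lpreim T X2) u2 -> is_basis X2 x2 ->
  is_basis (lpreim TS X3) u3 -> is_basis X3 x3 -> is_basis (lpreim T X3) n ->
  map P3 u3 = y3 -> map PN n = yN ->
  psi X1 e1 = det_elt (lpreim S X1) X1 (blade u1) (blade x1) ->
  psi X2 e2 = det_elt (lpreim T X2) X2 (blade u2) (blade x2) ->
  psi X3 e3 = det_elt (lpreim TS X3) X3 (blade u3) (blade x3) ->
  (forall i j, (i < size y3)%N -> (j < size y3)%N -> l3 i y3`_j = (i == j)%:R) ->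
  (forall i j, (i < size yN)%N -> (j < size yN)%N -> lN i yN`_j = (i == j)%:R) ->
  (forall i j, (i < size x1)%N -> (j < size x1)%N -> xi1 i x1`_j = (i == j)%:R) ->
  (forall i j, (i < size x2)%N -> (j < size x2)%N -> xi2 i x2`_j = (i == j)%:R) ->
  phi S T (e1 ⊗ e2) =
    (((-1) ^+ (size x1 * size n) * ratio_det S E1 u1 n
        (fun i => bop_comp (l3 i) P3) xi1 (size u3) (size u3 + size x1)) *
     ((-1) ^+ (size x2 * size x3) * ratio_det T E2 u2 x3
        (fun i => bop_comp (lN i) PN) xi2 (size n) (size n + size x2))) *: e3.
Proof.
move=> fS fT f1 f2 f3 SX1 TX2 [TSX inj3 sur3] [TX3 injN surN] E1X E2X b1 bx1 b2 bx2
  b3 bx3 bn u3y ny p1 p2 p3 l3y lNy xi1x xi2x.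
have fN : finite_dim (lpreim T X3) by exists n.
have SN := transversal_comp_r fS TSX.
have b3' : is_basis (lpreim S (lpreim T X3)) u3 by rewrite -preim_comp.
have [d1 d1E] := psi_surj (det_elt (lpreim S (lpreim T X3)) (lpreim T X3)
  (blade u3) (blade n)) SN fN.
have [d2 d2E] := psi_surj (det_elt (lpreim T X3) X3 (blade n) (blade x3)) TX3 f3.
have r1 := chart_ratio f1 fN SX1 SN inj3 sur3 E1X b1 bx1 b3' bn u3y p1 d1E l3y xi1x.
have r2 := chart_ratio f2 f3 TX2 TX3 injN surN E2X b2 bx2 bn bx3 ny p2 d2E lNy xi2x.
have [pl _] := phiP fS fT.
have c := phi_contracts fS fT TSX f3 (generates_blade b3) (generates_blade bn)
  (generates_blade bx3) d1E d2E p3.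
by rewrite r1 r2 tensZl tensZr scalerA linear_scale// c.
Qed.

End PhiInFrames.

Section LocalRatio.
Variables (R : realType) (k : scalar_kind) (H1 H2 H3 : hilbertType R k).
Local Notation K := (scalars R k).
Local Notation B := (bop H1 H2 * bop H2 H3)%type.

Lemma scalar_regroup (F : fieldType) (a1 a2 a3 e1 e2 r1 r2 : F) : a3 != 0 ->
  a1 * a2 * (e1 * r1 * (e2 * r2)) = a1 * a2 / a3 * (e1 * e2) * (r1 * r2) * a3.
Proof. by move=> a30; field. Qed.

Lemma frame_data (V W : hilbertType R k) (U : set (bop V W))
    (s : forall T, DetF T) T0 : frame (Det_bundle V W) U s -> U T0 ->
  exists (X : subspace W) (P : bop V V) (y : seq V) (x : seq W) (c : K),
    [/\ finite_dim X, forall x, P (P x) = P x, is_basis (lran P) y,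
        is_basis X x /\ c != 0 & chart_dom X P T0 /\
        forall T u e, chart_dom X P T -> is_basis (lpreim T X) u -> map P u = y ->
          psi X e = det_elt (lpreim T X) X (blade u) (blade x) -> s T = c *: e].
Proof.
move=> [X [fX [P [th0 [xi [[PP [y yP]] g0 xi0 -> sP]]]]]] [TX [inj sur]].
have [x bx] := fX; have [c c0 cP] := frame_value fX yP bx g0 xi0.
exists X, P, y, x, c; split=> //; split; first by split.
move=> T u e [TX' inj' sur'] bu uy pe.
have [|th [gth Pth pth]] := sP T; first by split.
exact: cP TX' gth Pth pth bu uy e pe.
Qed.

(** The intermediate space N = T^-1 X3 of phi_in_frames varies with T; a basis of
    it depending analytically on T comes from the chart of a projector onto its
    value at the given point. *)
Lemma local_ratio (b : B) U1 s1 U2 s2 V t :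
  fredholm b.1 -> fredholm b.2 ->
  frame (Det_bundle H1 H2) U1 s1 -> U1 b.1 ->
  frame (Det_bundle H2 H3) U2 s2 -> U2 b.2 ->
  frame (Det_bundle H1 H3) V t -> V (bop_comp b.2 b.1) ->
  exists2 g : B -> K, analytic (g : B -> K^o) b
    & exists2 d : R, 0 < d & forall b' : B, rnorm (b' - b) < d ->
      phi b'.1 b'.2 (s1 b'.1 ⊗ s2 b'.2) = g b' *: t (bop_comp b'.2 b'.1).
Proof.
move=> fS0 fT0 fr1 U1b fr2 U2b fr3 Vb.
have [X1 [P1 [y1 [x1 [c1 [fX1 PP1 by1 [bx1 c10] [dom1 s1E]]]]]]] := frame_data fr1 U1b.
have [X2 [P2 [y2 [x2 [c2 [fX2 PP2 by2 [bx2 c20] [dom2 s2E]]]]]]] := frame_data fr2 U2b.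
have [X3 [P3 [y3 [x3 [c3 [fX3 PP3 by3 [bx3 c30] [dom3 tE]]]]]]] := frame_data fr3 Vb.
have [TSX0 _ _] := dom3; have TX0 := transversal_comp_l fT0 TSX0.
have fN := finite_dim_preim TX0 fX3; have [PN [PNN PNE]] := hilbert_projector fN.
have domN : chart_dom X3 PN b.2.
  split=> // [x Xx|y [z <-]]; first by rewrite PNE.
  exists (PN z); split; first exact: PNN.
  by apply: PNE; exact: PNN.
have PPN x : PN (PN x) = PN x by apply: PNE.
have [yN byN] : finite_dim (lran PN).
  by apply: finite_dim_sub fN => _ [z <-]; exact: PNN.
have [E1 [u1 [E1a u1a [d1 d10 E1P]]]] := chart_family fX1 by1 PP1 dom1.
have [E2 [u2 [E2a u2a [d2 d20 E2P]]]] := chart_family fX2 by2 PP2 dom2.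
have [EN [n [ENa na [dN dN0 ENP]]]] := chart_family fX3 byN PPN domN.
have [E3 [u3 [_ _ [d3 d30 E3P]]]] := chart_family fX3 by3 PP3 dom3.
have [d4 d40 d4P] := comp_continuous b d30.
have [l3 l3P] := hilbert_dual_family (basis_neq0 by3).
have [lN lNP] := hilbert_dual_family (basis_neq0 byN).
have [xi1 xi1P] := hilbert_dual_family (basis_neq0 bx1).
have [xi2 xi2P] := hilbert_dual_family (basis_neq0 bx2).
pose q1 (b' : B) : K := ratio_det b'.1 (E1 b'.1) (mkseq (u1^~ b'.1) (size y1))
  (mkseq (n^~ b'.2) (size yN)) (fun i => bop_comp (l3 i) P3) xi1
  (size y3) (size y3 + size x1).
pose q2 (b' : B) : K := ratio_det b'.2 (E2 b'.2) (mkseq (u2^~ b'.2) (size y2))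
  (mkseq (fun i => x3`_i) (size x3)) (fun i => bop_comp (lN i) PN) xi2
  (size yN) (size yN + size x2).
have q1a : analytic (q1 : B -> K^o) b.
  apply: (comparison_analytic (S := fst) (E := fun b' : B => E1 b'.1)
    (u := fun i (b' : B) => u1 i b'.1) (x' := fun i (b' : B) => n i b'.2)).
  - exact: analytic_fst (analytic_id _).
  - exact: analytic_fst E1a.
  - by move=> i; exact: analytic_fst (u1a i).
  - by move=> i; exact: analytic_snd (na i).
have q2a : analytic (q2 : B -> K^o) b.
  apply: (comparison_analytic (S := snd) (E := fun b' : B => E2 b'.2)
    (u := fun i (b' : B) => u2 i b'.2) (x' := fun i (_ : B) => x3`_i)).
  - exact: analytic_snd (analytic_id _).
  - exact: analytic_snd E2a.
  - by move=> i; exact: analytic_snd (u2a i).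
  - by move=> i; exact: analytic_cst.
pose c : K := c1 * c2 / c3 * ((-1) ^+ (size x1 * size yN) * (-1) ^+ (size x2 * size x3)).
exists (fun b' => c * (q1 b' * q2 b')).
  apply: analyticZ; first exact: analytic_cst.
  exact: (analyticZ q1a q2a).
exists (Num.min (Num.min d1 d2) (Num.min dN d4)).
  by rewrite !lt_min d10 d20 dN0 d40.
move=> b' ; rewrite !lt_min => /andP[/andP[h1 h2] /andP[hN h4]].
have /E1P[D1 E1X bu1 u1y] := le_lt_trans (rnorm_fst (b' - b)) h1.
have /E2P[D2 E2X bu2 u2y] := le_lt_trans (rnorm_snd (b' - b)) h2.
have /ENP[DN _ bn ny] := le_lt_trans (rnorm_snd (b' - b)) hN.
have /E3P[D3 _ bu3 u3y] := d4P _ h4.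
have [SX1 _ _] := D1; have [TX2 _ _] := D2; have [TSX3 _ _] := D3.
have [e1 e1E] := psi_surj (det_elt (lpreim b'.1 X1) X1
  (blade (mkseq (u1^~ b'.1) (size y1))) (blade x1)) SX1 fX1.
have [e2 e2E] := psi_surj (det_elt (lpreim b'.2 X2) X2
  (blade (mkseq (u2^~ b'.2) (size y2))) (blade x2)) TX2 fX2.
have [e3 e3E] := psi_surj (det_elt (lpreim (bop_comp b'.2 b'.1) X3) X3
  (blade (mkseq (u3^~ (bop_comp b'.2 b'.1)) (size y3))) (blade x3)) TSX3 fX3.
rewrite (s1E _ _ _ D1 bu1 u1y e1E) (s2E _ _ _ D2 bu2 u2y e2E) (tE _ _ _ D3 bu3 u3y e3E).
have := phi_in_frames SX1.1 TX2.1 fX1 fX2 fX3 SX1 TX2 D3 DN E1X E2X bu1 bx1 bu2 bx2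
  bu3 bx3 bn u3y ny e1E e2E e3E l3P lNP xi1P xi2P.
have [pl _] := phiP SX1.1 TX2.1.
rewrite !size_mkseq => E.
rewrite tensZl tensZr scalerA linear_scale// E !scalerA; congr (_ *: _).
rewrite /c /q1 /q2 mkseq_nth; set r1 := ratio_det _ _ _ _ _ _ _ _.
set r2 := ratio_det _ _ _ _ _ _ _ _.
exact: scalar_regroup c30.
Qed.

End LocalRatio.

Theorem mainTheorem7 (R : realType) (k : scalar_kind)
    (H1 H2 H3 : hilbertType R k) :
  (forall (S : bop H1 H2) (T : bop H2 H3), fredholm S -> fredholm T ->
     is_phi S T (phi S T) /\ bijective (phi S T)) /\
  analytic_bundle_morphism
    (E := ext_tensor (Det_bundle H1 H2) (Det_bundle H2 H3))
    (F := Det_bundle H1 H3)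
    (f := fun ST : bop H1 H2 * bop H2 H3 => bop_comp ST.2 ST.1)
    (fun ST => phi ST.1 ST.2).
Proof.
split.
  move=> S T fS fT; split; first exact (phiP fS fT).
  exact (is_phi_bij fS fT (phiP fS fT)).
split.
- move=> b [fS fT]; split; first exact: (fredholm_comp fS fT).
  exact (analytic_analytic_at (analytic_comp_bop b)).
- by move=> b [fS fT]; exact (phiP fS fT).1.
- move=> b [fS fT]; split.
    have [U1 [s1 [fr1 Ub1]]] := frame_exists fS.
    have [U2 [s2 [fr2 Ub2]]] := frame_exists fT.
    exists (U1 `*` U2), (fun b => s1 b.1 ⊗ s2 b.2); split=> //.
    by exists U1, s1, U2, s2.
  exact: frame_exists (fredholm_comp fS fT).
- move=> b U s V t [fS fT] [U1 [s1 [U2 [s2 [fr1 fr2 -> sE]]]]] [Ub1 Ub2] fr3 Vb.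
  have [g ga [d d0 gE]] := local_ratio fS fT fr1 Ub1 fr2 Ub2 fr3 Vb.
  exists g; first exact (analytic_analytic_at ga).
  apply/nearP; exists d => // b' b'd.
  by rewrite sE; exact: gE.
Qed.
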